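(* Let $n\ge1$ be an integer, let $0<\kappa<8/(2n+1)$, and let $x,y\in\mathbb{R}$ with $x\ne y$. Let $g_\tau(z)=z+a_1z^{-1}+a_2z^{-2}+\cdots$ be the expansion at $\infty$ of the stopped Loewner map of SLE$_\kappa(\kappa-6)$ started from $X_0=x$, $Y_0=y$, stopped at $\tau=\inf\{t\ge0:|Y_s-X_s|\to0\text{ as }s\nearrow t\}$. Then $$\mathbb{E}[a_1^n]=\frac{2^n(x-y)^{2n}}{(8-3\kappa)(8-5\kappa)\cdots(8-(2n+1)\kappa)}.$$
   Context: SLE$_\kappa(\rho)$ started from $(x,y)$ (here with $\rho=\kappa-6$): let $B_t$ be a standard one-dimensional Brownian motion and let $(X_t,Y_t)$ solve, for $t<\tau$, $$dX_t=\sqrt{\kappa}\,dB_t+\frac{\rho\,dt}{X_t-Y_t},\qquad dY_t=\frac{2\,dt}{Y_t-X_t},\qquad X_0=x,\ Y_0=y,$$ where $\tau=\inf\{t\ge0:|Y_s-X_s|\to0 \text{ as } s\nearrow t\}$. The Loewner maps $g_t$ solve $$\partial_t g_t(z)=\frac{2}{g_t(z)-X_t},\qquad g_0(z)=z,\quad z\in\mathbb{H}=\{z\in\mathbb{C}:\mathrm{Im}(z)>0\},$$ so $g_t$ maps $\mathbb{H}\setminus K_t$ conformally onto $\mathbb{H}$ with $g_t(z)=z+2t/z+\cdots$ at $\infty$, where $K_t$ is the set of $z\in\mathbb{H}$ for which the solution does not exist up to and including time $t$. For $\rho=\kappa-6$ and $0<\kappa<8$ one has $\tau<\infty$ almost surely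 and $g_\tau$ is well-defined; in particular $a_1=2\tau$. *)

(* Defs.v *)
From HB Require Import structures.
From mathcomp Require Import all_boot all_order all_algebra.
From mathcomp Require Import complex.
From mathcomp Require Import all_classical all_reals all_analysis.

Set Implicit Arguments.
Unset Strict Implicit.
Unset Printing Implicit Defensive.

Import Order.TTheory GRing.Theory Num.Theory.
Import numFieldNormedType.Exports.

Local Open Scope classical_set_scope.
Local Open Scope ring_scope.
Local Open Scope complex_scope.

(* Time is modelled by R; only times t >= 0 are ever used. *)

Definition filtration (R : realType) d (T : measurableType d)
    (F : R -> set_system T) : Prop :=
  [/\ forall t, 0 <= t -> sigma_algebra setT (F t),
      forall t, 0 <= t -> F t `<=` d.-measurable
    & forall s t, 0 <= s <= t -> F s `<=` F t].

(* Standard one-dimensional Brownian motion relative to F.  The second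
   argument of normal_prob is the standard deviation. *)
Record brownian_motion (R : realType) d (T : measurableType d)
    (P : probability T R) (F : R -> set_system T) (B : R -> T -> R) : Prop := {
  bm_filtration : filtration F ;
  bm_adapted : forall (t : R) (A : set R), 0 <= t -> measurable A ->
    F t (B t @^-1` A) ;
  bm_start : {ae P, forall w, B 0 w = 0} ;
  bm_continuous : {ae P, forall w, {within `[0, +oo[, continuous (B ^~ w)}} ;
  bm_gaussian : forall (s t : R) (A : set R), 0 <= s < t -> measurable A ->
    P [set w | A (B t w - B s w)] = normal_prob 0 (Num.sqrt (t - s)) A ;
  bm_independent : forall (s t : R) (E : set T) (A : set R),
    0 <= s < t -> F s E -> measurable A ->
    P (E `&` [set w | A (B t w - B s w)]) =
      (P E * P [set w | A (B t w - B s w)%R])%E }.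

(* The times t at which |Y_s - X_s| -> 0 as s increases to t.  For t = 0 there
   is no s in [0, t), so that only t > 0 is meaningful. *)
Definition collision_times (R : realType) (X Y : R -> R) : set R :=
  [set t | 0 < t /\ `|Y s - X s| @[s --> t^'-] --> 0].

Definition collision_time (R : realType) (X Y : R -> R) : \bar R :=
  ereal_inf (EFin @` collision_times X Y).

(* One trajectory of the SDE, driven by the trajectory b.  The noise is
   additive, so the SDE is the integral equation below, with no stochastic
   integral.  X and Y are meaningful on [0, tau) only, and their values from tau
   on are arbitrary; the last field says that a finite tau is a collision of
   the solution itself, and not an accumulation point of collisions of these
   arbitrary values. *)
Record sle_trajectory (R : realType) (kappa rho x y : R) (b X Y : R -> R) :
    Prop := {
  sle_startX : X 0 = x ;
  sle_startY : Y 0 = y ;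
  sle_continuous : forall t : R, 0 <= t -> (t%:E < collision_time X Y)%E ->
    {within `[0, t], continuous X} /\ {within `[0, t], continuous Y} ;
  sle_eqX : forall t : R, 0 <= t -> (t%:E < collision_time X Y)%E ->
    X t = x + Num.sqrt kappa * b t
          + \int[lebesgue_measure]_(s in `[0, t]) (rho / (X s - Y s)) ;
  sle_eqY : forall t : R, 0 <= t -> (t%:E < collision_time X Y)%E ->
    Y t = y + \int[lebesgue_measure]_(s in `[0, t]) (2 / (Y s - X s)) ;
  sle_collision : (collision_time X Y < +oo)%E ->
    collision_times X Y (fine (collision_time X Y)) }.

(* SLE_kappa(rho) started from (x, y): a solution of the SDE driven by the
   F-Brownian motion B, adapted to F as a process living on [0, tau). *)
Record sle_kappa_rho (R : realType) d (T : measurableType d)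
    (P : probability T R) (F : R -> set_system T) (B : R -> T -> R)
    (kappa rho x y : R) (X Y : R -> T -> R) : Prop := {
  sle_brownian : brownian_motion P F B ;
  sle_adaptedX : forall (t : R) (A : set R), 0 <= t -> measurable A ->
    F t [set w | (t%:E < collision_time (X ^~ w) (Y ^~ w))%E /\ A (X t w)] ;
  sle_adaptedY : forall (t : R) (A : set R), 0 <= t -> measurable A ->
    F t [set w | (t%:E < collision_time (X ^~ w) (Y ^~ w))%E /\ A (Y t w)] ;
  sle_solution : {ae P, forall w,
    sle_trajectory kappa rho x y (B ^~ w) (X ^~ w) (Y ^~ w)} }.

(* The solution u(s) = g_s(z) of the Loewner equation driven by W, up to and
   including time t.  The value W t is not used, so that t may be the lifetime
   of W.  Solutions which exist up to and including t are those which stay in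
   the upper half-plane.  R[i] is not a normed space over R in the library,
   hence the derivative in s is taken componentwise; the topology of R[i] is
   the one of R[i]^o. *)
Record loewner_solution (R : realType) (W : R -> R) (t : R) (z : R[i])
    (u : R -> R[i]) : Prop := {
  loewner_start : u 0 = z ;
  loewner_in_H : forall s : R, 0 <= s <= t -> 0 < complex.Im (u s) ;
  loewner_continuous : {within `[0, t], continuous (u : R -> R[i]^o)} ;
  loewner_eqRe : forall s : R, 0 < s < t ->
    is_derive s 1 (fun r : R => complex.Re (u r))
      (complex.Re (2 / (u s - (W s)%:C))) ;
  loewner_eqIm : forall s : R, 0 < s < t ->
    is_derive s 1 (fun r : R => complex.Im (u r))
      (complex.Im (2 / (u s - (W s)%:C))) }.

(* K_t *)
Definition loewner_hull (R : realType) (W : R -> R) (t : R) : set R[i] :=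
  [set z | 0 < complex.Im z /\ ~ exists u, loewner_solution W t z u].

(* g_t, with value 0 where the solution does not exist up to and including t *)
Definition loewner_map (R : realType) (W : R -> R) (t : R) (z : R[i]) : R[i] :=
  xget 0 [set v | exists u, loewner_solution W t z u /\ u t = v].

(* g is defined on the complement in the upper half-plane of the bounded set K,
   with g(z) = z + a_1 z^-1 + a_2 z^-2 + ... for z near infinity; a 0 is not
   used. *)
Definition expansion_at_infinity (R : realType) (K : set R[i])
    (g : R[i] -> R[i]) (a : nat -> R) : Prop :=
  exists M : R, forall z : R[i], 0 < complex.Im z -> M%:C < `|z| ->
    ~ K z /\
    (\sum_(1 <= k < m) (a k)%:C / z ^+ k : R[i]^o) @[m --> \oo]
      --> (g z - z : R[i]^o).

(* Main.v *)
Require Import Defs.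
From HB Require Import structures.
From mathcomp Require Import all_boot all_order all_algebra.
From mathcomp Require Import complex.
From mathcomp Require Import all_classical all_reals all_analysis.
From mathcomp Require Import measurable_realfun.
From mathcomp Require Import ring lra.
Import Order.TTheory GRing.Theory Num.Theory.
Import numFieldNormedType.Exports.
Local Open Scope classical_set_scope.
Local Open Scope ring_scope.

Set Implicit Arguments.
Unset Strict Implicit.
Unset Printing Implicit Defensive.

(* The distance V = |X - Y|, absorbed at 0, solves dV = sqrt(kappa) dB' - b dt / V
   with b = 4 - kappa, and its lifetime is tau.  The generator of V maps z^(2k) to
   - k (8 - (2k+1) kappa) z^(2k-2), and it annihilates z^a for a = 8/kappa - 1 > 2n,
   so that E[V_t^a] is constant.  With P(V_t > 0) -> 0 this gives E[V_t^(2k)] -> 0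
   for k <= n, hence
     E[V_t^(2k)] = k (8 - (2k+1) kappa) \int_t^oo E[V_s^(2k-2)] ds,   1 <= k <= n.
   Iterating from (x - y)^(2n) = E[V_0^(2n)] down to E[V_s^0] = P(s < tau), and
   exchanging integrals, yields E[tau^n]; finally a_1 = 2 tau.

   Without a stochastic integral, Dynkin's formula for the moments is obtained by
   a second order Taylor expansion over [t, t + h]: outside an event of
   probability O(h^2), on which the Brownian path oscillates too much on the
   interval, V moves by the increment of sqrt(kappa) B' and an explicit drift,
   and the increments of B' are Gaussian and independent of the past. *)

(** * The first coefficient of the Loewner map *)

Section loewner.
Local Open Scope complex_scope.
Variable R : realType.
Implicit Types (W : R -> R) (u : R -> R[i]) (t s r C : R).

(** The identity a_1 = 2 tau is not built into the hypotheses, which only give the convergence of a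
    series at each point near infinity. It is read off along the points i r, where the Loewner
    equation determines Im(g)^2 up to O(r^-2), provided that the driving function is bounded up to
    tau. Powers of V are unbounded, and in general not smooth at the absorbing point, where the
    drift is singular. Dynkin's formula is therefore proved for powers cut off near 0 and near
    infinity only. The cut-offs are such that the generator applied to the cut-off power is
    dominated by z^(a-2) uniformly in the cut-off parameter, so that they can be removed by Fatou's
    lemma and dominated convergence. An exceptional event of probability O(h^2) is affordable
    because a step may err by o(h); this is why fourth moments of the increments are used. The
    condition on kappa is 2n < 8/kappa - 1. A moment of order 2k is interpolated between P(V_t > 0)
    and the constant moment of order 8/kappa - 1, and P(V_t > 0) = O(1/t) holds because the second
    moment is nonnegative. *)

Lemma div2_complex (z : R[i]) (w : R) : 0 < complex.Im z ->
  2 / (z - w%:C) = (2 * (complex.Re z - w) / ((complex.Re z - w) ^+ 2 + complex.Im z ^+ 2))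
    -i* (2 * complex.Im z / ((complex.Re z - w) ^+ 2 + complex.Im z ^+ 2)).
Proof.
case: z => a b /= b0.
have d0 : 0 < (a - w) ^+ 2 + b ^+ 2.
  by rewrite ltr_wpDl ?sqr_ge0// exprn_gt0.
have z0 : (a +i* b - w%:C) != 0 :> R[i].
  by apply/eqP => -[_ /eqP]; rewrite subr0 (gt_eqF b0).
apply: (mulIf z0); rewrite divfK//.
simpc; apply/eqP; rewrite eq_complex /=; apply/andP; split; apply/eqP.
  by field; rewrite gt_eqF.
by field; rewrite gt_eqF.
Qed.

Lemma loewner_within_continuous W t z u : loewner_solution W t z u ->
  {within `[0, t], continuous (fun s => complex.Im (u s))} /\
  {within `[0, t], continuous (fun s => complex.Re (u s))}.
Proof.
move=> [_ _ cu _ _].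
have clip (f : R[i] -> R) : (forall a b : R[i], f a - f b = f (a - b)) ->
   (forall a : R[i], (`|f a|)%:C <= `|a|) ->
   {within `[0, t], continuous (fun s => f (u s))}.
  move=> fB fle x; apply/cvgrPdist_lt => e e0.
  have e0' : 0 < e%:C :> R[i] by rewrite ltcR.
  have /cvgrPdist_lt/(_ _ e0') := cu x.
  apply: filterS => y /= h.
  by rewrite fB -ltcR; apply: le_lt_trans h; exact: fle.
split; apply: clip.
- by case=> a b [c d].
- case => a b; simpc; rewrite -sqrtr_sqr.
  by apply: ler_wsqrtr; rewrite lerDr sqr_ge0.
- by case=> a b [c d].
- exact: normc_ge_Re.
Qed.

Section loewner_imag.
Variables (W : R -> R) (t C r : R) (u : R -> R[i]).
Hypotheses (t0 : 0 < t) (Cge0 : 0 <= C) (r1 : 1 <= r) (rt : 16 * t <= r ^+ 2).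
Hypothesis WC : forall s, 0 < s < t -> `|W s| <= C.
Hypothesis Lu : loewner_solution W t (0 +i* r) u.
Let X s := complex.Re (u s).
Let Y s := complex.Im (u s).
Let D s := (X s - W s) ^+ 2 + Y s ^+ 2.

Let Ygt0 s : 0 <= s <= t -> 0 < Y s. Proof. by case: Lu => _ + _ _ _; apply. Qed.

Let Dgt0 s : 0 <= s <= t -> 0 < D s.
Proof. by move=> /Ygt0 Ys; rewrite /D ltr_wpDl ?sqr_ge0// exprn_gt0. Qed.

Let within0 (f : R -> R) s : s <= t -> {within `[0, t], continuous f} ->
  {within `[0, s], continuous f}.
Proof.
by move=> st; apply: continuous_subspaceW; apply: subset_itvl; rewrite bnd_simp.
Qed.

Let dY s : 0 < s < t -> is_derive s 1 (fun q => Y q ^+ 2) (- 4 * (Y s ^+ 2 / D s)).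
Proof.
move=> st; have st' : 0 <= s <= t by lra.
have := @loewner_eqIm _ _ _ _ _ Lu _ st.
rewrite div2_complex ?Ygt0// => h.
apply: is_derive_eq; rewrite /= -/(X s) -/(Y s) -/(D s) /GRing.scale/=.
by field; rewrite gt_eqF// Dgt0.
Qed.

Let dX s : 0 < s < t -> is_derive s 1 X (2 * (X s - W s) / D s).
Proof.
move=> st; have st' : 0 <= s <= t by lra.
have := @loewner_eqRe _ _ _ _ _ Lu _ st.
by rewrite div2_complex ?Ygt0.
Qed.

(** With Y the imaginary part, (Y^2)' = -4 Y^2 / D, and Y^2 / D lies in [0, 1]; this gives the lower
    bound, and then Y >= r / 2 because 16 t <= r^2. Hence D >= r^2 / 4, so that 1 - Y^2 / D = (X -
    W)^2 / D is O(r^-2), which gives the upper bound. *)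
Lemma loewner_Im_sqr :
  r ^+ 2 - 4 * t <= Y t ^+ 2 <= r ^+ 2 - 4 * t + 16 * t * (C + 2 * t) ^+ 2 / r ^+ 2.
Proof.
move: (t0) (Cge0) (r1) (rt) => t0' C0' r1' rt'.
have r0 : 0 <= r by lra.
have [cY cX] := loewner_within_continuous Lu.
have X00 : X 0 = 0 by rewrite /X (loewner_start Lu).
have Y00 : Y 0 = r by rewrite /Y (loewner_start Lu).
have cY2 : {within `[0, t], continuous (fun q => Y q ^+ 2)}.
  by move=> x; apply: cvgM; exact: cY.
have mvtY s : 0 < s -> s <= t -> exists2 c, 0 < c < s &
    Y s ^+ 2 - r ^+ 2 = - 4 * (Y c ^+ 2 / D c) * s.
  move=> s0 st.
  have dYs x : x \in `]0, s[%R ->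
      is_derive x 1 (fun q => Y q ^+ 2) (- 4 * (Y x ^+ 2 / D x)).
    by rewrite in_itv/= => /andP[x0 xs]; apply: dY; lra.
  have [c cs e] := MVT s0 dYs (within0 st cY2).
  by exists c; [move: cs; rewrite in_itv|rewrite -Y00 e subr0].
have ratio s : 0 <= s <= t -> 0 <= Y s ^+ 2 / D s <= 1.
  move=> st; rewrite divr_ge0 ?sqr_ge0 ?(ltW (Dgt0 st))//=.
  by rewrite ler_pdivrMr ?Dgt0// mul1r /D lerDr sqr_ge0.
have Y2 s : 0 <= s <= t -> r ^+ 2 - 4 * s <= Y s ^+ 2.
  case/andP; rewrite le_eqVlt => /orP[/eqP <- _|s0 st]; first by rewrite Y00; lra.
  have [c cs] := mvtY s s0 st.
  have /ratio/andP[] : 0 <= c <= t by lra.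
  by nra.
have Yr s : 0 <= s <= t -> r / 2 <= Y s.
  move=> st; have := Y2 s st; have := Ygt0 st => y0 y2.
  rewrite -(@ler_pXn2r _ 2)// ?nnegrE; [|by rewrite divr_ge0|exact: ltW].
  have -> : (r / 2) ^+ 2 = r ^+ 2 / 4 by field.
  by case/andP: st => *; lra.
have Xb s : 0 < s < t -> `|X s| <= 2 * t.
  move=> /andP[s0 st].
  have dXs x : x \in `]0, s[%R -> is_derive x 1 X (2 * (X x - W x) / D x).
    by rewrite in_itv/= => /andP[x0 xs]; apply: dX; lra.
  have [c cs e] := MVT s0 dXs (within0 (ltW st) cX).
  move: cs; rewrite in_itv/= => /andP[c0 cs].
  have ct : 0 <= c <= t by lra.
  have yc := Yr c ct.
  move: e; rewrite X00 !subr0 => ->.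
  have Dc := Dgt0 ct.
  rewrite -[2 * _ / _]mulrA normrM (gtr0_norm s0) normrM ger0_norm//.
  (* [Y c >= 1 / 2] makes [D c] at least [(X c - W c) ^+ 2 + 1 / 4], hence at least the absolute
     value of [X c - W c]. *)
  have : `|(X c - W c) / D c| <= 1.
    rewrite normrM normfV (gtr0_norm Dc) ler_pdivrMr// mul1r /D.
    rewrite -(real_normK (num_real (X c - W c))).
    have : 1 / 4 <= Y c ^+ 2 by nra.
    by have := sqr_ge0 (`|X c - W c| - 1 / 2); lra.
  by nra.
have XW s : 0 < s < t -> (X s - W s) ^+ 2 <= (C + 2 * t) ^+ 2.
  move=> st; rewrite -(real_normK (num_real (X s - W s))).
  apply: lerXn2r; rewrite ?nnegrE//; first lra.
  apply: le_trans (ler_normB _ _) _.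
  by have := Xb s st; have := WC st; lra.
have [c ct e] := mvtY t t0 (lexx t).
have ct' : 0 <= c <= t by lra.
have tt : 0 <= t <= t by lra.
rewrite Y2//= -lerBlDl.
have -> : Y t ^+ 2 - (r ^+ 2 - 4 * t) = 4 * t * (1 - Y c ^+ 2 / D c).
  by move: e; lra.
have -> : 1 - Y c ^+ 2 / D c = (X c - W c) ^+ 2 / D c.
  have Dc := Dgt0 ct'; rewrite -[1](@divff _ (D c)) ?gt_eqF// -mulrBl.
  by rewrite {1}/D addrK.
rewrite (_ : 16 * t * _ / _ = (4 * t) * ((C + 2 * t) ^+ 2 / (r / 2) ^+ 2)); last first.
  by field; rewrite ?expf_eq0/=; lra.
rewrite ler_pM2l; last lra.
apply: ler_pM; rewrite ?sqr_ge0 ?invr_ge0 ?(ltW (Dgt0 ct'))//; first exact: XW.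
rewrite lef_pV2 ?posrE ?Dgt0 ?exprn_gt0//; try lra.
rewrite /D; apply: ler_wpDl; rewrite ?sqr_ge0//.
by apply: lerXn2r; rewrite ?nnegrE ?Yr//; have := Yr c ct'; lra.
Qed.
End loewner_imag.

(** Convergence at the single point [q] bounds the terms there, so that |c k| is at most a constant
    times q^k. For r >= 2 q the terms from k = 2 on are then dominated by a geometric series of
    ratio at most 1/2, whose sum is O(r^-2). *)
Lemma power_series_coef1 (c : nat -> R) (q : R) (l : R -> R) : 0 < q ->
  (forall r, q <= r -> \sum_(1 <= k < m) c k / r ^+ k @[m --> \oo] --> l r) ->
  exists2 K, 0 <= K & forall r, 2 * q <= r -> `|l r - c 1%N / r| <= K / r ^+ 2.
Proof.
move=> q0 cl.
have [M [_ /(_ (M + 1))]] : bounded_fun (fun m => \sum_(1 <= k < m) c k / q ^+ k).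
  by apply: cvg_seq_bounded; apply/cvg_ex; exists (l q); exact: cl.
rewrite ltrDl ltr01 => /(_ isT) bM.
pose b : R := `|M + 1|.
have cb k : (0 < k)%N -> `|c k| <= 2 * b * q ^+ k.
  move=> k0; rewrite -ler_pdivrMr ?exprn_gt0//.
  have qk : `|q ^+ k| = q ^+ k by rewrite gtr0_norm// exprn_gt0.
  rewrite -{1}qk -normf_div.
  have -> : c k / q ^+ k = \sum_(1 <= i < k.+1) c i / q ^+ i - \sum_(1 <= i < k) c i / q ^+ i.
    by rewrite big_nat_recr//= addrAC subrr add0r.
  apply: le_trans (ler_normB _ _) _.
  have := bM k I; have := bM k.+1 I => /= h1 h2.
  by have := ler_norm (M + 1); rewrite -/b => h3; rewrite -/b; lra.
exists (4 * b * q ^+ 2); first by rewrite mulr_ge0 ?sqr_ge0// mulr_ge0// /b normr_ge0.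
move=> r qr.
have r0 : 0 < r by lra.
pose x := q / r.
have x0 : 0 < x by rewrite divr_gt0.
have x2 : x <= 1 / 2 by rewrite ler_pdivrMr//; lra.
(* The added [2 * x ^+ m.+2] bounds the rest of the series and makes the inequality inductive. *)
have geo m : \sum_(2 <= k < m.+2) x ^+ k + 2 * x ^+ m.+2 <= 2 * x ^+ 2.
  elim: m => [|m ih]; first by rewrite big_geq// add0r.
  rewrite big_nat_recr//=; apply: le_trans ih.
  rewrite -addrA lerD2l [x ^+ m.+3]exprS.
  by have : 0 < x ^+ m.+2 by [exact: exprn_gt0]; nra.
have part m : `|\sum_(1 <= k < m.+2) c k / r ^+ k - c 1%N / r| <= 4 * b * q ^+ 2 / r ^+ 2.
  rewrite big_ltn// expr1 addrC addrA addNr add0r.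
  apply: le_trans (ler_norm_sum _ _ _) _.
  have -> : 4 * b * q ^+ 2 / r ^+ 2 = 2 * b * (2 * x ^+ 2).
    by rewrite /x; field; rewrite gt_eqF.
  have b0 : 0 <= b by exact: normr_ge0.
  apply: le_trans (_ : 2 * b * (\sum_(2 <= k < m.+2) x ^+ k) <= _); last first.
    by apply: ler_wpM2l; [lra|have := geo m; have : 0 < x ^+ m.+2 by [exact: exprn_gt0]; lra].
  rewrite mulr_sumr; rewrite !big_nat; apply: ler_sum => k /andP[k2 _].
  rewrite normrM normfV (gtr0_norm (exprn_gt0 _ r0)) /x expr_div_n mulrA.
  by rewrite ler_pM2r ?invr_gt0 ?exprn_gt0// cb// ltnW.
apply/ler_addgt0Pr => e e0.
have /cvgrPdist_lt/(_ _ e0) : \sum_(1 <= k < m) c k / r ^+ k @[m --> \oo] --> l r by apply: cl; lra.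
move=> [m _ /(_ m.+2)] /= h.
have {}h := h (leqW (leqnSn m)).
have := part m; move: h; set s := \sum_(_ <= _ < _) _ => h p.
have -> : l r - c 1%N / r = (l r - s) + (s - c 1%N / r) by rewrite addrA subrK.
by apply: le_trans (ler_normD _ _) _; lra.
Qed.

Lemma Im_sum (I : Type) (s : seq I) (f : I -> R[i]) :
  complex.Im (\sum_(i <- s) f i) = \sum_(i <- s) complex.Im (f i).
Proof.
elim: s => [|i s ih]; first by rewrite !big_nil.
by rewrite !big_cons -ih; case: (f i) => a b; case: (\sum_(_ <- _) _).
Qed.

(** At z = i r the series gives Im g = r - a_1 / r + O(r^-2), so that (Im g)^2 = r^2 - 2 a_1 +
    O(1/r), whereas the Loewner equation gives (Im g)^2 = r^2 - 4 t + O(r^-2). *)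
Lemma expansion_capacity (W : R -> R) (t C : R) (a : nat -> R) : 0 < t ->
  (forall s, 0 < s < t -> `|W s| <= C) ->
  expansion_at_infinity (loewner_hull W t) (loewner_map W t) a ->
  a 1%N = 2 * t.
Proof.
move=> t0 WC [M0 hM0].
wlog Cge0 : C WC / 0 <= C.
  move=> h; apply: (h `|C|) => // s /WC sC; exact: le_trans (ler_norm _).
(* Beyond [q] the expansion is available, and r >= 2 q yields r >= 2 and r >= 8 t, hence 16 t <=
   r^2. *)
pose q := 1 + `|M0| + 4 * t.
have M00 := normr_ge0 M0.
have q1 : 1 <= q by rewrite /q; lra.
pose c k := complex.Im ((a k)%:C / 'i ^+ k).
pose l r := complex.Im (loewner_map W t (0 +i* r)) - r.
have gq r : q <= r ->
    ~ loewner_hull W t (0 +i* r) /\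
    (\sum_(1 <= k < m) (a k)%:C / (0 +i* r) ^+ k : R[i]^o) @[m --> \oo]
      --> (loewner_map W t (0 +i* r) - (0 +i* r) : R[i]^o).
  move=> qr; apply: hM0 => /=; first by lra.
  rewrite normc_def /= ltcR expr0n add0r sqrtr_sqr ger0_norm; last lra.
  by have := ler_norm M0; rewrite /q in q1 qr *; lra.
have cl r : q <= r -> \sum_(1 <= k < m) c k / r ^+ k @[m --> \oo] --> l r.
  move=> qr; have [_ h] := gq _ qr.
  have r0 : 0 < r by lra.
  apply/cvgrPdist_lt => e e0.
  have e0' : 0 < e%:C :> R[i] by rewrite ltcR.
  move/cvgrPdist_lt : h => /(_ _ e0'); apply: filterS => m h.
  rewrite -ltcR; apply: le_lt_trans h.
  have Imle (z : R[i]) : (`|complex.Im z|)%:C <= `|z|.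
    by case: z => x y; simpc; rewrite -sqrtr_sqr; apply: ler_wsqrtr; rewrite lerDr sqr_ge0.
  apply: le_trans (Imle _); rewrite lecR.
  set S1 := \sum_(_ <= _ < _) _; set S2 := \sum_(_ <= _ < _) _.
  have -> : S1 = complex.Im S2.
    rewrite /S2 Im_sum; apply: eq_bigr => k _.
    have -> : (0 +i* r) = 'i * r%:C :> R[i] by simpc.
    rewrite /c exprMn invfM mulrA -rmorphXn -fmorphV /=.
    by case: (_ / 'i ^+ k) => x y; simpc.
  by rewrite /l; case: (loewner_map _ _ _) => x y; case: S2.
have q0 : 0 < q by lra.
have [K K0 hK] := power_series_coef1 q0 cl.
have c1 : c 1%N = - a 1%N.
  rewrite /c expr1; have -> : 'i^-1 = - 'i :> R[i].
    have i0 : 'i != 0 :> R[i] by apply/eqP => -[/eqP]; rewrite oner_eq0.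
    by apply: (mulfI i0); rewrite divff// mulrN -expr2 sqr_i opprK.
  by simpc.
pose E := 16 * t * (C + 2 * t) ^+ 2.
have E0 : 0 <= E by rewrite /E mulr_ge0 ?sqr_ge0// mulr_ge0// ltW.
have main r : 2 * q <= r -> `|2 * a 1%N - 4 * t| * r <= E + 2 * K + (`|a 1%N| + K) ^+ 2.
  move=> qr.
  have r1 : 1 <= r by lra.
  have rr : 16 * t <= r ^+ 2.
    have h1 : 8 * t <= r by rewrite /q in qr; lra.
    by have h2 : 2 <= r by [lra]; nra.
  have qr' : q <= r by lra.
  have [nK _] := gq _ qr'.
  have [u Lu] : exists u, loewner_solution W t (0 +i* r) u.
    by apply: contrapT => nu; apply: nK; split => //=; lra.
  have : [set v | exists u, loewner_solution W t (0 +i* r) u /\ u t = v] (loewner_map W t (0 +i* r)).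
    by apply: (xgetPex 0); exists (u t), u.
  move=> {u Lu}[u [Lu ut]].
  have := loewner_Im_sqr t0 Cge0 r1 rr WC Lu; rewrite ut -/E.
  have := hK _ qr; rewrite c1 /l mulNr opprK.
  set y := complex.Im _ => h1 h2.
  have r0 : 0 < r by lra.
  (* [D] is the rescaled error of the series after its first term; [e] below is the error left by
     the Loewner equation. *)
  pose D := (y - r + a 1%N / r) * r ^+ 2.
  have DK : `|D| <= K.
    rewrite /D normrM (gtr0_norm (exprn_gt0 _ r0)).
    by rewrite -ler_pdivlMr ?exprn_gt0.
  have ry : r * (y ^+ 2 - r ^+ 2) = - 2 * a 1%N * r + 2 * D + (- a 1%N + D / r) ^+ 2 / r.
    by rewrite /D; field; rewrite gt_eqF.
  pose e := y ^+ 2 - (r ^+ 2 - 4 * t).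
  have e0 : 0 <= e by rewrite /e; case/andP: h2 => *; lra.
  have re : r * e <= E.
    have : e <= E / r ^+ 2 by rewrite /e; case/andP: h2 => *; lra.
    rewrite ler_pdivlMr ?exprn_gt0//; apply: le_trans.
    have r1' : 0 <= r - 1 by lra.
    by have := mulr_ge0 (mulr_ge0 (ltW r0) e0) r1'; lra.
  have sq : 0 <= (- a 1%N + D / r) ^+ 2 / r <= (`|a 1%N| + K) ^+ 2.
    rewrite divr_ge0 ?sqr_ge0 ?(ltW r0)//= ler_pdivrMr//.
    apply: le_trans (_ : (`|a 1%N| + K) ^+ 2 <= _); last first.
      by rewrite ler_peMr// sqr_ge0.
    rewrite -real_normK ?num_real// lerXn2r ?nnegrE ?addr_ge0//.
    apply: le_trans (ler_normD _ _) _; rewrite normrN lerD2l normrM normfV (gtr0_norm r0).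
    by rewrite ler_pdivrMr//; nra.
  have -> : `|2 * a 1%N - 4 * t| * r = `|2 * D + (- a 1%N + D / r) ^+ 2 / r - r * e|.
    rewrite -{1}(gtr0_norm r0) -normrM; congr `|_|.
    by rewrite /e; move: ry; rewrite mulrBr => ry; lra.
  have {}DK : - K <= D <= K by rewrite -ler_norml.
  have re0 : 0 <= r * e by nra.
  rewrite ler_norml; case/andP: sq => s1 s2; case/andP: DK => d1 d2.
  by apply/andP; split; have := sqr_ge0 (`|a 1%N| + K); lra.
apply/eqP; rewrite -subr_eq0; apply/negPn/negP => n0.
have n1 : 0 < `|2 * a 1%N - 4 * t|.
  rewrite normr_gt0; apply: contra n0 => /eqP h; apply/eqP; lra.
set Q := E + 2 * K + (`|a 1%N| + K) ^+ 2 in main.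
have Q0 : 0 <= Q by rewrite /Q addr_ge0 ?sqr_ge0//; lra.
(* At this radius the left side of [main] is at least Q + 1. *)
have := main (2 * q + (Q + 1) / `|2 * a 1%N - 4 * t|) _.
rewrite lerDl divr_ge0 ?(ltW n1)//; last lra.
rewrite mulrDr [X in _ + X]mulrC divfK ?gt_eqF// => /(_ isT).
by nra.
Qed.
End loewner.

(** * Bessel type trajectories *)

Section path.
Variable R : realType.
Notation mu := (@lebesgue_measure R).

Lemma within_continuousP (A : set R) (f : R -> R) :
  {within A, continuous f} <->
  forall x, A x -> forall e, 0 < e -> exists2 d, 0 < d &
    forall y, A y -> `|x - y| < d -> `|f x - f y| < e.
Proof.
rewrite subspace_continuousP; split => h x Ax.
  move=> e e0; have /cvgrPdist_lt/(_ _ e0) := h x Ax.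
  rewrite /prop_near1 /within /= => -[d /= d0 hd].
  by exists d => // y Ay yd; apply: hd.
apply/cvgrPdist_lt => e e0; have [d d0 hd] := h x Ax e e0.
by exists d => //= y /= yd Ay; apply: hd.
Qed.

Lemma continuous_bounded (a b : R) (f : R -> R) : a <= b ->
  {within `[a, b], continuous f} ->
  exists M, forall x, a <= x <= b -> `|f x| <= M.
Proof.
move=> ab cf.
have [c _ hc] := EVT_max ab cf; have [e _ he] := EVT_min ab cf.
exists (`|f c| + `|f e|) => x xab.
have := hc x xab; have := he x xab.
have := ler_norm (f c); have := ler_norm (- f e); rewrite normrN => *.
have := normr_ge0 (f c); have := normr_ge0 (f e) => *.
by rewrite ler_norml; apply/andP; split; lra.
Qed.

(* A trajectory of the Bessel type equation dV = dN - b dt / V started from z0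
   and absorbed at 0; the drift integral is only recorded through bounds. *)
Record bessel_path (b z0 : R) (N V : R -> R) : Prop := {
  bessel_start : V 0 = z0 ;
  bessel_ge0 : forall t, 0 <= t -> 0 <= V t ;
  bessel_continuous : {within `[0, +oo[, continuous V} ;
  bessel_absorbed : forall s t, 0 <= s <= t -> 0 < V t -> 0 < V s ;
  bessel_drift_le : forall s t c, 0 <= s <= t -> 0 < V t ->
    (forall u, s <= u <= t -> (V u)^-1 <= c) ->
    V s - V t + (N t - N s) <= b * (c * (t - s)) ;
  bessel_drift_ge : forall s t c, 0 <= s <= t -> 0 < V t ->
    (forall u, s <= u <= t -> c <= (V u)^-1) ->
    b * (c * (t - s)) <= V s - V t + (N t - N s) }.

Section trajectory.
Variables (kappa x y : R) (beta X Y : R -> R).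
Hypotheses (kappa4 : kappa < 4) (xy : x != y).
Hypothesis cbeta : {within `[0, +oo[, continuous beta}.
Hypothesis sle : sle_trajectory kappa (kappa - 6) x y beta X Y.
Let tau := collision_time X Y.
Let sg := Num.sg (x - y).
Let Z t := sg * (X t - Y t).
Let V t := if (t%:E < tau)%E then Z t else 0.
Let N t := sg * Num.sqrt kappa * beta t.

Let sg2 : sg * sg = 1.
Proof. by rewrite /sg -expr2 sqr_sg subr_eq0 xy. Qed.

Let Z0 : Z 0 = `|x - y|.
Proof. by rewrite /Z (sle_startX sle) (sle_startY sle) normrEsg. Qed.

Let Z0_gt0 : 0 < Z 0. Proof. by rewrite Z0 normr_gt0 subr_eq0. Qed.

Let tau_ge0 : (0 <= tau)%E.
Proof.
apply: le_ereal_inf_tmp => _ [t [t0 _] <-]; rewrite lee_fin; exact: ltW.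
Qed.

Let tau_gt0 : (0 < tau)%E.
Proof.
rewrite lt_neqAle tau_ge0 andbT; apply/negP => /eqP t0.
have := sle_collision sle; rewrite -/tau -t0 => /(_ (ltry _)) [] /=.
by rewrite ltxx.
Qed.

Let cZ t : 0 <= t -> (t%:E < tau)%E -> {within `[0, t], continuous Z}.
Proof.
move=> t0 tt; have [cX cY] := sle_continuous sle t0 tt.
by move=> u; apply: cvgM; [exact: cvg_cst|apply: cvgB; [exact: cX|exact: cY]].
Qed.

Let normZ t : `|Z t| = `|Y t - X t|.
Proof.
rewrite /Z normrM distrC; have : `|sg * sg| = 1 by rewrite sg2 normr1.
by rewrite normrM -expr2 => /eqP; rewrite sqrp_eq1// => /eqP ->; rewrite mul1r.
Qed.

(** At a zero t > 0, continuity makes |Y - X| tend to 0 from the left, so that t is a collision time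
    and cannot precede their infimum. *)
Let Z_neq0 t : 0 <= t -> (t%:E < tau)%E -> Z t != 0.
Proof.
rewrite le_eqVlt => /orP[/eqP <- _|t0 tt]; first by rewrite gt_eqF.
apply/negP => /eqP Zt.
suff : collision_times X Y t.
  move=> ct; have : (tau <= t%:E)%E by apply: ereal_inf_lbound; exists t.
  by rewrite leNgt tt.
split => //; apply/cvgr0Pnorm_lt => e e0.
have /within_continuousP/(_ t) := cZ (ltW t0) tt.
rewrite /= in_itv/= lexx ltW// => /(_ isT e e0)[d d0 hd].
near=> s.
rewrite -normZ normr_id -[Z s]subr0 -Zt distrC; apply: hd.
  by rewrite /= in_itv/=; apply/andP; split; near: s; [exact: nbhs_left_ge|exact: nbhs_left_le].
rewrite gtr0_norm ?subr_gt0; first by rewrite ltrBlDl -ltrBlDr; near: s; apply: nbhs_left_gt; lra.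
by near: s; exact: nbhs_left_lt.
Unshelve. all: by end_near. Qed.

Let Z_gt0 t : 0 <= t -> (t%:E < tau)%E -> 0 < Z t.
Proof.
move=> t0 tt; rewrite lt_neqAle eq_sym Z_neq0//= leNgt; apply/negP => Zt.
have b0 : Num.min (Z 0) (Z t) <= 0 <= Num.max (Z 0) (Z t).
  by rewrite ge_min le_max (ltW Zt) (ltW Z0_gt0) orbT.
have [c] := IVT t0 (cZ t0 tt) b0.
rewrite in_itv/= => /andP[c0 ct] /eqP; apply/negP/Z_neq0 => //.
by apply: le_lt_trans tt; rewrite lee_fin.
Qed.

Let lt_tau s t : s <= t -> (t%:E < tau)%E -> (s%:E < tau)%E.
Proof. by move=> st; apply: le_lt_trans; rewrite lee_fin. Qed.

Let cVZ t : 0 <= t -> (t%:E < tau)%E -> {within `[0, t], continuous (fun u => (Z u)^-1)}.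
Proof.
move=> t0 tt; apply/subspace_continuousP => u /=; rewrite in_itv/= => /andP[u0 ut].
apply: cvgV; first by apply: Z_neq0 => //; exact: lt_tau tt.
have /subspace_continuousP := cZ t0 tt; apply.
by rewrite /= in_itv/= u0.
Qed.

Let iVZ t : 0 <= t -> (t%:E < tau)%E ->
  mu.-integrable `[0, t] (EFin \o (fun u => (Z u)^-1)).
Proof.
move=> t0 tt; apply: continuous_compact_integrable; first exact: segment_compact.
exact: cVZ.
Qed.

Let G t := \int[mu]_(u in `[0, t]) (Z u)^-1.

Let Zinv u : (X u - Y u)^-1 = sg * (Z u)^-1.
Proof.
rewrite /Z invfM mulrA; have -> : sg * sg^-1 = 1; last by rewrite mul1r.
by apply: divff; apply: contraTneq isT => s0; move: sg2; rewrite s0 mul0r => /eqP; rewrite eq_sym oner_eq0.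
Qed.

Let XE t : 0 <= t -> (t%:E < tau)%E ->
  X t = x + Num.sqrt kappa * beta t + (kappa - 6) * sg * G t.
Proof.
move=> t0 tt; rewrite (sle_eqX sle t0 tt); congr (_ + _).
rewrite -RintegralZl//; last exact: iVZ.
by apply: eq_Rintegral => u _; rewrite Zinv mulrA.
Qed.

Let YE t : 0 <= t -> (t%:E < tau)%E -> Y t = y - 2 * sg * G t.
Proof.
move=> t0 tt; rewrite (sle_eqY sle t0 tt); congr (_ + _).
rewrite -mulNr -RintegralZl//; last exact: iVZ.
by apply: eq_Rintegral => u _; rewrite -opprB invrN Zinv mulrN mulrA mulNr.
Qed.

(** The drifts (kappa - 6) / (X - Y) of X and 2 / (X - Y) of -Y add up to -(4 - kappa) / (X - Y). *)
Let ZE t : 0 <= t -> (t%:E < tau)%E -> Z t = Z 0 + N t - (4 - kappa) * G t.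
Proof.
move=> t0 tt; rewrite Z0 normrEsg /Z XE// YE// /N -/sg.
have -> : 4 - kappa = (4 - kappa) * (sg * sg) by rewrite sg2 mulr1.
by ring.
Qed.

Let GE s t : 0 <= s <= t -> (t%:E < tau)%E ->
  G t - G s = \int[mu]_(u in `]s, t]) (Z u)^-1.
Proof.
move=> /andP[s0 st] tt; apply: Rintegral_itvB; rewrite ?bnd_simp//.
exact: iVZ (le_trans s0 st) tt.
Qed.

Let iVZ' s t : 0 <= s <= t -> (t%:E < tau)%E ->
  mu.-integrable `]s, t] (EFin \o (fun u => (Z u)^-1)).
Proof.
move=> /andP[s0 st] tt; apply: integrableS (iVZ (le_trans s0 st) tt) => //.
by apply: subset_itvr; rewrite bnd_simp.
Qed.

Let icst (s t c : R) : mu.-integrable `]s, t] (EFin \o (fun=> c)).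
Proof.
apply: (@integrableS _ _ _ mu `[s, t]) => //; first by apply: subset_itvr; rewrite bnd_simp.
apply: continuous_compact_integrable; first exact: segment_compact.
by move=> u; exact: cvg_cst.
Qed.

Let VE t : (t%:E < tau)%E -> V t = Z t. Proof. by rewrite /V => ->. Qed.

Lemma sle_bessel_gt0 t : 0 <= t -> (0 < V t) = (t%:E < tau)%E.
Proof. by move=> t0; rewrite /V; case: ifPn => [/(Z_gt0 t0)//|_]; rewrite ltxx. Qed.

Let VsubE s t : 0 <= s <= t -> (t%:E < tau)%E ->
  V s - V t + (N t - N s) = (4 - kappa) * \int[mu]_(u in `]s, t]) (Z u)^-1.
Proof.
move=> /[dup] /andP[s0 st] st' tt; have ss := lt_tau st tt.
have t0 := le_trans s0 st.
by rewrite !VE// (ZE t0)// (ZE s0)// -GE//; ring.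
Qed.

Let int_cst (s t c : R) : s <= t -> \int[mu]_(u in `]s, t]) c = c * (t - s).
Proof.
move=> st; rewrite Rintegral_cst//= lebesgue_measure_itv/= lte_fin.
case: ifPn => [_ //|]; rewrite -leNgt => ts.
by have -> : t = s; [apply/le_anti/andP|rewrite subrr].
Qed.

(** The drift bounds are monotonicity of the integral of 1 / Z before tau. Continuity at tau is the
    delicate point: by [sle_collision] a finite tau is itself a collision time, so that Z tends to 0
    from the left, and 0 is the value of V from tau on. *)
Lemma sle_bessel_path : bessel_path (4 - kappa) `|x - y| N V.
Proof.
have b0 : 0 <= 4 - kappa by move: (kappa4) => ?; lra.
split.
- by rewrite VE// Z0.
- move=> t t0; rewrite /V; case: ifPn => // tt; exact: ltW (Z_gt0 t0 tt).
- apply/within_continuousP => t; rewrite /= in_itv/= andbT => t0 e e0.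
  have [tt|tt|tt] := ltgtP t%:E tau.
  (* Continuity of [Z] is available on closed intervals below tau only; [t'] leaves room to the
     right of t. *)
  + have [t' tt' t'tau] : exists2 t', t < t' & (t'%:E < tau)%E.
      case: tau tt => [r| |]//; rewrite ?lte_fin => rt.
        by exists ((t + r) / 2); rewrite ?lte_fin; lra.
      by exists (t + 1); [lra|exact: ltry].
    have t'0 : 0 <= t' by lra.
    have /within_continuousP/(_ t) := cZ t'0 t'tau.
    rewrite /= in_itv/= t0 ltW// => /(_ isT e e0)[d d0 hd].
    exists (Num.min d (t' - t)); first by rewrite lt_min d0 subr_gt0.
    move=> u; rewrite /= in_itv/= andbT => u0; rewrite lt_min => /andP[ud ut].
    have ut' : u <= t' by move: ut; rewrite ltr_norml => /andP[*]; lra.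
    rewrite !VE//; last exact: lt_tau t'tau.
    by apply: hd => //; rewrite /= in_itv/= u0.
  + exists (t - fine tau).
      have := tau_ge0; case: tau tt => [r| |]//; rewrite /= lte_fin; lra.
    move=> u _ ut; have -> : V t = 0 by rewrite /V ltNge (ltW tt).
    have -> : V u = 0; last by rewrite subrr normr0.
    rewrite /V ltNge; have -> // : (tau <= u%:E)%E.
    have := tau_ge0; case: tau ut tt => [r| |]//=; rewrite lte_fin !lee_fin => + _ _.
    by rewrite ltr_norml => /andP[*]; lra.
  + have tauoo : (tau < +oo)%E by rewrite -tt ltry.
    have := sle_collision sle tauoo; rewrite -/tau -tt /= => -[t0' /cvgr0Pnorm_lt/(_ e e0)].
    rewrite near_withinE /= => -[d /= d0 hd].
    exists d => // u; rewrite /= in_itv/= andbT => u0 ud.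
    rewrite {1}/V tt ltxx sub0r normrN /V -tt lte_fin.
    case: ifPn => [ut|_]; last by rewrite normr0.
    by rewrite normZ -[X in X < _]normr_id; apply: hd.
- move=> s t /andP[s0 st]; rewrite !sle_bessel_gt0//; [exact: lt_tau|exact: le_trans st].
- move=> s t c /[dup] /andP[s0 st] st'; rewrite sle_bessel_gt0; last exact: le_trans st.
  move=> tt hc; rewrite VsubE//; apply: ler_wpM2l => //.
  rewrite -int_cst//; apply: le_Rintegral => //; first exact: iVZ'.
  move=> u /=; rewrite in_itv/= => /andP[su ut]; rewrite -VE; last exact: lt_tau tt.
  by apply: hc; rewrite ltW.
- move=> s t c /[dup] /andP[s0 st] st'; rewrite sle_bessel_gt0; last exact: le_trans st.
  move=> tt hc; rewrite VsubE//; apply: ler_wpM2l => //.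
  rewrite -int_cst//; apply: le_Rintegral => //; first exact: iVZ'.
  move=> u /=; rewrite in_itv/= => /andP[su ut]; rewrite -VE; last exact: lt_tau tt.
  by apply: hc; rewrite ltW.
Qed.

(** The estimate of the Loewner map needs a driving function bounded up to tau, where the drift of X
    is singular. The integral G of 1 / Z is recovered from (4 - kappa) G = |x - y| + N - V, where N
    and V are continuous on the compact interval [0, tau]. *)
Lemma sle_driving_bounded : (tau < +oo)%E ->
  0 < fine tau /\ exists C, forall s, 0 < s < fine tau -> `|X s| <= C.
Proof.
move=> tauoo; have T0 : 0 < fine tau by rewrite fine_gt0// tau_gt0.
split => //.
have tauE : tau = (fine tau)%:E by rewrite fineK// ge0_fin_numE.
have sub : [set` `[0, fine tau]] `<=` [set` `[0, +oo[].
  by move=> u /=; rewrite !in_itv/= andbT => /andP[].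
have [M1 h1] := continuous_bounded (ltW T0) (continuous_subspaceW sub cbeta).
have [M2 h2] := continuous_bounded (ltW T0)
  (continuous_subspaceW sub (bessel_continuous sle_bessel_path)).
pose K := `|sg| * ((`|x - y| + Num.sqrt kappa * M1 + M2) / (4 - kappa)).
exists (`|x| + Num.sqrt kappa * M1 + `|kappa - 6| * K) => s /andP[s0 sT].
have st : (s%:E < tau)%E by rewrite tauE lte_fin.
have s0' := ltW s0; have sT' : 0 <= s <= fine tau by rewrite s0' ltW.
have b0 : 0 < 4 - kappa by move: (kappa4) => ?; lra.
have Bs : `|Num.sqrt kappa * beta s| <= Num.sqrt kappa * M1.
  by rewrite normrM ger0_norm ?sqrtr_ge0// ler_wpM2l ?sqrtr_ge0 ?h1.
rewrite XE//; apply: le_trans (ler_normD _ _) _; apply: lerD.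
  by apply: le_trans (ler_normD _ _) _; apply: lerD.
rewrite -mulrA normrM; apply: ler_wpM2l => //.
rewrite normrM; apply: ler_wpM2l => //.
have -> : G s = (`|x - y| + N s - V s) / (4 - kappa).
  by rewrite VE// ZE// Z0; field; rewrite gt_eqF.
rewrite normrM normfV (gtr0_norm b0) ler_pM2r ?invr_gt0//.
apply: le_trans (ler_normB _ _) _; apply: lerD; last exact: h2.
apply: le_trans (ler_normD _ _) _; rewrite normr_id; apply: lerD => //.
have sg1 : `|sg| = 1 by rewrite /sg normr_sg subr_eq0 xy.
by rewrite /N -mulrA normrM sg1 mul1r.
Qed.
End trajectory.
End path.

(** * Second order expansion of a test function over one time step *)

Section step.
Variable R : realType.

(** These functions ignore the region near 0, where the drift explodes. The Taylor bound is asked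
    between positive points only, which are the values of the process before absorption. *)
Record test_function (e K : R) (f f1 f2 : R -> R) : Prop := {
  test_near0 : forall z, z <= e -> [/\ f z = 0, f1 z = 0 & f2 z = 0] ;
  test_bounded : forall z, [/\ `|f z| <= K, `|f1 z| <= K & `|f2 z| <= K] ;
  test_taylor : forall z w, 0 < z -> 0 < w ->
    `|f w - f z - f1 z * (w - z) - f2 z * (w - z) ^+ 2 / 2| <= K * `|w - z| ^+ 3 }.

Section one_step.
Variables (b z0 e r t h : R) (N V : R -> R).
Hypotheses (b_gt0 : 0 < b) (e_gt0 : 0 < e) (r_gt0 : 0 < r) (re : 8 * r < e)
  (t_ge0 : 0 <= t) (h_ge0 : 0 <= h) (bh : 4 * b * h <= r * e).
Hypothesis bV : bessel_path b z0 N V.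
Hypothesis Nr : forall s, t <= s <= t + h -> `|N s - N t| <= r.

(** Up to the first time at which V falls to e / 4 the drift has size at most 4 b / e. Hence V has
    lost at most 4 b h / e + r <= 2 r by then, less than the e / 4 needed to come down from e /
    2. *)
Lemma bessel_step_lower : e / 2 <= V t -> forall s, t <= s <= t + h -> e / 4 <= V s.
Proof.
move: b_gt0 e_gt0 r_gt0 re t_ge0 h_ge0 bh => b0 e0 r0 re' t0 h0 bh' Vt s sth.
rewrite leNgt; apply/negP => Vs.
pose S := [set u | t <= u <= s /\ V u <= e / 4].
have Ss : S s by split; [case/andP: sth => -> _ /=|exact: ltW].
have hS : has_inf S by split; [exists s|exists t => u [/andP[]]].
pose c := inf S.
have tc : t <= c by apply: lb_le_inf; [exists s|move=> u [/andP[]]].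
have cs : c <= s by apply: ge_inf => //; exact: hS.2.
have before u : t <= u -> u < c -> e / 4 < V u.
  move=> tu uc; rewrite ltNge; apply/negP => Vu.
  have : c <= u; last by lra.
  by apply: ge_inf; [exact: hS.2|split => //; rewrite tu; lra].
have cV := bessel_continuous bV; move/within_continuousP : cV => cV.
have c0 : [set` `[0, +oo[] c by rewrite /= in_itv/= andbT; lra.
have Vc : V c = e / 4.
  apply/eqP; rewrite eq_le; apply/andP; split; rewrite leNgt; apply/negP => Vc.
    have [d d0 hd] := cV c c0 (V c - e / 4) ltac:(lra).
    have [u Su uc] := inf_adherent d0 hS.
    have cu : c <= u by apply: ge_inf => //; exact: hS.2.
    case: Su => /andP[tu us] Vu.
    have : `|V c - V u| < V c - e / 4.
      apply: hd; first by rewrite /= in_itv/= andbT; lra.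
      by rewrite distrC ger0_norm -/c in uc *; lra.
    by have := ler_norm (V c - V u); lra.
  have tc' : t < c.
    by rewrite lt_neqAle tc andbT; apply/negP => /eqP tc'; move: Vc; rewrite -tc'; lra.
  have [d d0 hd] := cV c c0 (e / 4 - V c) ltac:(lra).
  pose u := Num.max t (c - d / 2).
  have uc : u < c by rewrite gt_max tc'/=; lra.
  have tu : t <= u by rewrite le_max lexx.
  have cdu : c - d / 2 <= u by rewrite le_max lexx orbT.
  have := before u tu uc.
  have : `|V c - V u| < e / 4 - V c.
    apply: hd; first by rewrite /= in_itv/= andbT; lra.
    by rewrite ger0_norm; lra.
  by rewrite distrC; have := ler_norm (V u - V c); lra.
case/andP: sth => ts sth.
have tc2 : 0 <= t <= c by rewrite t0.
have Vc0 : 0 < V c by rewrite Vc; lra.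
have := @bessel_drift_le _ _ _ _ _ bV t c (4 / e) tc2 Vc0.
have : `|N c - N t| <= r by apply: Nr; rewrite tc; lra.
rewrite ler_norml => /andP[N1 N2] H.
have {}H : V t - V c + (N c - N t) <= b * (4 / e * (c - t)).
  apply: H => u /andP[tu uc].
  have Vu : e / 4 <= V u.
    by move: uc; rewrite le_eqVlt => /orP[/eqP ->|/(before _ tu)/ltW]; rewrite ?Vc.
  by rewrite -[4 / e]invf_div lef_pV2 ?posrE; lra.
have : b * (4 / e * (c - t)) <= r.
  have -> : b * (4 / e * (c - t)) = 4 * b * (c - t) / e by field; rewrite gt_eqF.
  by rewrite ler_pdivrMr//; nra.
by lra.
Qed.

(** The drift only pulls V down, so from below e / 2 the noise cannot lift it above e, and a test
    function vanishes at both ends of the step. From above e / 2 the path stays above e / 4 and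
    moves by at most 2 r, so that freezing the drift at its initial value costs O(r h). *)
Lemma bessel_step :
  (V t <= e / 2 /\ V (t + h) <= e) \/
  [/\ e / 2 <= V t, 0 < V (t + h), `|V (t + h) - V t| <= 2 * r,
      0 <= V t - V (t + h) + (N (t + h) - N t) <= 4 * b * h / e &
      `|V t - V (t + h) + (N (t + h) - N t) - b * h / V t| <= 16 * b * r * h / e ^+ 2].
Proof.
move: b_gt0 e_gt0 r_gt0 re t_ge0 h_ge0 bh => b0 e0 r0 re' t0 h0 bh'.
have tth : t <= t + h <= t + h by lra.
have t2 u : t <= u <= t + h -> 0 <= t <= u by move=> ?; lra.
have [Vt|/ltW Vt] := leP (V t) (e / 2); [left|right].
  split => //; have [Vth|] := ltP 0 (V (t + h)); last by lra.
  have := @bessel_drift_ge _ _ _ _ _ bV t (t + h) 0 (t2 _ tth) Vth.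
  rewrite !mul0r !mulr0 => H.
  have := Nr tth; rewrite ler_norml => /andP[*].
  have : 0 <= V t - V (t + h) + (N (t + h) - N t).
    by apply: H => u ut; rewrite invr_ge0; apply: (bessel_ge0 bV); lra.
  by lra.
have low := bessel_step_lower Vt.
have V0 u : t <= u <= t + h -> 0 < V u by move=> /low; lra.
have drift u : t <= u <= t + h -> 0 <= V t - V u + (N u - N t) <= 4 * b * h / e.
  move=> ut; have Vu := V0 u ut; apply/andP; split.
    have := @bessel_drift_ge _ _ _ _ _ bV t u 0 (t2 _ ut) Vu.
    rewrite !mul0r !mulr0; apply => w wt; rewrite invr_ge0; apply: (bessel_ge0 bV); lra.
  apply: (@le_trans _ _ (b * (4 / e * (u - t)))).
    apply: (bessel_drift_le bV (t2 _ ut) Vu) => w wt.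
    have wth : t <= w <= t + h by lra.
    by rewrite -[4 / e]invf_div lef_pV2 ?posrE; have := low w wth; lra.
  have -> : 4 * b * h / e = b * (4 / e * h) by field; rewrite gt_eqF.
  by rewrite ler_pM2l// ler_pM2l ?divr_gt0//; lra.
have dr : 4 * b * h / e <= r by rewrite ler_pdivrMr.
have diff u : t <= u <= t + h -> `|V u - V t| <= 2 * r.
  move=> ut; have := drift u ut => /andP[? ?].
  have := Nr ut; rewrite !ler_norml => /andP[? ?].
  by apply/andP; split; lra.
(* 16 / e^2 is 2 / ((e / 4) (e / 2)): the displacement is at most 2 r, and the two values of V are
   at least e / 4 and e / 2. *)
have inv u : t <= u <= t + h -> `|(V u)^-1 - (V t)^-1| <= 16 * r / e ^+ 2.
  move=> ut; have Vu := V0 u ut; have lu := low u ut.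
  have Vt0 : 0 < V t by lra.
  have -> : (V u)^-1 - (V t)^-1 = (V t - V u) / (V u * V t).
    by field; rewrite !gt_eqF.
  rewrite normrM normfV (gtr0_norm (mulr_gt0 Vu Vt0)).
  have -> : 16 * r / e ^+ 2 = 2 * r / (e / 4 * (e / 2)) by field; rewrite gt_eqF.
  rewrite distrC; apply: ler_pM; rewrite ?invr_ge0//; [exact: ltW (mulr_gt0 Vu Vt0)|exact: diff|].
  rewrite lef_pV2 ?posrE ?mulr_gt0//; try lra.
  by apply: ler_pM => //; lra.
have Vth := V0 _ tth.
split => //; [exact: diff|exact: drift|].
rewrite ler_norml; apply/andP; split.
  rewrite lerBrDl.
  have -> : b * h / V t + - (16 * b * r * h / e ^+ 2) =
      b * (((V t)^-1 - 16 * r / e ^+ 2) * (t + h - t)).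
    by field; rewrite !gt_eqF//; lra.
  apply: (bessel_drift_ge bV (t2 _ tth) Vth) => u /inv; rewrite ler_norml => /andP[*]; lra.
rewrite lerBlDl.
have -> : b * h / V t + 16 * b * r * h / e ^+ 2 =
    b * (((V t)^-1 + 16 * r / e ^+ 2) * (t + h - t)).
  by field; rewrite !gt_eqF//; lra.
apply: (bessel_drift_le bV (t2 _ tth) Vth) => u /inv; rewrite ler_norml => /andP[*]; lra.
Qed.

Lemma lipschitz_step (K : R) (phi : R -> R) :
  (forall z, z <= e -> phi z = 0) ->
  (forall z w, 0 < z -> 0 < w -> `|phi w - phi z| <= K * `|w - z|) ->
  `|phi (V (t + h)) - phi (V t)| <= 2 * K * r.
Proof.
move: e_gt0 r_gt0 => e0 r0 phi0 phiK.
have K0 : 0 <= K.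
  have := phiK 1 2 ltr01 ltac:(lra); rewrite (_ : 2 - 1 = 1 :> R); last by lra.
  by rewrite normr1 mulr1; apply: le_trans.
case: bessel_step => [[V1 V2]|[V1 V2 V3 _ _]].
  by rewrite !phi0 ?subrr ?normr0 ?mulr_ge0//; lra.
apply: le_trans (phiK _ _ _ V2) _; first by lra.
by rewrite [2 * K]mulrC -mulrA; exact: ler_wpM2l.
Qed.

Lemma taylor_step (K : R) (f f1 f2 : R -> R) : r <= 1 -> test_function e K f f1 f2 ->
  `|f (V (t + h)) - f (V t) - f1 (V t) * (N (t + h) - N t)
    - f2 (V t) * (N (t + h) - N t) ^+ 2 / 2 + b * h / V t * f1 (V t)|
  <= K * (4 + 24 * b / e + 16 * b / e ^+ 2) * (r * (h + (N (t + h) - N t) ^+ 2)).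
Proof.
move: b_gt0 e_gt0 r_gt0 re t_ge0 h_ge0 bh => b0 e0 r0 re' t0 h0 bh' r1 tf.
set D := N (t + h) - N t.
have K0 : 0 <= K by have [+ _ _] := test_bounded tf 0; apply: le_trans.
have be : 0 < b / e by rewrite divr_gt0.
have be2 : 0 < b / e ^+ 2 by rewrite divr_gt0// exprn_gt0.
have C0 : 0 <= 4 + 24 * b / e + 16 * b / e ^+ 2 by rewrite -!mulrA; lra.
case: bessel_step => [[V1 V2]|[V1 V2 V3 /andP[d0 d1] d2]].
  have [-> _ _] := test_near0 tf V2.
  have Vte : V t <= e by lra.
  have [-> -> ->] := test_near0 tf Vte.
  rewrite !(mul0r, mulr0, subr0, addr0) normr0.
  apply: mulr_ge0; first exact: mulr_ge0.
  by apply: mulr_ge0; [exact: ltW|rewrite addr_ge0 ?sqr_ge0].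
rewrite -/D in d0 d1 d2; set d := V t - V (t + h) + D in d0 d1 d2.
have Vt0 : 0 < V t by lra.
have tay := test_taylor tf Vt0 V2.
have [_ b1 b2] := test_bounded tf (V t).
set u := V (t + h) - V t in V3 tay.
have uE : u = D - d by rewrite /u /d; ring.
have dr : d <= r by apply: le_trans d1 _; rewrite ler_pdivrMr.
have DN : `|D| <= r by apply: Nr; lra.
have u3 : `|u| ^+ 3 <= 4 * r * D ^+ 2 + 4 * r * d * r.
  rewrite exprS (real_normK (num_real u)).
  have u2 : u ^+ 2 <= 2 * D ^+ 2 + 2 * d ^+ 2.
    by rewrite uE; have := sqr_ge0 (D + d); lra.
  have d2r : d ^+ 2 <= d * r by rewrite expr2; exact: ler_wpM2l.
  apply: le_trans (_ : 2 * r * (2 * D ^+ 2 + 2 * (d * r)) <= _); last by lra.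
  by apply: ler_pM => //; [exact: sqr_ge0|lra].
have -> : f (V (t + h)) - f (V t) - f1 (V t) * D - f2 (V t) * D ^+ 2 / 2
     + b * h / V t * f1 (V t) =
   (f (V (t + h)) - f (V t) - f1 (V t) * u - f2 (V t) * u ^+ 2 / 2)
   - f1 (V t) * (d - b * h / V t) + f2 (V t) * (d ^+ 2 - 2 * D * d) / 2.
  by rewrite uE; field; rewrite gt_eqF.
have t2 : `|f1 (V t) * (d - b * h / V t)| <= K * (16 * b * r * h / e ^+ 2).
  by rewrite normrM; exact: ler_pM.
have t3 : `|f2 (V t) * (d ^+ 2 - 2 * D * d) / 2| <= K * (3 * r * d) / 2.
  rewrite normrM normrM [ `|2^-1|]ger0_norm//; apply: ler_wpM2r => //.
  apply: ler_pM => //.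
  have -> : d ^+ 2 - 2 * D * d = d * (d - 2 * D) by ring.
  rewrite normrM ger0_norm// mulrC; apply: ler_wpM2r => //.
  apply: le_trans (ler_normB _ _) _; rewrite ger0_norm// normrM ger0_norm//; lra.
have t1 : K * `|u| ^+ 3 <= K * (4 * r * D ^+ 2 + 4 * r * d) .
  apply: ler_wpM2l => //; apply: le_trans u3 _; rewrite lerD2l.
  by rewrite ler_piMr//; nra.
apply: le_trans (ler_normD _ _) _.
apply: le_trans (lerD (ler_normB _ _) (lexx _)) _.
apply: le_trans (lerD (lerD tay t2) t3) _.
apply: le_trans (lerD (lerD t1 (lexx _)) (lexx _)) _.
have rd : r * d <= r * (4 * b * h / e) by rewrite ler_pM2l.
have D2 := sqr_ge0 D.
rewrite [leLHS](_ : _ = K * (4 * r * D ^+ 2 + 4 * r * d + 16 * b * r * h / e ^+ 2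
  + 3 * r * d / 2)); last by ring.
rewrite -[leRHS]mulrA; apply: ler_wpM2l => //.
rewrite [leRHS](_ : _ = 4 * (r * D ^+ 2) + 6 * (r * (4 * b * h / e))
  + 16 * b * r * h / e ^+ 2 +
  (4 * (r * h) + (24 * (b / e) + 16 * (b / e ^+ 2)) * (r * D ^+ 2))); last by ring.
have : 0 <= 4 * (r * h) + (24 * (b / e) + 16 * (b / e ^+ 2)) * (r * D ^+ 2).
  apply: addr_ge0; first by rewrite !mulr_ge0// ltW.
  by apply: mulr_ge0; [lra|apply: mulr_ge0 => //; exact: ltW].
have := mulr_ge0 (ltW r0) d0.
by lra.
Qed.
End one_step.
End step.

(** * Powers cut off near zero and infinity *)

Section test.
Variable R : realType.

Lemma continuous_max0 : continuous (fun u : R => Num.max u 0).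
Proof.
move=> u; apply: (@continuous_max R R^o (fun x => x) (cst 0)) => //; exact: cvg_cst.
Qed.

(** At 0 the difference quotient is [Num.max u 0 ^+ p.+1], which is continuous and vanishes there;
    this is where an exponent at least 2 is used. *)
Lemma is_derive_max0_pow (p : nat) (x : R) : is_derive x 1
  (fun u : R => Num.max u 0 ^+ p.+2) (p.+2%:R * Num.max x 0 ^+ p.+1).
Proof.
have [x0|x0|<-] := ltgtP 0 x.
- have : is_derive x 1 (fun u : R => u ^+ p.+2) (p.+2%:R * x ^+ p.+1).
    have := @is_deriveX R R^o id p.+2 x 1 1 (is_derive_id x (1 : R)).
    by rewrite exprfctE => h; apply: (is_derive_eq h); rewrite /GRing.scale/= mulr1.
  apply: near_eq_is_derive.
  by near=> y; rewrite max_l//; apply/ltW; near: y; exact: lt_nbhsr.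
- rewrite exprS mul0r mulr0; have := is_derive_cst (0 : R) x 1.
  apply: near_eq_is_derive.
  near=> y; rewrite max_r ?exprS ?mul0r//; apply/ltW; near: y; exact: lt_nbhsl.
- rewrite expr0n mulr0; apply/is_derive1_caratheodory.
  exists (fun u => Num.max u 0 ^+ p.+1); split.
  + move=> z; rewrite maxxx [0 ^+ _]exprS mul0r !subr0 exprSr.
    by have [z0|z0] := leP z 0; rewrite ?mulr0// exprS !mul0r.
  + apply: (@continuous_comp _ _ _ (fun u : R => Num.max u 0) (fun v => v ^+ p.+1)).
      exact: continuous_max0.
    exact: exprn_continuous.
  + by rewrite maxxx expr0n.
Unshelve. all: by end_near. Qed.

Section bump.
Variable eps : R.
Hypotheses (eps0 : 0 < eps) (eps1 : eps < 1).

Definition bump_lo (z : R) := Num.max (1 - eps / z) 0.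
Definition bump_hi (z : R) := Num.max (1 - eps * z) 0.

(* [z ^ a] cut off near [0] and near infinity; with [D = z d/dz] one has
   [D bump_lo = 1 - bump_lo] and [D bump_hi = bump_hi - 1] where they are
   positive, so the family is stable under differentiation. *)
Definition bump (a : R) (p q : nat) (z : R) : R :=
  if 0 < z then z `^ a * (bump_lo z ^+ p * bump_hi z ^+ q) else 0.

Lemma is_derive_bump (a : R) (p q : nat) (z : R) : 0 < z ->
  is_derive z 1 (bump a p.+2 q.+2)
   ((a - p.+2%:R + q.+2%:R) * bump (a - 1) p.+2 q.+2 z
    + p.+2%:R * bump (a - 1) p.+1 q.+2 z - q.+2%:R * bump (a - 1) p.+2 q.+1 z).
Proof.
move=> z0.
have H : is_derive z 1 (fun u => u `^ a *
    (((fun v => Num.max v 0 ^+ p.+2) \o (fun u => 1 - eps / u)) u *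
     ((fun v => Num.max v 0 ^+ q.+2) \o (fun u => 1 - eps * u)) u))
   ((a - p.+2%:R + q.+2%:R) * bump (a - 1) p.+2 q.+2 z
    + p.+2%:R * bump (a - 1) p.+1 q.+2 z - q.+2%:R * bump (a - 1) p.+2 q.+1 z).
  have d1 := is_derive1_powR a z0.
  have dl : is_derive z 1 (fun u : R => 1 - eps / u) (eps / z ^+ 2).
    have z0' : (fun u : R => u) z != 0 by rewrite gt_eqF.
    have dV := @is_deriveV R (fun u => u) z 1 1 z0' (is_derive_id z (1:R)).
    have dE : is_derive z 1 (fun u : R => eps / u) (eps *: (- z ^- 2 *: 1)).
      exact: (is_deriveZ eps dV).
    by apply: (is_derive_eq (is_deriveB (is_derive_cst (1 : R) z 1) dE)); rewrite /GRing.scale/= mulr1 mulrN sub0r opprK.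
  have dh : is_derive z 1 (fun u : R => 1 - eps * u) (- eps).
    have dE : is_derive z 1 (fun u : R => eps * u) (eps *: 1).
      exact: (is_deriveZ eps (is_derive_id z (1:R))).
    by apply: (is_derive_eq (is_deriveB (is_derive_cst (1 : R) z 1) dE)); rewrite /GRing.scale/= mulr1 sub0r.
  have dL := @is_derive1_comp R (fun v => Num.max v 0 ^+ p.+2) (fun u => 1 - eps / u)
    z _ _ (is_derive_max0_pow p (1 - eps / z)) dl.
  have dH := @is_derive1_comp R (fun v => Num.max v 0 ^+ q.+2) (fun u => 1 - eps * u)
    z _ _ (is_derive_max0_pow q (1 - eps * z)) dh.
  have dLH := is_deriveM dL dH.
  apply: (is_derive_eq (is_deriveM d1 dLH)) => /=.
  rewrite /GRing.scale/= /bump z0 -/(bump_lo z) -/(bump_hi z).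
  have -> : z `^ a = z * z `^ (a - 1).
    by rewrite -{2}(powRr1 (ltW z0)) -powRD ?(addrC 1) ?subrK// (gt_eqF z0) implybT.
  set A := bump_lo z; set C := bump_hi z; set w := z `^ _.
  (* Where the positive part is active this is the relation eps / z = 1 - A; elsewhere the power of
     A vanishes on both sides. *)
  have EA : eps / z ^+ 2 * A ^+ p.+1 = (1 - A) / z * A ^+ p.+1.
    rewrite /A /bump_lo; have [_|h] := leP 0 (1 - eps / z); last by rewrite [0 ^+ _]exprS mul0r !mulr0.
    by congr (_ * _); field; rewrite gt_eqF.
  have EC : eps * C ^+ q.+1 = (1 - C) / z * C ^+ q.+1.
    rewrite /C /bump_hi; have [_|h] := leP 0 (1 - eps * z); last by rewrite [0 ^+ _]exprS mul0r !mulr0.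
    by congr (_ * _); field; rewrite gt_eqF.
  change (z * w *
    (A ^+ p.+2 * (q.+2%:R * C ^+ q.+1 * - eps) +
     C ^+ q.+2 * (p.+2%:R * A ^+ p.+1 * (eps / z ^+ 2))) +
    A ^+ p.+2 * C ^+ q.+2 * (a * w) =
    (a - p.+2%:R + q.+2%:R) * (w * (A ^+ p.+2 * C ^+ q.+2)) +
    p.+2%:R * (w * (A ^+ p.+1 * C ^+ q.+2)) -
    q.+2%:R * (w * (A ^+ p.+2 * C ^+ q.+1))).
  have -> : q.+2%:R * C ^+ q.+1 * - eps = - (q.+2%:R * (eps * C ^+ q.+1)) by ring.
  have -> : p.+2%:R * A ^+ p.+1 * (eps / z ^+ 2) = p.+2%:R * (eps / z ^+ 2 * A ^+ p.+1).
    by ring.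
  rewrite EA EC ![_ ^+ _.+2]exprS.
  by move: (A ^+ p.+1) (C ^+ q.+1) (p.+2%:R) (q.+2%:R) => *; field; rewrite gt_eqF.
apply: near_eq_is_derive H.
by near=> u; rewrite /bump ifT//; near: u; exact: lt_nbhsr.
Unshelve. all: by end_near. Qed.

Lemma bump_lo_bound z : 0 < z -> 0 <= bump_lo z <= 1.
Proof.
move=> z0; rewrite /bump_lo le_max lexx orbT ge_max ler01 andbT.
by rewrite gerBl divr_ge0// ltW.
Qed.

Lemma bump_hi_bound z : 0 < z -> 0 <= bump_hi z <= 1.
Proof.
move=> z0; rewrite /bump_hi le_max lexx orbT ge_max ler01 andbT.
by rewrite gerBl mulr_ge0// ltW.
Qed.

Lemma bump_le a p q z : 0 <= bump a p q z <= (if 0 < z then z `^ a else 0).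
Proof.
rewrite /bump; case: ifPn => [z0|_]; last by rewrite lexx.
have /andP[a0 a1] := bump_lo_bound z0; have /andP[c0 c1] := bump_hi_bound z0.
rewrite mulr_ge0 ?powR_ge0 ?mulr_ge0 ?exprn_ge0//=.
by rewrite ler_piMr ?powR_ge0// mulr_ile1 ?exprn_ge0 ?exprn_ile1.
Qed.

Lemma bump_near0 a p q z : z <= eps -> bump a p.+1 q z = 0.
Proof.
move=> ze; rewrite /bump; case: ifPn => // z0.
rewrite /bump_lo max_r ?exprS ?mul0r ?mulr0//.
by rewrite subr_le0 ler_pdivlMr// mul1r.
Qed.

Definition bounded_on_pos (f : R -> R) := exists K, forall z, `|f z| <= K.
Definition lipschitz_on_pos (f : R -> R) :=
  exists K, forall z w, 0 < z -> 0 < w -> `|f w - f z| <= K * `|w - z|.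

Lemma bounded_on_posD f g : bounded_on_pos f -> bounded_on_pos g ->
  bounded_on_pos (fun z => f z + g z).
Proof.
move=> [K hK] [L hL]; exists (K + L) => z.
by apply: le_trans (ler_normD _ _) _; exact: lerD.
Qed.

Lemma bounded_on_posZ c f : bounded_on_pos f -> bounded_on_pos (fun z => c * f z).
Proof. by move=> [K hK]; exists (`|c| * K) => z; rewrite normrM ler_wpM2l. Qed.

Lemma lipschitz_on_posD f g : lipschitz_on_pos f -> lipschitz_on_pos g ->
  lipschitz_on_pos (fun z => f z + g z).
Proof.
move=> [K hK] [L hL]; exists (K + L) => z w z0 w0.
rewrite opprD addrACA mulrDl; apply: le_trans (ler_normD _ _) _.
by apply: lerD; [exact: hK|exact: hL].
Qed.

Lemma lipschitz_on_posZ c f : lipschitz_on_pos f -> lipschitz_on_pos (fun z => c * f z).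
Proof.
move=> [K hK]; exists (`|c| * K) => z w z0 w0.
by rewrite -mulrBr normrM -mulrA; apply: ler_wpM2l => //; exact: hK.
Qed.

(** The function vanishes outside [eps, 1 / eps], and inside |ln z| <= - ln eps. *)
Lemma bounded_bump a p q : bounded_on_pos (bump a p.+1 q.+1).
Proof.
exists (eps `^ (- `|a|)) => z; rewrite ger0_norm; last by have /andP[] := bump_le a p.+1 q.+1 z.
have [ze|ze] := leP z eps; first by rewrite bump_near0// powR_ge0.
have z0 : 0 < z by exact: lt_trans ze.
have e0 := eps0; have e1 := eps1.
have [zh|zh] := leP z eps^-1; last first.
  rewrite /bump z0 /bump_hi max_r; first by rewrite [0 ^+ _]exprS mul0r !mulr0 powR_ge0.
  rewrite subr_le0; move: zh; rewrite -(ltr_pM2l e0) divff ?gt_eqF//; exact: ltW.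
have /andP[_] := bump_le a p.+1 q.+1 z; rewrite z0 => /le_trans; apply.
rewrite /powR !gt_eqF// ler_expR.
have lz : `|ln z| <= - ln eps.
  rewrite ler_norml opprK -lnV ?posrE// !ler_ln ?posrE ?invr_gt0// (ltW ze)//.
apply: le_trans (ler_norm _) _; rewrite normrM mulNr -mulrN.
exact: ler_wpM2l.
Qed.

Lemma mvt_pos (f df : R -> R) (z w : R) : 0 < z -> 0 < w ->
  (forall u : R, 0 < u -> is_derive u 1 f (df u)) ->
  exists c, [/\ 0 < c, `|c - z| <= `|w - z| & f w - f z = df c * (w - z)].
Proof.
move=> z0 w0 dfu.
have cf u v : 0 < u -> {within `[u, v], continuous f}.
  move=> u0; apply: derivable_within_continuous => x; rewrite in_itv/= => /andP[ux _].
  by have [] := dfu x (lt_le_trans u0 ux).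
have [zw|wz|->] := ltgtP z w.
- have dzw x : x \in `]z, w[%R -> is_derive x 1 f (df x).
    by rewrite in_itv/= => /andP[zx _]; apply: dfu; exact: lt_trans zx.
  have [c] := MVT zw dzw (cf _ _ z0).
  rewrite in_itv/= => /andP[zc cw] e.
  by exists c; split => //; [lra|rewrite !ger0_norm; lra].
- have dwz x : x \in `]w, z[%R -> is_derive x 1 f (df x).
    by rewrite in_itv/= => /andP[zx _]; apply: dfu; exact: lt_trans zx.
  have [c] := MVT wz dwz (cf _ _ w0).
  rewrite in_itv/= => /andP[zc cw] e.
  exists c; split => //; [lra| |by rewrite -opprB e; ring].
  by rewrite !ler0_norm; lra.
- by exists w; rewrite !subrr mulr0 normr0.
Qed.

Lemma lipschitz_bump a p q : lipschitz_on_pos (bump a p.+2 q.+2).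
Proof.
have [K hK] : bounded_on_pos (fun z =>
   (a - p.+2%:R + q.+2%:R) * bump (a - 1) p.+2 q.+2 z
    + p.+2%:R * bump (a - 1) p.+1 q.+2 z + - q.+2%:R * bump (a - 1) p.+2 q.+1 z).
  by do ?apply: bounded_on_posD; apply: bounded_on_posZ; exact: bounded_bump.
exists K => z w z0 w0.
have [c [c0 _ ->]] := mvt_pos z0 w0 (is_derive_bump a p q).
by rewrite normrM; apply: ler_wpM2r => //; have := hK c; rewrite mulNr.
Qed.

(** The mean value theorem is used twice: for f minus its second order polynomial at z, then for f1.
    This produces a difference of values of f2, which the Lipschitz hypothesis controls because both
    intermediate points are within |w - z| of z. *)
Lemma taylor_pos (f f1 f2 : R -> R) (K z w : R) : 0 < z -> 0 < w ->
  (forall u : R, 0 < u -> is_derive u 1 f (f1 u)) ->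
  (forall u : R, 0 < u -> is_derive u 1 f1 (f2 u)) ->
  (forall u v, 0 < u -> 0 < v -> `|f2 v - f2 u| <= K * `|v - u|) ->
  `|f w - f z - f1 z * (w - z) - f2 z * (w - z) ^+ 2 / 2| <= K * `|w - z| ^+ 3.
Proof.
move=> z0 w0 d1 d2 lip.
have K0 : 0 <= K.
  have := lip 1 2 ltr01 ltac:(lra); rewrite (_ : 2 - 1 = 1 :> R); last by lra.
  by rewrite normr1 mulr1; apply: le_trans.
pose G u := f u - f1 z * (u - z) - f2 z * (u - z) ^+ 2 / 2.
have dG (u : R) : 0 < u -> is_derive u 1 G (f1 u - f1 z - f2 z * (u - z)).
  move=> u0; have dl := is_deriveB (is_derive_id u (1 : R)) (is_derive_cst (z : R) u (1 : R)).
  have d3 := is_deriveZ (f2 z / 2) (is_deriveM dl dl).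
  have d4 := is_deriveB (is_deriveB (d1 u u0) (is_deriveZ (f1 z) dl)) d3.
  have -> : G = f - (f1 z \*: (id - cst z)) - (f2 z / 2 \*: ((id - cst z) * (id - cst z))).
    apply/funext => v; change (G v = f v - f1 z * (v - z) - f2 z / 2 * ((v - z) * (v - z))).
    by rewrite /G; ring.
  apply: (is_derive_eq d4).
  change (f1 u - f1 z * (1 - 0) - f2 z / 2 * ((u - z) * (1 - 0) + (u - z) * (1 - 0)) =
    f1 u - f1 z - f2 z * (u - z)).
  by field.
have [c [c0 cw e]] := mvt_pos z0 w0 dG.
have [c' [c'0 cw' e']] := mvt_pos z0 c0 d2.
have -> : f w - f z - f1 z * (w - z) - f2 z * (w - z) ^+ 2 / 2 = G w - G z.
  by rewrite /G; ring.
rewrite e e' -mulrBl !normrM [ `|w - z| ^+ 3]exprSr mulrA; apply: ler_wpM2r => //.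
rewrite expr2 mulrA; apply: ler_pM => //.
by apply: le_trans (lip _ _ z0 c'0) _; apply: ler_wpM2l => //; exact: le_trans cw.
Qed.

Section power.
Variables (kappa b a : R).

(** Starting from exponents 4, all the bumps of the second derivative have exponents at least 2, as
    [lipschitz_bump] requires. *)
Definition power_cut : R -> R := bump a 4 4.
Definition power_cut1 (z : R) : R :=
  a * bump (a - 1) 4 4 z + 4 * bump (a - 1) 3 4 z - 4 * bump (a - 1) 4 3 z.
Definition power_cut2 (z : R) : R :=
  a * ((a - 1) * bump (a - 2) 4 4 z + 4 * bump (a - 2) 3 4 z - 4 * bump (a - 2) 4 3 z)
  + 4 * (a * bump (a - 2) 3 4 z + 3 * bump (a - 2) 2 4 z - 4 * bump (a - 2) 3 3 z)
  - 4 * ((a - 2) * bump (a - 2) 4 3 z + 4 * bump (a - 2) 3 3 z - 3 * bump (a - 2) 4 2 z).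
(** For z > 0 this is [power_cut1 z / z], in a form to which the estimates on bumps apply. *)
Definition power_cut1_div (z : R) : R :=
  a * bump (a - 2) 4 4 z + 4 * bump (a - 2) 3 4 z - 4 * bump (a - 2) 4 3 z.
Definition power_cut_gen (z : R) : R :=
  kappa / 2 * power_cut2 z - b * power_cut1_div z.

Lemma is_derive_power_cut (z : R) : 0 < z -> is_derive z 1 power_cut (power_cut1 z).
Proof.
move=> z0; apply: (is_derive_eq (is_derive_bump a 2 2 z0)).
by rewrite /power_cut1; ring.
Qed.

Lemma is_derive_power_cut1 (z : R) : 0 < z -> is_derive z 1 power_cut1 (power_cut2 z).
Proof.
move=> z0.
have d1 := is_derive_bump (a - 1) 2 2 z0.
have d2 := is_derive_bump (a - 1) 1 2 z0.
have d3 := is_derive_bump (a - 1) 2 1 z0.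
have d := is_deriveB (is_deriveD (is_deriveZ a d1) (is_deriveZ 4 d2)) (is_deriveZ 4 d3).
have -> : power_cut1 = a \*: bump (a - 1) 4 4 + 4 \*: bump (a - 1) 3 4 - 4 \*: bump (a - 1) 4 3.
  by [].
apply: (is_derive_eq d); rewrite /GRing.scale/= /power_cut2.
have -> : a - 1 - 1 = a - 2 by ring.
by ring.
Qed.

Lemma power_cut1E z : 0 < z -> power_cut1 z / z = power_cut1_div z.
Proof.
move=> z0; rewrite /power_cut1 /power_cut1_div.
have E p q : bump (a - 1) p q z = z * bump (a - 2) p q z.
  rewrite /bump z0 [RHS]mulrA; congr (_ * _).
  have -> : a - 1 = 1 + (a - 2) by ring.
  by rewrite (@powRD _ z 1) ?(gt_eqF z0) ?implybT// powRr1// ltW.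
by rewrite !E; field; rewrite gt_eqF.
Qed.

Lemma power_cut_test : exists K, test_function eps K power_cut power_cut1 power_cut2.
Proof.
have [K0 h0] : bounded_on_pos power_cut by exact: bounded_bump.
have [K1 h1] : bounded_on_pos power_cut1.
  rewrite /power_cut1; under eq_fun do rewrite -mulNr.
  by do ?apply: bounded_on_posD; apply: bounded_on_posZ; exact: bounded_bump.
have [K2 h2] : bounded_on_pos power_cut2.
  rewrite /power_cut2; under eq_fun do rewrite -!mulNr.
  do ?apply: bounded_on_posD; apply: bounded_on_posZ;
    do ?apply: bounded_on_posD; apply: bounded_on_posZ; exact: bounded_bump.
have [K3 h3] : lipschitz_on_pos power_cut2.
  rewrite /power_cut2; under eq_fun do rewrite -!mulNr.
  do ?apply: lipschitz_on_posD; apply: lipschitz_on_posZ;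
    do ?apply: lipschitz_on_posD; apply: lipschitz_on_posZ; exact: lipschitz_bump.
pose K := `|K0| + `|K1| + `|K2| + `|K3|.
have n0 := normr_ge0 K0; have n1 := normr_ge0 K1.
have n2 := normr_ge0 K2; have n3 := normr_ge0 K3.
have m0 := ler_norm K0; have m1 := ler_norm K1.
have m2 := ler_norm K2; have m3 := ler_norm K3.
exists K; split.
- by move=> z ze; rewrite /power_cut /power_cut1 /power_cut2 !bump_near0//; split; ring.
- by move=> z; have := h0 z; have := h1 z; have := h2 z; rewrite /K; split; lra.
- move=> z w z0 w0.
  apply: taylor_pos => // [u|u|u v u0 v0]; [exact: is_derive_power_cut|exact: is_derive_power_cut1|].
  apply: le_trans (h3 _ _ u0 v0) _; apply: ler_wpM2r => //; rewrite /K; lra.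
Qed.

Lemma power_cut_gen_lip : lipschitz_on_pos power_cut_gen.
Proof.
rewrite /power_cut_gen; under eq_fun do rewrite -mulNr.
apply: lipschitz_on_posD; apply: lipschitz_on_posZ.
  rewrite /power_cut2; under eq_fun do rewrite -!mulNr.
  do ?apply: lipschitz_on_posD; apply: lipschitz_on_posZ;
    do ?apply: lipschitz_on_posD; apply: lipschitz_on_posZ; exact: lipschitz_bump.
rewrite /power_cut1_div; under eq_fun do rewrite -!mulNr.
do ?apply: lipschitz_on_posD; apply: lipschitz_on_posZ; exact: lipschitz_bump.
Qed.

Lemma power_cut_gen_near0 z : z <= eps -> power_cut_gen z = 0.
Proof.
by move=> ze; rewrite /power_cut_gen /power_cut2 /power_cut1_div !bump_near0//; ring.
Qed.

(* [z `^ c] does not vanish for [z < 0], and [0 `^ 0 = 1]; with the test,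
   [power_pos 0] is the indicator function of [0 < z]. *)
Definition power_pos (c z : R) : R := if 0 < z then z `^ c else 0.

Definition power_cut_gen_bound : R :=
  `|kappa / 2| * (`|a| * (`|a - 1| + 8) + 4 * (`|a| + 7) + 4 * (`|a - 2| + 7))
  + `|b| * (`|a| + 8).

(** The bound is free of eps: every term is a bump of exponent a - 2, whose cut-off factors lie in
    [0, 1]. It supplies the dominating function for the removal of the cut-offs. *)
Lemma power_cut_gen_le z :
  `|power_cut_gen z| <= power_cut_gen_bound * power_pos (a - 2) z.
Proof.
set P := power_pos _ _.
have B p q : `|bump (a - 2) p q z| <= P.
  by have /andP[h1 h2] := bump_le (a - 2) p q z; rewrite ger0_norm.
have P0 : 0 <= P by exact: le_trans (B 1 1).
have S c p q : `|c * bump (a - 2) p q z| <= `|c| * P.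
  by rewrite normrM; apply: ler_wpM2l.
have n4 : `|4| = 4 :> R by rewrite ger0_norm.
have n3 : `|3| = 3 :> R by rewrite ger0_norm.
have T c1 c2 c3 p1 q1 p2 q2 p3 q3 :
    `|c1 * bump (a - 2) p1 q1 z + c2 * bump (a - 2) p2 q2 z - c3 * bump (a - 2) p3 q3 z|
    <= (`|c1| + `|c2| + `|c3|) * P.
  apply: le_trans (ler_normB _ _) _; rewrite !mulrDl; apply: lerD => //.
  by apply: le_trans (ler_normD _ _) _; apply: lerD.
have T2 : `|power_cut2 z| <=
    (`|a| * (`|a - 1| + 8) + 4 * (`|a| + 7) + 4 * (`|a - 2| + 7)) * P.
  rewrite /power_cut2; apply: le_trans (ler_normB _ _) _.
  rewrite [leRHS]mulrDl [X in _ <= X + _]mulrDl.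
  apply: lerD; first (apply: le_trans (ler_normD _ _) _; apply: lerD).
  - rewrite normrM -[leRHS]mulrA; apply: ler_wpM2l => //; apply: le_trans (T _ _ _ _ _ _ _ _ _) _.
    by rewrite n4; apply: ler_wpM2r => //; lra.
  - rewrite normrM n4 -[leRHS]mulrA; apply: ler_wpM2l => //; apply: le_trans (T _ _ _ _ _ _ _ _ _) _.
    by rewrite n4 n3; apply: ler_wpM2r => //; lra.
  - rewrite normrM n4 -[leRHS]mulrA; apply: ler_wpM2l => //; apply: le_trans (T _ _ _ _ _ _ _ _ _) _.
    by rewrite n4 n3; apply: ler_wpM2r => //; lra.
rewrite /power_cut_gen /power_cut_gen_bound mulrDl.
apply: le_trans (ler_normB _ _) _; apply: lerD.
  by rewrite normrM -[leRHS]mulrA; exact: ler_wpM2l.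
rewrite normrM -[leRHS]mulrA; apply: ler_wpM2l => //; apply: le_trans (T _ _ _ _ _ _ _ _ _) _.
by rewrite n4; apply: ler_wpM2r => //; lra.
Qed.
End power.
End bump.

Lemma bump_cvg (a : R) (p q : nat) (z : R) :
  bump (n.+2%:R^-1) a p q z @[n --> \oo] --> power_pos a z.
Proof.
rewrite /bump /power_pos; case: ifPn => z0; last exact: cvg_cst.
rewrite -[X in _ --> X]mulr1; apply: cvgM; first exact: cvg_cst.
have inv0 : (n.+2%:R^-1 : R) @[n --> \oo] --> (0 : R).
  have := @cvg_harmonic R; rewrite -cvg_shiftS; apply.
have max1 (u : nat -> R) : u n @[n --> \oo] --> (1 : R) -> Num.max (u n) 0 @[n --> \oo] --> (1 : R).
  move=> u1; have := cvg_comp _ _ u1 (continuous_max0 (x := 1)).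
  by rewrite max_l// ler01.
have pow1 k (u : nat -> R) : u n @[n --> \oo] --> (1 : R) -> u n ^+ k @[n --> \oo] --> (1 : R).
  move=> u1; have := cvg_comp _ _ u1 (@exprn_continuous R k 1).
  by rewrite expr1n.
rewrite -[X in _ --> X]mulr1; apply: cvgM; apply: pow1; apply: max1.
  rewrite -[X in _ --> X]subr0; apply: cvgB; first exact: cvg_cst.
  by rewrite -[X in _ --> X](mul0r z^-1); apply: cvgM => //; exact: cvg_cst.
rewrite -[X in _ --> X]subr0; apply: cvgB; first exact: cvg_cst.
by rewrite -[X in _ --> X](mul0r z); apply: cvgM => //; exact: cvg_cst.
Qed.

(** All bumps of exponent a - 2 have the same limit, so the terms created by the cut-offs cancel,
    and what is left is the action of the Bessel generator on z^a. *)
Lemma power_cut_gen_cvg (kappa b a z : R) :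
  power_cut_gen (n.+2%:R^-1) kappa b a z @[n --> \oo] -->
  (kappa / 2 * (a * (a - 1)) - b * a) * power_pos (a - 2) z.
Proof.
have -> : (kappa / 2 * (a * (a - 1)) - b * a) * power_pos (a - 2) z =
  let P := power_pos (a - 2) z in
  kappa / 2 * (a * ((a - 1) * P + 4 * P - 4 * P) + 4 * (a * P + 3 * P - 4 * P)
  - 4 * ((a - 2) * P + 4 * P - 3 * P)) - b * (a * P + 4 * P - 4 * P) by rewrite /=; ring.
rewrite /power_cut_gen /power_cut2 /power_cut1_div.
have S c p q : c * bump (n.+2%:R^-1) (a - 2) p q z @[n --> \oo] --> c * power_pos (a - 2) z.
  by apply: cvgM; [exact: cvg_cst|exact: bump_cvg].
have T c1 c2 c3 p1 q1 p2 q2 p3 q3 :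
   c1 * bump (n.+2%:R^-1) (a - 2) p1 q1 z + c2 * bump (n.+2%:R^-1) (a - 2) p2 q2 z
   - c3 * bump (n.+2%:R^-1) (a - 2) p3 q3 z @[n --> \oo] -->
   c1 * power_pos (a - 2) z + c2 * power_pos (a - 2) z - c3 * power_pos (a - 2) z.
  by apply: cvgB => //; apply: cvgD.
apply: cvgB; (apply: cvgM; first exact: cvg_cst) => //.
apply: cvgB; last by apply: cvgM; first exact: cvg_cst.
by apply: cvgD; (apply: cvgM; first exact: cvg_cst).
Qed.
End test.

(** * Brownian increments *)

Section normal_moments.
Variable R : realType.
Notation mu := (@lebesgue_measure R).
Implicit Types (s x : R).

(** The Radon-Nikodym derivative of the normal law is almost everywhere [normal_pdf], as both have
    the same integral over every measurable set. *)
Lemma ge0_integral_normal s (f : R -> \bar R) :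
  measurable_fun setT f -> (forall x, (0 <= f x)%E) ->
  (\int[normal_prob 0 s]_x f x = \int[mu]_x (f x * (normal_pdf 0 s x)%:E))%E.
Proof.
move=> mf f0; have dom := normal_prob_dominates (0 : R) s.
have mpdf : measurable_fun setT (fun x : R => (normal_pdf 0 s x)%:E).
  by apply/measurable_EFinP; exact: measurable_normal_pdf.
rewrite -(Radon_Nikodym_SigmaFinite.change_of_variables dom)//.
have mRN := measurable_int _ (Radon_Nikodym_SigmaFinite.f_integrable dom).
apply: ge0_ae_eq_integral => //.
- exact: emeasurable_funM.
- exact: emeasurable_funM.
- by move=> x _; rewrite mule_ge0// Radon_Nikodym_SigmaFinite.f_ge0.
- by move=> x _; rewrite mule_ge0// lee_fin normal_pdf_ge0.
have : ae_eq mu setT (Radon_Nikodym_SigmaFinite.f (normal_prob 0 s) mu)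
    (fun x => (normal_pdf 0 s x)%:E).
  apply: integral_ae_eq => //; first exact: Radon_Nikodym_SigmaFinite.f_integrable.
  by move=> A _ mA; rewrite -Radon_Nikodym_SigmaFinite.f_integral.
by apply: filterS => x h xT; rewrite h.
Qed.

Lemma expR_ge_sqr4 (u : R) : 0 <= u -> u ^+ 2 / 4 <= expR u.
Proof.
move=> u0; have -> : u = u / 2 + u / 2 by lra.
rewrite expRD; have := expR_ge1Dx (u / 2) => h; have := sqr_ge0 (expR (u / 2)); nra.
Qed.

(** Half of the Gaussian exponent absorbs the polynomial. With u = x^2 / (4 s^2) one has x^4 = 16
    s^4 u^2 and u^2 exp(-u) <= 4, and the remaining exp(-u) belongs to the normal law of variance 2
    s^2, whose peak is at least half of the original one; thus 128 = 16 * 4 * 2. *)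
Lemma normal_pow4 s : 0 < s ->
  (\int[normal_prob 0 s]_x (x ^+ 4)%:E <= (128 * s ^+ 4)%:E)%E.
Proof.
move=> s0; rewrite ge0_integral_normal; last 2 first.
- by apply/measurable_EFinP; exact: measurable_funX.
- by move=> x; rewrite lee_fin (exprM x 2 2) sqr_ge0.
pose s2 := Num.sqrt 2 * s.
have s20 : 0 < s2 by rewrite mulr_gt0// sqrtr_gt0.
have s2E : s2 ^+ 2 = 2 * s ^+ 2 by rewrite exprMn sqr_sqrtr.
rewrite -[leRHS]mule1 -(integral_normal_pdf 0 s2) -ge0_integralZl_EFin//; last 3 first.
- by move=> x _; rewrite lee_fin normal_pdf_ge0.
- by apply/measurable_EFinP; exact: measurable_normal_pdf.
- by rewrite mulr_ge0// exprn_ge0// ltW.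
apply: ge0_le_integral => //.
- by move=> x _; rewrite -EFinM lee_fin mulr_ge0 ?normal_pdf_ge0// (exprM x 2 2) sqr_ge0.
- apply/measurable_EFinP; apply: measurable_funM; first exact: measurable_funX.
  exact: measurable_normal_pdf.
- by apply/measurable_EFinP; apply: measurable_funM => //; exact: measurable_normal_pdf.
move=> x _; rewrite -!EFinM lee_fin !normal_pdfE ?gt_eqF// /normal_fun subr0 s2E.
have pk : normal_peak s <= 2 * normal_peak s2.
  rewrite /normal_peak s2E.
  have p0 : 0 < s ^+ 2 * pi *+ 2 by rewrite mulrn_wgt0// mulr_gt0 ?exprn_gt0 ?pi_gt0.
  have -> : 2 * s ^+ 2 * pi *+ 2 = 2 * (s ^+ 2 * pi *+ 2) by rewrite mulrnAr !mulrA.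
  rewrite sqrtrM// -[X in X <= _]invrK invrK.
  set q := Num.sqrt (_ *+ 2); have q0 : 0 < q by rewrite sqrtr_gt0.
  have r2 : Num.sqrt 2 <= 2 :> R by rewrite -(@ler_pXn2r _ 2)// ?nnegrE ?sqrtr_ge0// sqr_sqrtr//; lra.
  have r20 : 0 < Num.sqrt 2 :> R by rewrite sqrtr_gt0.
  rewrite invfM mulrA ler_peMl ?invr_ge0 ?(ltW q0)//.
  by rewrite ler_pdivlMr// mul1r.
pose u := x ^+ 2 / (4 * s ^+ 2).
have u0 : 0 <= u by rewrite divr_ge0 ?sqr_ge0// mulr_ge0// sqr_ge0.
have -> : - x ^+ 2 / (s ^+ 2 *+ 2) = - u + - u.
  by rewrite /u -[s ^+ 2 *+ 2]mulr_natl; field; rewrite gt_eqF.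
have -> : - x ^+ 2 / ((2 * s ^+ 2) *+ 2) = - u.
  by rewrite /u -[(2 * s ^+ 2) *+ 2]mulr_natl; field; rewrite gt_eqF.
have x4 : x ^+ 4 = 16 * s ^+ 4 * u ^+ 2 by rewrite /u; field; rewrite gt_eqF.
have ee : u ^+ 2 * expR (- u) <= 4.
  by rewrite expRN ler_pdivrMr ?expR_gt0//; have := expR_ge_sqr4 u0; lra.
rewrite expRD x4.
have -> : 16 * s ^+ 4 * u ^+ 2 * (normal_peak s * (expR (- u) * expR (- u))) =
  16 * s ^+ 4 * ((u ^+ 2 * expR (- u)) * normal_peak s) * expR (- u) by ring.
rewrite [leRHS]mulrA; apply: ler_wpM2r; first exact: expR_ge0.
have -> : 128 * s ^+ 4 * normal_peak s2 = 16 * s ^+ 4 * (4 * (2 * normal_peak s2)) by ring.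
apply: ler_wpM2l; first by rewrite mulr_ge0// exprn_ge0// ltW.
apply: ler_pM => //; last exact: normal_peak_ge0.
by rewrite mulr_ge0 ?sqr_ge0 ?expR_ge0.
Qed.

Lemma normal_integrable_pow s k : 0 < s -> (k <= 4)%N ->
  (normal_prob 0 s).-integrable setT (fun x => (x ^+ k)%:E).
Proof.
move=> s0 k4.
have i4 : (normal_prob 0 s).-integrable setT (fun x => (x ^+ 4)%:E).
  apply/integrableP; split; first by apply/measurable_EFinP; exact: measurable_funX.
  under eq_integral do rewrite gee0_abs ?lee_fin ?(exprM _ 2 2) ?sqr_ge0// -exprM.
  exact: le_lt_trans (normal_pow4 s0) (ltry _).
pose g x := (1 + x ^+ 4)%:E.
apply: (@le_integrable _ _ R (normal_prob 0 s) setT measurableT (fun x => (x ^+ k)%:E) g).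
- by apply/measurable_EFinP; exact: measurable_funX.
- move=> x _; rewrite /= lee_fin normrX [leRHS]ger0_norm; last first.
    by rewrite addr_ge0// (exprM x 2 2) sqr_ge0.
  have -> : x ^+ 4 = `|x| ^+ 4 by rewrite -normrX ger0_norm// (exprM x 2 2) sqr_ge0.
  have [x1|/ltW x1] := leP `|x| 1.
    by apply: le_trans (_ : 1 <= _); [exact: exprn_ile1|rewrite lerDl exprn_ge0].
  by apply: le_trans (ler_weXn2l x1 k4) _; rewrite lerDr.
rewrite (_ : g = (cst 1%E \+ (fun x : R => (x ^+ 4)%:E))%E)//.
by apply: integrableD => //; exact: finite_measure_integrable_cst.
Qed.

Lemma integral_symmetric_cvg (f : R -> R) : mu.-integrable setT (EFin \o f) ->
  (\int[mu]_(x in `[(- n%:R)%R, n%:R%R]) (f x)%:E)%E @[n --> \oo] --> (\int[mu]_x (f x)%:E)%E.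
Proof.
move=> fi; have mf := measurable_int _ fi.
have -> : (fun n : nat => \int[mu]_(x in `[(- n%:R)%R, n%:R%R]) (f x)%:E)%E =
  (fun n : nat => \int[mu]_x ((EFin \o f) \_ `[(- n%:R)%R, n%:R%R]) x)%E.
  by apply/funext => n; rewrite -integral_mkcond.
apply: (@dominated_cvg _ _ _ mu setT measurableT _ (EFin \o f) (abse \o (EFin \o f))) => //.
- by move=> n; apply/(measurable_restrictT _ _).1 => //; exact: measurable_funTS.
- move=> x _; apply: (@cvg_near_cst _ _ _ _ _ _).
  near=> n; rewrite patchE mem_set//= in_itv/= -ler_norml.
  by near: n; exact: nbhs_infty_ger.
- exact: integrable_abse.
- move=> n x _; rewrite patchE; case: ifPn => //= _.
  by rewrite normr0 lee_fin.
Unshelve. all: by end_near. Qed.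

Lemma integral_antiderivative0 (f G : R -> R) :
  mu.-integrable setT (EFin \o f) -> continuous f ->
  (forall x, is_derive x 1 G (f x)) ->
  (fun n : nat => G n%:R - G (- n%:R)) @ \oo --> (0 : R) ->
  (\int[mu]_x (f x)%:E = 0)%E.
Proof.
move=> fi cf dG G0; have := integral_symmetric_cvg fi => /cvg_lim <-//.
have cG : continuous G.
  by move=> x; apply/differentiable_continuous/derivable1_diffP; have [] := dG x.
apply/cvg_lim => //.
apply: (@cvg_trans _ (EFin (G n%:R - G (- n%:R)) @[n --> \oo])); last first.
  by apply: cvg_EFin; [exact: nearW|exact: G0].
apply: near_eq_cvg; near=> n.
have n0 : (0 < n)%N by near: n; exact: nbhs_infty_gt.
rewrite (@continuous_FTC2 _ f G)//.
- by rewrite -subr_gt0 opprK -natrD ltr0n addn_gt0 n0.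
- by apply: continuous_subspaceT.
- split; first by move=> x _; have [] := dG x.
  + by apply: cvg_at_right_filter; exact: cG.
  + by apply: cvg_at_left_filter; exact: cG.
- by move=> x _; rewrite derive1E; have [_ ->] := dG x.
Unshelve. all: by end_near. Qed.

(** The nonnegative case extends to signed functions through f = (|f| + f) - |f|. *)
Lemma integral_normal s (f : R -> R) :
  (normal_prob 0 s).-integrable setT (EFin \o f) ->
  mu.-integrable setT (fun x => (f x * normal_pdf 0 s x)%:E) /\
  (\int[normal_prob 0 s]_x (f x)%:E = \int[mu]_x (f x * normal_pdf 0 s x)%:E)%E.
Proof.
move=> fi; have mf : measurable_fun setT f.
  by apply/measurable_EFinP; exact: measurable_int fi.
have mp := measurable_normal_pdf (0 : R) s.
pose N : measure _ R := normal_prob 0 s.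
have ge0_case (g : R -> R) : (forall x, 0 <= g x) -> N.-integrable setT (EFin \o g) ->
    mu.-integrable setT (fun x => (g x * normal_pdf 0 s x)%:E) /\
    (\int[normal_prob 0 s]_x (g x)%:E = \int[mu]_x (g x * normal_pdf 0 s x)%:E)%E.
  move=> g0 gi; have mg : measurable_fun setT g.
    by apply/measurable_EFinP; exact: measurable_int gi.
  have e : (\int[normal_prob 0 s]_x (g x)%:E = \int[mu]_x (g x * normal_pdf 0 s x)%:E)%E.
    by rewrite ge0_integral_normal//; apply/measurable_EFinP.
  split => //; apply/integrableP; split.
    by apply/measurable_EFinP; exact: measurable_funM.
  under eq_integral do rewrite gee0_abs ?lee_fin ?mulr_ge0 ?normal_pdf_ge0//.
  rewrite -e; move/integrableP : gi => [_].
  by under eq_integral do rewrite /= ger0_norm//.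
have ni : N.-integrable setT (EFin \o (fun x => `|f x|)).
  exact: (integrable_abse fi).
have pi : N.-integrable setT (EFin \o (fun x => `|f x| + f x)).
  pose na x := `|f x|.
  rewrite (_ : EFin \o _ = ((EFin \o na) \+ (EFin \o f))%E)//.
  exact: integrableD.
have [i1 e1] := ge0_case _ (fun x => normr_ge0 (f x)) ni.
have [|i2 e2] := ge0_case _ _ pi.
  by move=> x; have := ler_norm (- f x); rewrite normrN; lra.
have E (x : R) : (f x * normal_pdf 0 s x)%:E =
   (((`|f x| + f x) * normal_pdf 0 s x)%:E - (`|f x| * normal_pdf 0 s x)%:E)%E.
  by rewrite -EFinB; congr EFin; ring.
split.
  have := integrableB measurableT i2 i1; congr (_.-integrable _ _).
  by apply/funext => x; rewrite E.
under [RHS]eq_integral do rewrite E.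
rewrite (integralB measurableT i2 i1) -e1 -e2 -(integralB measurableT pi ni).
by apply: eq_integral => x _ /=; rewrite -EFinB addrAC subrr add0r.
Qed.

Lemma is_derive_normal_pdf s x : 0 < s ->
  is_derive x 1 (normal_pdf 0 s) (- (x / s ^+ 2) * normal_pdf 0 s x).
Proof.
move=> s0; rewrite normal_pdfE ?gt_eqF// /normal_fun.
pose q (y : R) : R := - (s ^+ 2 *+ 2)^-1 * y ^+ 2.
have dq : is_derive x 1 q (- (x / s ^+ 2)).
  have d2 := @is_deriveX R R^o id 2 x 1 1 (is_derive_id x (1 : R)).
  have := is_deriveZ (- (s ^+ 2 *+ 2)^-1) d2; rewrite exprfctE => h.
  apply: (is_derive_eq h).
  change (- (s ^+ 2 *+ 2)^-1 * (2 * x ^+ 1 * 1) = - (x / s ^+ 2)).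
  by rewrite -[s ^+ 2 *+ 2]mulr_natl; field; rewrite gt_eqF.
have de := is_derive1_comp (is_derive_expR (q x)) dq.
have -> : (fun x0 : R => normal_peak s * expR (- (x0 - 0) ^+ 2 / (s ^+ 2 *+ 2))) =
   normal_peak s \*: (expR \o q).
  apply/funext => y; rewrite subr0 /q.
  change (normal_peak s * expR (- y ^+ 2 / (s ^+ 2 *+ 2)) =
    normal_peak s * expR (- (s ^+ 2 *+ 2)^-1 * y ^+ 2)).
  by congr (_ * expR _); ring.
apply: (is_derive_eq (is_deriveZ (normal_peak s) de)).
change (normal_peak s * (expR (q x) * - (x / s ^+ 2)) =
  - (x / s ^+ 2) * (normal_peak s * expR (- (x - 0) ^+ 2 / (s ^+ 2 *+ 2)))).
by rewrite subr0 /q (_ : - x ^+ 2 / _ = - (s ^+ 2 *+ 2)^-1 * x ^+ 2); ring.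
Qed.

Lemma normal_pdfN s x : 0 < s -> normal_pdf 0 s (- x) = normal_pdf 0 s x.
Proof. by move=> s0; rewrite normal_pdfE ?gt_eqF// /normal_fun !subr0 sqrrN. Qed.

Lemma continuous_normal_pdf0 s : 0 < s -> continuous (normal_pdf (0 : R) s).
Proof. by move=> s0; apply: continuous_normal_pdf; rewrite gt_eqF. Qed.

Lemma normal_mean s : 0 < s -> (\int[normal_prob 0 s]_x x%:E = 0)%E.
Proof.
move=> s0; have i1 := normal_integrable_pow s0 (isT : (1 <= 4)%N).
have [fi ->] := @integral_normal s id i1.
apply: (@integral_antiderivative0 _ (fun x => - s ^+ 2 * normal_pdf 0 s x)) => //.
- by move=> x; apply: cvgM; [exact: cvg_id|exact: continuous_normal_pdf0].
- move=> x; apply: (is_derive_eq (is_deriveZ (- s ^+ 2) (is_derive_normal_pdf x s0))).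
  change (- s ^+ 2 * (- (x / s ^+ 2) * normal_pdf 0 s x) = x * normal_pdf 0 s x).
  by field; rewrite gt_eqF.
- by apply: cvg_near_cst; apply: nearW => n; rewrite normal_pdfN// subrr.
Qed.

(** With p the density, s^2 x p(x) is an antiderivative of (s^2 - x^2) p(x) and vanishes at
    infinity. *)
Lemma normal_variance s : 0 < s -> (\int[normal_prob 0 s]_x (x ^+ 2)%:E = (s ^+ 2)%:E)%E.
Proof.
move=> s0; have i2 := normal_integrable_pow s0 (isT : (2 <= 4)%N).
have ic : (normal_prob 0 s).-integrable setT (EFin \o (cst (s ^+ 2))).
  exact: finite_measure_integrable_cst.
have iB := integrableB measurableT ic i2.
suff : (\int[normal_prob 0 s]_x (s ^+ 2 - x ^+ 2)%:E = 0)%E.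
  under eq_integral do rewrite EFinB.
  rewrite (integralB measurableT ic i2) /= integral_cst//= probability_setT mule1.
  have /fineK <- : (\int[normal_prob 0 s]_x (x ^+ 2)%:E)%E \is a fin_num.
    exact: (integrable_fin_num measurableT i2).
  by rewrite -EFinB => -[/eqP]; rewrite subr_eq0 => /eqP <-.
have [fi ->] := @integral_normal s (fun x => s ^+ 2 - x ^+ 2) iB.
apply: (@integral_antiderivative0 _ (fun x => s ^+ 2 * (x * normal_pdf 0 s x))) => //.
- move=> x; apply: cvgM; last exact: continuous_normal_pdf0.
  by apply: cvgB; [exact: cvg_cst|exact: exprn_continuous].
- move=> x.
  have d := is_deriveZ (s ^+ 2) (is_deriveM (is_derive_id x (1 : R)) (is_derive_normal_pdf x s0)).
  apply: (is_derive_eq d).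
  change (s ^+ 2 * (x * (- (x / s ^+ 2) * normal_pdf 0 s x) + normal_pdf 0 s x * 1) =
    (s ^+ 2 - x ^+ 2) * normal_pdf 0 s x).
  by field; rewrite gt_eqF.
- have s0' := ltW s0; pose C := 4 * s ^+ 4 * normal_peak s.
  apply: (@squeeze_cvgr _ _ _ _ (cst 0) (fun n : nat => C * n%:R^-1)); last 2 first.
  + exact: cvg_cst.
  + rewrite -[X in _ --> X](mulr0 C); apply: cvgM; first exact: cvg_cst.
    by rewrite -(cvg_shiftS (fun n : nat => n%:R^-1 : R)); exact: cvg_harmonic.
  near=> n; have n0 : 0 < n%:R :> R by rewrite ltr0n; near: n; exact: nbhs_infty_gt.
  rewrite normal_pdfN//.
  have -> : s ^+ 2 * (n%:R * normal_pdf 0 s n%:R) - s ^+ 2 * (- n%:R * normal_pdf 0 s n%:R) =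
     2 * s ^+ 2 * n%:R * normal_pdf 0 s n%:R by ring.
  rewrite !mulr_ge0 ?normal_pdf_ge0 ?sqr_ge0 ?(ltW n0)//=.
  rewrite normal_pdfE ?gt_eqF// /normal_fun subr0.
  pose u : R := n%:R ^+ 2 / (2 * s ^+ 2).
  have u0 : 0 < u by rewrite divr_gt0 ?exprn_gt0// mulr_gt0 ?exprn_gt0.
  have -> : - n%:R ^+ 2 / (s ^+ 2 *+ 2) = - u.
    by rewrite /u -[s ^+ 2 *+ 2]mulr_natl mulNr.
  have eu : expR (- u) <= u^-1.
    rewrite expRN lef_pV2 ?posrE ?expR_gt0//.
    by have := expR_ge1Dx u; lra.
  have -> : 2 * s ^+ 2 * n%:R * (normal_peak s * expR (- u)) =
    (2 * s ^+ 2 * n%:R * normal_peak s) * expR (- u) by ring.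
  apply: le_trans (_ : (2 * s ^+ 2 * n%:R * normal_peak s) * u^-1 <= _).
    by apply: ler_wpM2l => //; do !apply: mulr_ge0 => //; exact: normal_peak_ge0.
  rewrite [leLHS](_ : _ = C * n%:R^-1)// /u /C.
  by field; rewrite ?(gt_eqF s0) ?(gt_eqF n0).
Unshelve. all: by end_near. Qed.
End normal_moments.

Section independence.
Context d (T : measurableType d) (R : realType) (P : probability T R).

(** The values on rectangles identify the joint law of (W, G) with the product of the two laws;
    Fubini's theorem then isolates the mean of G. *)
Lemma independent_mean0 (W G : T -> R) (K : R) :
  measurable_fun setT W -> measurable_fun setT G ->
  (forall w, `|W w| <= K) -> P.-integrable setT (EFin \o G) ->
  (forall A A' : set R, measurable A -> measurable A' ->
    P (W @^-1` A `&` G @^-1` A') = P (W @^-1` A) * P (G @^-1` A'))%E ->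
  (\int[P]_w (G w)%:E = 0)%E ->
  P.-integrable setT (fun w => (W w * G w)%:E) /\ (\int[P]_w (W w * G w)%:E = 0)%E.
Proof.
move=> mW mG WK iG indep G0.
have mWG : measurable_fun setT (fun w => W w * G w) by exact: measurable_funM.
have K0 : 0 <= K by exact: le_trans (WK point).
have iWG : P.-integrable setT (fun w => (W w * G w)%:E).
  apply: (@le_integrable _ _ R P setT measurableT _ (fun w => (K * G w)%:E)).
  - exact/measurable_EFinP.
  - move=> w _; rewrite /= lee_fin !normrM (ger0_norm K0).
    by apply: ler_wpM2r.
  - exact: (integrableZl measurableT K iG).
split => //.
pose W' : {mfun T >-> R} := HB.pack W (isMeasurableFun.Build _ _ _ _ W mW).
pose G' : {mfun T >-> R} := HB.pack G (isMeasurableFun.Build _ _ _ _ G mG).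
have mpair := measurable_fun_pair mW mG.
pose H : T -> R * R := fun w => (W w, G w).
pose H' : {mfun T >-> (R * R)%type} :=
  HB.pack H (isMeasurableFun.Build _ _ _ _ H mpair).
pose m1 := distribution P W'.
pose m2 := distribution P G'.
pose m' := distribution P H'.
have m12 (X : set (R * R)) : measurable X -> (m1 \x m2)%E X = m' X.
  by apply: product_measure_unique => A A' mA mA'; exact: indep.
pose f (z : R * R) : \bar R := (z.1 * z.2)%:E.
have mf : measurable_fun setT f.
  by apply/measurable_EFinP; apply: measurable_funM; [exact: measurable_fst|exact: measurable_snd].
have e1 : (\int[P]_w (W w * G w)%:E = \int[m']_z f z)%E.
  rewrite (@integral_pushforward _ _ _ _ _ H mpair P setT f mf)//.
have if' : (m1 \x m2)%E.-integrable setT f.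
  apply/integrableP; split => //.
  rewrite (@eq_measure_integral _ _ _ _ m'); last by move=> A mA _; exact: m12.
  rewrite (@ge0_integral_pushforward _ _ _ _ _ H mpair)//.
    by move/integrableP : iWG => [].
  exact: measurableT_comp.
rewrite e1 -(@eq_measure_integral _ _ _ _ m' (m1 \x m2)%E); last by move=> A mA _; exact: m12.
rewrite -(integral12_prod_meas1 if').
have m2id : (\int[m2]_y y%:E = 0)%E.
  rewrite -G0 (@integral_pushforward _ _ _ _ _ G mG P setT EFin)//.
have im2 : m2.-integrable setT (fun y => y%:E).
  by apply: (@integrable_pushforward _ _ _ _ _ G mG P setT EFin).
apply: integral0_eq => x _; rewrite /fubini_F /f /=.
under eq_integral do rewrite EFinM.
by rewrite (integralZl measurableT im2) m2id mule0.
Qed.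
End independence.

Lemma measurable_abs_gt d (T : measurableType d) (R : realType) (U : T -> R) (l : R) :
  measurable_fun setT (fun w => `|U w|) -> measurable [set w | l < `|U w| ].
Proof.
move=> mU; rewrite (_ : [set w | _] = (fun w => `|U w|) @^-1` `]l, +oo[).
  by rewrite -[X in measurable X]setTI; exact: mU.
by apply/seteqP; split => w /=; rewrite in_itv/= andbT.
Qed.

Section brownian.
Context d (T : measurableType d) (R : realType) (P : probability T R).
Variables (F : R -> set_system T) (B : R -> T -> R).
Hypothesis bm : brownian_motion P F B.

Definition adapted_at (t : R) (U : T -> R) : Prop :=
  forall A : set R, measurable A -> F t (U @^-1` A).

(** [F t] is a bare family of sets; viewed as the measurable sets of a generated sigma-algebra it
    inherits the closure properties of measurable functions. *)
Lemma adapted_atP t U : 0 <= t -> adapted_at t U <->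
  measurable_fun (setT : set (g_sigma_algebraType (F t))) U.
Proof.
move=> t0; have [sF _ _] := bm_filtration bm.
have FE : <<s F t >> = F t by apply: sigma_algebra_id; exact: sF.
split.
  move=> aU _ A mA; rewrite setTI.
  have : <<s F t >> (U @^-1` A) by rewrite FE; exact: aU.
  by [].
move=> mU A mA; have := mU measurableT A mA; rewrite setTI -[X in X -> _]/(<<s F t >> (U @^-1` A)).
by rewrite FE.
Qed.

Lemma adapted_measurable t (E : set T) : 0 <= t -> F t E -> measurable E.
Proof. by move=> t0; have [_ + _] := bm_filtration bm; apply. Qed.

Lemma adapted_at_measurable t U : 0 <= t -> adapted_at t U -> measurable_fun setT U.
Proof.
move=> t0 aU _ A mA; rewrite setTI; apply: (adapted_measurable t0); exact: aU.
Qed.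

Lemma adapted_at_comp t U (f : R -> R) : measurable_fun setT f -> adapted_at t U ->
  adapted_at t (fun w => f (U w)).
Proof.
move=> mf aU A mA; have := mf measurableT A mA; rewrite setTI => /aU; exact.
Qed.

Lemma adapted_atB t U U' : 0 <= t -> adapted_at t U -> adapted_at t U' ->
  adapted_at t (fun w => U w - U' w).
Proof.
move=> t0 /(adapted_atP _ t0) mU /(adapted_atP _ t0) mU'; apply/(adapted_atP _ t0).
exact: measurable_funB.
Qed.

Lemma adapted_at_le s t U : 0 <= s <= t -> adapted_at s U -> adapted_at t U.
Proof.
move=> st aU A mA; have [_ _ +] := bm_filtration bm; move/(_ s t st); apply; exact: aU.
Qed.

Lemma adapted_brownian s t : 0 <= s <= t -> adapted_at t (B s).
Proof.
move=> /[dup] st /andP[s0 _]; apply: (adapted_at_le st) => A mA.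
exact: (bm_adapted bm).
Qed.

Lemma brownian_measurable t : 0 <= t -> measurable_fun setT (B t).
Proof.
by move=> t0; apply: (adapted_at_measurable t0); apply: adapted_brownian; rewrite t0 lexx.
Qed.

Section increment.
Variables (s t : R).
Hypothesis st : 0 <= s < t.
Let D w := B t w - B s w.
Let sd := Num.sqrt (t - s).

Let sd0 : 0 < sd.
Proof. by rewrite sqrtr_gt0 subr_gt0; case/andP: st. Qed.

Let sd2 : sd ^+ 2 = t - s.
Proof. by rewrite sqr_sqrtr// subr_ge0 ltW//; case/andP: st. Qed.

Lemma increment_measurable : measurable_fun setT D.
Proof.
case/andP: st => s0 s_t; apply: measurable_funB; apply: brownian_measurable => //.
by rewrite (le_trans s0)// ltW.
Qed.

Let mD : @measurable_fun _ _ T (measurableTypeR R) setT D := increment_measurable.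
Let D0 : T -> measurableTypeR R := D.
Let D' : {mfun T >-> measurableTypeR R} := HB.pack D0 (isMeasurableFun.Build _ _ _ _ D0 mD).

Lemma ge0_integral_increment (f : R -> \bar R) :
  measurable_fun setT f -> (forall x, (0 <= f x)%E) ->
  (\int[P]_w f (D w) = \int[normal_prob 0 sd]_x f x)%E.
Proof.
move=> mf f0.
have := @eq_measure_integral _ _ R setT (normal_prob 0 sd) (distribution P D') f
  (fun A mA _ => bm_gaussian bm st mA).
move=> <-; apply/esym.
exact: (@ge0_integral_pushforward _ _ _ (measurableTypeR R) R D0 mD P setT f measurableT mf (fun x _ => f0 x)).
Qed.

Lemma increment_integrable (f : R -> R) :
  (normal_prob 0 sd).-integrable setT (EFin \o f) ->
  P.-integrable setT (fun w => (f (D w))%:E).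
Proof.
move=> fi; have mf := measurable_int _ fi.
apply/integrableP; split.
  exact: measurableT_comp mf increment_measurable.
rewrite (@ge0_integral_increment (fun x => `|(f x)%:E|%E))//.
  by move/integrableP : fi => [].
exact: measurableT_comp.
Qed.

Lemma integral_increment (f : R -> R) :
  (normal_prob 0 sd).-integrable setT (EFin \o f) ->
  (\int[P]_w (f (D w))%:E = \int[normal_prob 0 sd]_x (f x)%:E)%E.
Proof.
move=> fi; have mf := measurable_int _ fi.
have := @eq_measure_integral _ _ R setT (normal_prob 0 sd) (distribution P D') (EFin \o f)
  (fun A mA _ => bm_gaussian bm st mA).
move=> <-; apply/esym.
exact: (@integral_pushforward _ _ _ (measurableTypeR R) R D0 mD P setT (EFin \o f) mf (increment_integrable fi) measurableT).
Qed.

Lemma increment_pow_integrable k : (k <= 4)%N ->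
  P.-integrable setT (fun w => (D w ^+ k)%:E).
Proof. move=> k4; exact: (increment_integrable (normal_integrable_pow sd0 k4)). Qed.

Lemma increment_variance : (\int[P]_w (D w ^+ 2)%:E = (t - s)%:E)%E.
Proof.
by rewrite (integral_increment (normal_integrable_pow sd0 (isT : (2 <= 4)%N))) normal_variance// sd2.
Qed.

Lemma increment_pow4 : (\int[P]_w (D w ^+ 4)%:E <= (128 * (t - s) ^+ 2)%:E)%E.
Proof.
rewrite (integral_increment (normal_integrable_pow sd0 (isT : (4 <= 4)%N))).
by apply: le_trans (normal_pow4 sd0) _; rewrite (exprM sd 2 2) sd2.
Qed.

Lemma independent_increment (U : T -> R) (K : R) (f : R -> R) :
  adapted_at s U -> (forall w, `|U w| <= K) ->
  (normal_prob 0 sd).-integrable setT (EFin \o f) ->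
  (\int[normal_prob 0 sd]_x (f x)%:E = 0)%E ->
  P.-integrable setT (fun w => (U w * f (D w))%:E) /\
  (\int[P]_w (U w * f (D w))%:E = 0)%E.
Proof.
move=> aU UK fi f0; case/andP: (st) => s0 s_t.
have mf : measurable_fun setT f by apply/measurable_EFinP; exact: measurable_int fi.
apply: (independent_mean0 (K := K)) => //.
- exact: (adapted_at_measurable s0).
- exact: measurableT_comp mf increment_measurable.
- exact: increment_integrable.
- move=> A A' mA mA'.
  have mfA : measurable (f @^-1` A') by have := mf measurableT A' mA'; rewrite setTI.
  exact: (bm_independent bm st (aU A mA) mfA).
- by rewrite integral_increment.
Qed.

Lemma increment_mean (U : T -> R) (K : R) :
  adapted_at s U -> (forall w, `|U w| <= K) ->
  P.-integrable setT (fun w => (U w * D w)%:E) /\ (\int[P]_w (U w * D w)%:E = 0)%E.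
Proof.
move=> aU UK; apply: (@independent_increment U K id) => //; last exact: normal_mean.
exact: (normal_integrable_pow sd0 (isT : (1 <= 4)%N)).
Qed.

Lemma increment_sqr_mean (U : T -> R) (K : R) :
  adapted_at s U -> (forall w, `|U w| <= K) ->
  P.-integrable setT (fun w => (U w * (D w ^+ 2 - (t - s)))%:E) /\
  (\int[P]_w (U w * (D w ^+ 2 - (t - s)))%:E = 0)%E.
Proof.
move=> aU UK.
have i2 := normal_integrable_pow sd0 (isT : (2 <= 4)%N).
have ic : (normal_prob 0 sd).-integrable setT (EFin \o (cst (t - s))).
  exact: finite_measure_integrable_cst.
apply: (@independent_increment U K (fun x => x ^+ 2 - (t - s))) => //.
  exact: (integrableB measurableT i2 ic).
under eq_integral do rewrite EFinB.
rewrite (integralB measurableT i2 ic) normal_variance// sd2 /= integral_cst//=.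
by rewrite probability_setT mule1 -EFinB subrr.
Qed.

(** Markov's inequality for the fourth power, chosen to produce (t - s)^2: a bound of first order in
    t - s would not be negligible against the length of a step. *)
Lemma increment_tail (l : R) : 0 < l ->
  (P [set w | (l < `|D w|)%R ] <= (128 * (t - s) ^+ 2 / l ^+ 4)%:E)%E.
Proof.
move=> l0; have l40 : 0 < l ^+ 4 by exact: exprn_gt0.
have mnD : measurable_fun setT (fun w => `|D w|).
  by apply: measurableT_comp => //; exact: increment_measurable.
have mE : measurable [set w | l < `|D w| ] by exact: measurable_abs_gt.
rewrite EFinM lee_pdivlMr//; apply: le_trans increment_pow4.
rewrite -[X in P X]setIT -integral_indic// -ge0_integralZr//=; last 2 first.
- by apply/measurable_EFinP; exact: measurable_indic.
- by rewrite lee_fin ltW.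
apply: ge0_le_integral => //.
- by move=> w _; rewrite mule_ge0// lee_fin ltW.
- apply: emeasurable_funM => //; by apply/measurable_EFinP; exact: measurable_indic.
- by apply/measurable_EFinP; apply: measurable_funX; exact: increment_measurable.
move=> w _; rewrite -EFinM lee_fin indicE; case: (boolP (w \in _)) => [|_].
  rewrite inE /= mul1r => lD.
  have -> : D w ^+ 4 = `|D w| ^+ 4 by rewrite -normrX ger0_norm// (exprM _ 2 2) sqr_ge0.
  by apply: lerXn2r; rewrite ?nnegrE//; exact: ltW.
by rewrite mul0r (exprM _ 2 2) sqr_ge0.
Qed.
End increment.
End brownian.

(** * Maximal inequality and oscillation of Brownian motion over an interval *)

Section maximal.
Context d (T : measurableType d) (R : realType) (P : probability T R).
Variables (F : R -> set_system T) (B : R -> T -> R).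
Hypothesis bm : brownian_motion P F B.

Let pr (A : set T) : R := fine (P A).

Let prE A : measurable A -> P A = (pr A)%:E.
Proof. by move=> mA; rewrite /pr fineK// fin_num_measure. Qed.

Let pr_le A A' : measurable A -> measurable A' -> A `<=` A' -> pr A <= pr A'.
Proof.
by move=> mA mA' AA'; rewrite -lee_fin -!prE//; apply: le_measure; rewrite ?inE.
Qed.

Let prU A A' : measurable A -> measurable A' -> A `&` A' = set0 ->
  pr (A `|` A') = pr A + pr A'.
Proof.
move=> mA mA' AA'; apply: EFin_inj; rewrite EFinD -!prE//; last exact: measurableU.
by rewrite measureU.
Qed.

Lemma adapted_setD t (A A' : set T) : 0 <= t -> F t A -> F t A' -> F t (A `\` A').
Proof.
move=> t0 FA FA'; have [sF _ _] := bm_filtration bm.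
have FE : <<s F t >> = F t by apply: sigma_algebra_id; exact: sF.
rewrite -FE in FA FA' *.
exact: (@measurableD _ (g_sigma_algebraType (F t)) A A').
Qed.

Lemma adapted_setU t (A A' : set T) : 0 <= t -> F t A -> F t A' -> F t (A `|` A').
Proof.
move=> t0 FA FA'; have [sF _ _] := bm_filtration bm.
have FE : <<s F t >> = F t by apply: sigma_algebra_id; exact: sF.
rewrite -FE in FA FA' *.
exact: (@measurableU _ (g_sigma_algebraType (F t)) A A').
Qed.

Section grid.
Variables (t h l : R) (n : nat).
Hypotheses (t_ge0 : 0 <= t) (h_gt0 : 0 < h) (l_gt0 : 0 < l) (n_gt0 : (0 < n)%N)
  (hl : 256 * h ^+ 2 <= l ^+ 4).
Let q (k : nat) : R := t + h * (k%:R / n%:R).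
Let A k := [set w | 2 * l < `|B (q k) w - B t w| ].
Let E := fix E k := if k is k'.+1 then E k' `|` A k else A 0%N.
Let Tn := [set w | l < `|B (t + h) w - B t w| ].

Let n0 : 0 < n%:R :> R. Proof. by rewrite ltr0n. Qed.

Let q_ge k : t <= q k.
Proof. by rewrite lerDl mulr_ge0 ?divr_ge0// ltW. Qed.

Let q_le k k' : (k <= k')%N -> q k <= q k'.
Proof. by move=> kk; rewrite lerD2l ler_pM2l// ler_pM2r ?invr_gt0// ler_nat. Qed.

Let qn : q n = t + h.
Proof. by rewrite /q divff ?mulr1// gt_eqF. Qed.

Let q0 : q 0%N = t. Proof. by rewrite /q mul0r mulr0 addr0. Qed.

Let q_lt k : (k < n)%N -> q k < t + h.
Proof. by move=> kn; rewrite ltrD2l gtr_pMr// ltr_pdivrMr// mul1r ltr_nat. Qed.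

Let qk0 k : 0 <= q k. Proof. exact: le_trans (q_ge k). Qed.

Let FA k k' : (k <= k')%N -> F (q k') (A k).
Proof.
move=> kk; have q' := q_le kk.
have a : adapted_at F (q k') (fun w => B (q k) w - B t w).
  apply: (adapted_atB bm (qk0 k')); apply: (adapted_brownian bm); first by rewrite qk0.
  by rewrite t_ge0 q_ge.
have /a : measurable [set x : R | 2 * l < `|x| ].
  by apply: (@measurable_abs_gt _ _ R id); exact: measurableT_comp.
by [].
Qed.

Let FE k k' : (k <= k')%N -> F (q k') (E k).
Proof.
elim: k => [|k ih] kk; first exact: FA.
by apply: adapted_setU => //; [apply: ih; exact: ltnW|exact: FA].
Qed.

Let mA k : measurable (A k). Proof. exact: (adapted_measurable bm (qk0 k) (FA (leqnn k))). Qed.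
Let mE k : measurable (E k). Proof. exact: (adapted_measurable bm (qk0 k) (FE (leqnn k))). Qed.

Let mTn : measurable Tn.
Proof.
apply: measurable_abs_gt; apply: measurableT_comp => //.
have th : t < t + h by rewrite ltrDl.
by apply: (@increment_measurable _ _ _ _ _ _ bm t (t + h)); rewrite t_ge0 th.
Qed.

(** On [G], which is known at time [q k], the path is more than 2 l away from its value at t. The
    increment from [q k] to t + h is independent of [G] and at most l with probability at least 1/2,
    by 256 h^2 <= l^4; the final displacement then still exceeds l. *)
Let first_exit k (G : set T) : (k <= n)%N -> F (q k) G -> G `<=` A k ->
  pr G <= 2 * pr (G `&` Tn).
Proof.
(* For k = n no increment is left, and the displacement at t + h exceeds 2 l, hence l. *)
rewrite leq_eqVlt => /orP[/eqP ->|kn] FG GA.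
  have -> : G `&` Tn = G.
    apply/setIidPl => w /GA; rewrite /A /Tn /= qn; apply: lt_trans.
    by move: l_gt0 => ?; lra.
  by have : 0 <= pr G by [rewrite fine_ge0]; lra.
have mG : measurable G by exact: (adapted_measurable bm (qk0 k) FG).
have st : 0 <= q k < t + h by rewrite qk0 q_lt.
pose D w := B (t + h) w - B (q k) w.
have mD : measurable_fun setT (fun w => `|D w|).
  by apply: measurableT_comp => //; exact: (increment_measurable bm st).
have mDl : measurable [set w | l < `|D w| ] by exact: measurable_abs_gt.
pose S := [set x : R | ~ (l < `|x|)].
have mS : measurable S.
  apply: measurableC; apply: (@measurable_abs_gt _ _ R id); exact: measurableT_comp.
have mDS : measurable [set w | S (D w)] by exact: measurableC.
have ind : pr (G `&` [set w | S (D w)]) = pr G * pr [set w | S (D w)].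
  apply: EFin_inj; rewrite EFinM -!prE//; last exact: measurableI.
  exact: (bm_independent bm st FG mS).
have half : 1 / 2 <= pr [set w | S (D w)].
  have : pr [set w | l < `|D w| ] + pr [set w | S (D w)] = 1.
    rewrite -prU//; last by apply/seteqP; split => w // -[].
    have -> : [set w | l < `|D w|] `|` [set w | S (D w)] = setT.
      by apply/seteqP; split => w // _; exact: lem.
    by rewrite /pr probability_setT.
  have : pr [set w | l < `|D w| ] <= 1 / 2.
    have := increment_tail bm st l_gt0; rewrite prE// lee_fin => /le_trans; apply.
    rewrite ler_pdivrMr ?exprn_gt0//.
    have : (t + h - q k) ^+ 2 <= h ^+ 2.
      apply: lerXn2r; rewrite ?nnegrE.
      - by move: (q_lt kn) => ?; lra.
      - by exact: ltW.
      - by move: (q_ge k) => ?; lra.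
    by move: hl => ?; lra.
  by lra.
have sub : G `&` [set w | S (D w)] `<=` G `&` Tn.
  move=> w [Gw Sw]; split => //; have := GA w Gw; rewrite /A /Tn /=.
  move/negP : Sw; rewrite -leNgt => Sw.
  have : `|B (q k) w - B t w| <= `|B (t + h) w - B t w| + `|D w|.
    have -> : B (q k) w - B t w = (B (t + h) w - B t w) - D w by rewrite /D; ring.
    exact: ler_normB.
  by lra.
have := pr_le _ _ sub; rewrite ind => H.
have {}H : pr G * pr [set w | S (D w)] <= pr (G `&` Tn).
  by apply: H; rewrite -?ind; exact: measurableI.
have : 0 <= pr G by rewrite fine_ge0.
by nra.
Qed.

Let exceed_le k : (k <= n)%N -> pr (E k) <= 2 * pr (E k `&` Tn).
Proof.
elim: k => [|k ih] kn; first by apply: (@first_exit 0%N) => //; exact: (FE (leqnn 0)).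
(* The event of a first exceedance at index [k.+1], which makes the union disjoint. *)
pose G := A k.+1 `\` E k.
have FG : F (q k.+1) G by apply: adapted_setD => //; [exact: FA|exact: FE].
have mG : measurable G by exact: (adapted_measurable bm (qk0 _) FG).
have -> : E k.+1 = E k `|` G.
  apply/seteqP; split => w /= [Ew|Aw]; [by left| |by left|by right; case: Aw].
  by have [Ew|nEw] := lem (E k w); [left|right].
rewrite setIUl !prU//; last 4 first.
- exact: measurableI.
- exact: measurableI.
- by rewrite setIACA [E k `&` G]setDIK set0I.
- by rewrite setDIK.
have := first_exit kn FG (@subDsetl _ _ _).
by have := ih (ltnW kn); lra.
Qed.

Let E_exists k w : E k w <-> exists j, (j <= k)%N /\ A j w.
Proof.
elim: k => [|k ih] /=.
  by split => [?|[j [+ +]]]; [exists 0%N|rewrite leqn0 => /eqP ->].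
split => [[/ih[j [jk Aj]]|Ak]|[j [jk Aj]]].
- by exists j; rewrite (leq_trans jk).
- by exists k.+1.
- move: jk; rewrite leq_eqVlt => /orP[/eqP <-|jk]; [by right|left].
  by apply/ih; exists j.
Qed.

Lemma ottaviani :
  let X := [set w | exists j, (j <= n)%N /\
    2 * l < `|B (t + h * (j%:R / n%:R)) w - B t w| ] in
  measurable X /\ (P X <= (256 * h ^+ 2 / l ^+ 4)%:E)%E.
Proof.
move=> X; have XE : X = E n by apply/seteqP; split => w /E_exists.
rewrite XE; split => //; rewrite prE// lee_fin.
apply: le_trans (exceed_le (leqnn n)) _.
have th : t < t + h by rewrite ltrDl.
have st : 0 <= t < t + h by rewrite t_ge0 th.
have := increment_tail bm st l_gt0; rewrite prE// lee_fin addrAC subrr add0r => H.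
have : pr (E n `&` Tn) <= pr Tn by apply: pr_le => //; exact: measurableI.
by rewrite -[256]/(2 * 128)%:R natrM -!mulrA; lra.
Qed.
End grid.

(** Dyadic grids are nested, so the exceptional events increase, and a bound that does not depend on
    the mesh passes to their union; continuity of the path extends the estimate from dyadic times to
    all times. The factor 16 comes from l = r / 2. *)
Lemma brownian_modulus : exists2 c : R, 0 < c & forall t h r : R,
  0 <= t -> 0 < h -> 0 < r -> c * h ^+ 2 <= r ^+ 4 ->
  exists X : set T, [/\ measurable X, (P X <= (c * h ^+ 2 / r ^+ 4)%:E)%E &
    forall w, {within `[0, +oo[, continuous (B ^~ w)} -> ~ X w ->
      forall s, t <= s <= t + h -> `|B s w - B t w| <= r].
Proof.
exists (256 * 16) => [|t h r t0 h0 r0 hr]; first by apply: mulr_gt0; rewrite ltr0n.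
pose l := r / 2; have l0 : 0 < l by rewrite divr_gt0.
have lE : l ^+ 4 = r ^+ 4 / 16 by rewrite /l; field.
have hl : 256 * h ^+ 2 <= l ^+ 4 by rewrite lE; lra.
pose X m := [set w | exists j, (j <= 2 ^ m)%N /\
    2 * l < `|B (t + h * (j%:R / (2 ^ m)%:R)) w - B t w| ].
have H m := @ottaviani t h l (2 ^ m) t0 h0 l0 ltac:(by rewrite expn_gt0) hl.
have mX m : measurable (X m) by exact: (H m).1.
have mU : measurable (\bigcup_m X m) by exact: bigcup_measurable.
exists (\bigcup_m X m); split => //.
- have ndX : {homo X : n m / (n <= m)%N >-> (n <= m)%O}.
    apply/nondecreasing_seqP => m; apply/subsetPset => w [j [jm Aj]].
    exists (2 * j)%N; split; first by rewrite expnS leq_mul2l jm orbT.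
    rewrite expnS !natrM.
    have -> : 2%:R * j%:R / (2%:R * (2 ^ m)%:R) = j%:R / (2 ^ m)%:R :> R; last exact: Aj.
    by rewrite -mulf_div divff ?mul1r// pnatr_eq0.
  have cX := nondecreasing_cvg_mu (mu := P) mX mU ndX.
  have -> : 256 * 16 * h ^+ 2 / r ^+ 4 = 256 * h ^+ 2 / l ^+ 4.
    by rewrite lE invf_div; move: (256 : R) (16 : R) => p q; ring.
  rewrite -(cvg_lim _ cX)//; apply: lime_le; first by apply/cvg_ex; eexists; exact: cX.
  by apply: nearW => m /=; exact: (H m).2.
- move=> w /within_continuousP cw nX s sth; rewrite leNgt; apply/negP => rs.
  have s0 : [set` `[0, +oo[] s by rewrite /= in_itv/= andbT; lra.
  pose e := `|B s w - B t w| - r; have e0 : 0 < e by rewrite subr_gt0.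
  have [dl d0 hd] := cw s s0 e e0.
  (* A mesh below [dl] puts a grid point within the modulus of continuity of the path at s. *)
  have [m hm] : exists m : nat, h / dl < (2 ^ m)%:R.
    exists (Num.truncn (h / dl)).+1.
    apply: lt_trans (truncnS_gt _) _.
    by rewrite ltr_nat; apply: ltn_expl.
  have m0 : 0 < (2 ^ m)%:R :> R by rewrite ltr0n expn_gt0.
  pose x := (s - t) / h * (2 ^ m)%:R.
  have x0 : 0 <= x by rewrite mulr_ge0 ?divr_ge0//; lra.
  have xm : x <= (2 ^ m)%:R by rewrite ler_piMl ?(ltW m0)// ler_pdivrMr//; lra.
  have /andP[jx xj] := truncn_itv x0.
  pose j := Num.truncn x; rewrite -/j in jx xj.
  pose q := t + h * (j%:R / (2 ^ m)%:R).
  have sE : s = t + h * (x / (2 ^ m)%:R) by rewrite /x; field; rewrite !gt_eqF.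
  have sq : 0 <= s - q < dl.
    have -> : s - q = h * ((x - j%:R) / (2 ^ m)%:R) by rewrite {1}sE /q; ring.
    rewrite mulr_ge0 ?divr_ge0 ?subr_ge0 ?(ltW h0)//=.
    apply: le_lt_trans (_ : h * (1 / (2 ^ m)%:R) < _).
      apply: ler_wpM2l; first exact: ltW.
      by rewrite ler_pM2r ?invr_gt0// lerBlDr -natr1 addrC in xj *; exact: ltW.
    by rewrite mulrA mulr1 ltr_pdivrMr// mulrC -ltr_pdivrMr.
  have q0 : [set` `[0, +oo[] q.
    by rewrite /= in_itv/= andbT addr_ge0// mulr_ge0 ?divr_ge0// ltW.
  have jm : (j <= 2 ^ m)%N by rewrite -(ler_nat R); exact: le_trans xm.
  have : `|B s w - B q w| < e by apply: hd => //; case/andP: sq => ? ?; rewrite ger0_norm.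
  have : `|B q w - B t w| <= r.
    rewrite leNgt; apply/negP => rq; apply: nX; exists m => //; exists j; split => //.
    by rewrite /l mulrC divfK.
  have : `|B s w - B t w| <= `|B s w - B q w| + `|B q w - B t w|.
    have -> : B s w - B t w = (B s w - B q w) + (B q w - B t w) by ring.
    exact: ler_normD.
  by rewrite /e; lra.
Qed.
End maximal.

(** * Dynkin's formula *)

Section real_expectation.
Context d (T : measurableType d) (R : realType) (P : probability T R).
Implicit Types (f g : T -> R).

Lemma integrable_addR f g : P.-integrable setT (EFin \o f) ->
  P.-integrable setT (EFin \o g) -> P.-integrable setT (EFin \o (fun w => f w + g w)).
Proof. by move=> fi gi; exact: (integrableD measurableT fi gi). Qed.

Lemma integrable_scaleR (k : R) f : P.-integrable setT (EFin \o f) ->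
  P.-integrable setT (EFin \o (fun w => k * f w)).
Proof. by move=> fi; exact: (integrableZl measurableT k fi). Qed.

Lemma integrable_boundedR (K : R) f : measurable_fun setT f -> (forall w, `|f w| <= K) ->
  P.-integrable setT (EFin \o f).
Proof.
move=> mf fK; apply: (@le_integrable _ _ R P setT measurableT _ (fun=> K%:E)).
- exact/measurable_EFinP.
- by move=> w _; rewrite /= lee_fin; apply: le_trans (fK w) (ler_norm _).
- exact: finite_measure_integrable_cst.
Qed.

Lemma ae_le_Rintegral f g : P.-integrable setT (EFin \o f) ->
  P.-integrable setT (EFin \o g) -> {ae P, forall w, `|f w| <= g w} ->
  `|\int[P]_w f w| <= \int[P]_w g w.
Proof.
move=> fi gi fg.
apply: le_trans (le_normr_Rintegral measurableT fi) _.
have nfi : P.-integrable setT (EFin \o (fun w => `|f w|)) by exact: (integrable_abse fi).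
rewrite -lee_fin /Rintegral !fineK; last 2 first.
- exact: (integrable_fin_num measurableT gi).
- exact: (integrable_fin_num measurableT nfi).
have ngi : P.-integrable setT (EFin \o (fun w => `|g w|)) by exact: (integrable_abse gi).
have mng := measurable_int _ ngi; have mnf := measurable_int _ nfi.
have mg := measurable_int _ gi.
have -> : (\int[P]_w (g w)%:E = \int[P]_w (`|g w|%R)%:E)%E.
  apply: ae_eq_integral => //.
  by move: fg; apply: filterS => w h _ /=; rewrite ger0_norm//; exact: le_trans h.
apply: ae_ge0_le_integral => //.
by move: fg; apply: filterS => w h _; rewrite lee_fin; exact: le_trans h (ler_norm _).
Qed.
End real_expectation.

(** Meant for the exceptional event, with m = M h: the term m meets the small probability of that
    event, and x^4 / m has expectation O(h / M) for a Brownian increment x. It replaces the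
    Cauchy-Schwarz inequality. *)
Lemma sqr_le_pow4 (R : realType) (x m : R) : 0 < m -> x ^+ 2 <= m + x ^+ 4 / m.
Proof.
move=> m0; rewrite -lerBlDl ler_pdivlMr//.
have -> : x ^+ 4 = x ^+ 2 * x ^+ 2 by ring.
by have := sqr_ge0 (x ^+ 2 - m / 2); have := sqr_ge0 m; lra.
Qed.

Section dynkin.
Context d (T : measurableType d) (R : realType) (P : probability T R).
Variables (F : R -> set_system T) (B V : R -> T -> R).
Variables (kappa sigma b z0 : R).
Hypothesis bm : brownian_motion P F B.
Hypotheses (b_gt0 : 0 < b) (sigma0 : sigma != 0) (sigma2 : sigma ^+ 2 = kappa).
Hypothesis aV : forall t, 0 <= t -> adapted_at F t (V t).
Hypothesis HV : {ae P, forall w, bessel_path b z0 (fun t => sigma * B t w) (V ^~ w)}.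

Let kappa_gt0 : 0 < kappa.
Proof. by rewrite -sigma2 exprn_even_gt0. Qed.

Let mV t : 0 <= t -> measurable_fun setT (V t).
Proof. by move=> t0; exact: (adapted_at_measurable bm t0 (aV t0)). Qed.

Lemma good_event : exists2 c : R, 0 < c & forall e r t h : R,
  0 < e -> 0 < r -> 8 * r < e -> 0 <= t -> 0 < h ->
  4 * b * h <= r * e -> c * h ^+ 2 <= r ^+ 4 ->
  exists X : set T, [/\ measurable X,
    (P X <= (c * h ^+ 2 / r ^+ 4)%:E)%E &
    {ae P, forall w, ~ X w ->
      forall s, t <= s <= t + h -> `|sigma * B s w - sigma * B t w| <= r}].
Proof.
have ns : 0 < `|sigma| by rewrite normr_gt0.
have ns4 : `|sigma| ^+ 4 = kappa ^+ 2.
  by rewrite -sigma2 (exprM _ 2 2) real_normK ?num_real.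
have k20 : 0 < kappa ^+ 2 by exact: exprn_gt0.
have [c0 c00 H] := brownian_modulus bm.
exists (c0 * kappa ^+ 2); first exact: mulr_gt0.
move=> e r t h e0 r0 re t0 h0 bh hr.
pose r' := r / `|sigma|; have r'0 : 0 < r' by rewrite divr_gt0.
have r'4 : r' ^+ 4 = r ^+ 4 / kappa ^+ 2 by rewrite expr_div_n ns4.
have hr' : c0 * h ^+ 2 <= r' ^+ 4 by rewrite r'4 ler_pdivlMr// mulrAC.
have [X [mX PX hX]] := H t h r' t0 h0 r'0 hr'.
exists X; split => //.
  apply: le_trans PX _; rewrite lee_fin r'4 invfM invrK.
  by rewrite [leRHS](_ : _ = c0 * h ^+ 2 * ((r ^+ 4)^-1 * kappa ^+ 2))//; ring.
apply: filterS (bm_continuous bm) => w cw nX s sth.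
rewrite -mulrBr normrM mulrC -ler_pdivlMr//.
exact: hX.
Qed.

Section test.
Variables (e K : R) (f f1 f2 : R -> R).
Hypotheses (e_gt0 : 0 < e) (tf : test_function e K f f1 f2).
Hypotheses (mf : measurable_fun setT f) (mf1 : measurable_fun setT f1)
  (mf2 : measurable_fun setT f2).
Let L z := kappa / 2 * f2 z - b * (f1 z / z).
Hypothesis mL : measurable_fun setT L.

Let K0 : 0 <= K. Proof. by have [+ _ _] := test_bounded tf 0; apply: le_trans. Qed.

Let f1_div z : `|f1 z / z| <= K / e.
Proof.
have [ze|ez] := leP z e.
  by have [_ -> _] := test_near0 tf ze; rewrite mul0r normr0 divr_ge0// ltW.
have [_ f1K _] := test_bounded tf z.
have z0' : 0 < z by exact: lt_trans ez.
rewrite normrM normfV (gtr0_norm z0'); apply: ler_pM => //; first by rewrite invr_ge0 ltW.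
by rewrite lef_pV2 ?posrE// ltW.
Qed.

Let L_bound z : `|L z| <= kappa / 2 * K + b * (K / e).
Proof.
have [_ _ f2K] := test_bounded tf z.
apply: le_trans (ler_normB _ _) _; apply: lerD; rewrite normrM gtr0_norm ?divr_gt0//.
  by apply: ler_wpM2l => //; rewrite divr_ge0// ltW.
by apply: ler_wpM2l => //; exact: ltW.
Qed.

Let iU (g : R -> R) (c t : R) : measurable_fun setT g -> (forall z, `|g z| <= c) -> 0 <= t ->
  P.-integrable setT (EFin \o (fun w => g (V t w))).
Proof.
move=> mg gc t0; apply: (@integrable_boundedR _ _ _ _ c) => //.
exact: measurableT_comp (mV t0).
Qed.

(** A crude bound for the exceptional event, where the path is not controlled. *)
Lemma remainder_bound (z1 z2 x h : R) : 0 < h -> h < 1 ->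
  `|f z1 - f z2 - f1 z2 * (sigma * x) - f2 z2 * (sigma * x) ^+ 2 / 2
    + b * h / z2 * f1 z2| <= K * (3 + b / e) + 2 * K * kappa * x ^+ 2.
Proof.
move=> h0 h1; move: (b_gt0) (e_gt0) (kappa_gt0) (K0) => b0 e0 k0 K0'.
have [fK1 _ _] := test_bounded tf z1; have [fK2 f1K f2K] := test_bounded tf z2.
have kx : 0 <= kappa * x ^+ 2 by rewrite mulr_ge0 ?sqr_ge0// ltW.
have n1 : `|f1 z2 * (sigma * x)| <= K * (1 + kappa * x ^+ 2).
  rewrite normrM; apply: ler_pM => //.
  have -> : kappa * x ^+ 2 = `|sigma * x| ^+ 2 by rewrite real_normK ?num_real// exprMn sigma2.
  by have := sqr_ge0 (`|sigma * x| - 1 / 2); lra.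
have n2 : `|f2 z2 * (sigma * x) ^+ 2 / 2| <= K * (kappa * x ^+ 2).
  rewrite exprMn sigma2 -mulrA normrM; apply: ler_pM => //.
  by rewrite ger0_norm ?divr_ge0//; lra.
have n3 : `|b * h / z2 * f1 z2| <= K * (b / e).
  have -> : b * h / z2 * f1 z2 = b * (h * (f1 z2 / z2)) by ring.
  rewrite [leRHS](_ : _ = b * (K / e)); last by ring.
  rewrite normrM (gtr0_norm b0) ler_pM2l// normrM (gtr0_norm h0).
  apply: le_trans (ler_wpM2l (ltW h0) (f1_div z2)) _.
  by apply: ler_piMl; [apply: divr_ge0 => //; exact: ltW|exact: ltW].
apply: le_trans (ler_normD _ _) _.
apply: le_trans (lerD (ler_normB _ _) (lexx _)) _.
apply: le_trans (lerD (lerD (ler_normB _ _) (lexx _)) (lexx _)) _.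
apply: le_trans (lerD (lerD (lerD (ler_normB _ _) (lexx _)) (lexx _)) (lexx _)) _.
apply: le_trans (lerD (lerD (lerD (lerD fK1 fK2) n1) n2) n3) _.
rewrite [leLHS](_ : _ = K * (3 + b / e) + 2 * K * kappa * x ^+ 2)//; ring.
Qed.

(** Subtracting f1(V_t) sigma D and f2(V_t) kappa (D^2 - h) / 2, which have mean zero by
    independence, turns the difference into the remainder of [taylor_step]. Off the exceptional
    event it is at most C r (h + kappa D^2), and on it the crude bound applies. The parameters r, M
    and h0 are fixed in this order, and each brings one contribution below eta h / 4. *)
Lemma dynkin_step (eta : R) : 0 < eta -> exists2 h0, 0 < h0 &
  forall t h, 0 <= t -> 0 < h < h0 ->
  `|\int[P]_w f (V (t + h) w) - \int[P]_w f (V t w) - h * \int[P]_w L (V t w)| <= eta * h.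
Proof.
move=> eta0; move: (b_gt0) (e_gt0) (kappa_gt0) (K0) => b0 e0 k0 K0'.
have [c40 c4_gt0 inc4] : exists2 c : R, 0 < c & forall s t : R, 0 <= s < t ->
    (\int[P]_w ((B t w - B s w) ^+ 4)%:E <= (c * (t - s) ^+ 2)%:E)%E.
  by exists 128 => // s t st; exact: (increment_pow4 bm st).
have [cm cm_gt0 good0] := good_event.
pose C := K * (4 + 24 * b / e + 16 * b / e ^+ 2).
have C0 : 0 <= C.
  by rewrite /C mulr_ge0// !addr_ge0// !mulr_ge0 ?invr_ge0 ?sqr_ge0 ?(ltW b0) ?(ltW e0).
pose r := Num.min 1 (Num.min (e / 16) (eta / (4 * (C * (1 + kappa) + 1)))).
have Ck : 0 <= C * (1 + kappa) by rewrite mulr_ge0//; lra.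
have r0 : 0 < r by rewrite !lt_min ltr01 divr_gt0//= divr_gt0// mulr_gt0//; lra.
have r1 : r <= 1 by rewrite ge_min lexx.
have re : 8 * r < e.
  have : r <= e / 16 by rewrite !ge_min lexx orbT.
  by lra.
have rC : C * r * (1 + kappa) <= eta / 4.
  have : r <= eta / (4 * (C * (1 + kappa) + 1)) by rewrite !ge_min lexx !orbT.
  rewrite ler_pdivlMr; last by lra.
  have := mulr_ge0 Ck (ltW r0); nra.
pose c1 := K * (3 + b / e).
have be0 : 0 < b / e by rewrite divr_gt0.
have c10 : 0 <= c1 by rewrite mulr_ge0//; lra.
pose c2 := 2 * K * kappa.
have c20 : 0 <= c2 by rewrite !mulr_ge0// ltW.
(* [M] makes the fourth moment part of the crude bound small. It precedes [h0], since the weight [Q]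
   of the exceptional event depends on it. *)
pose M := 4 * c40 * c2 / eta + 1.
have M0 : 0 < M.
  by rewrite /M; have : 0 <= 4 * c40 * c2 / eta by [apply: divr_ge0; [apply: mulr_ge0 => //; lra|exact: ltW]]; lra.
have MC : c40 * c2 / M <= eta / 4.
  rewrite ler_pdivrMr//; have : M * eta = 4 * (c40 * c2) + eta by rewrite /M; field; rewrite gt_eqF.
  by lra.
pose Q := cm / r ^+ 4 * (c1 + c2 * M).
have r40 : 0 < r ^+ 4 by exact: exprn_gt0.
have Q0 : 0 <= Q.
  apply: mulr_ge0; first by rewrite divr_ge0// ltW.
  by rewrite addr_ge0// mulr_ge0// ltW.
pose h0 := Num.min 1 (Num.min (r * e / (4 * b)) (Num.min (r ^+ 4 / cm) (eta / (4 * (Q + 1))))).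
have Q10 : 0 < 4 * (Q + 1) by lra.
have h00 : 0 < h0.
  rewrite !lt_min ltr01 /=; apply/and3P; split; apply: divr_gt0 => //.
    exact: mulr_gt0.
  by apply: mulr_gt0 => //; rewrite ltr0n.
exists h0 => // t h t0 /andP[hgt0]; rewrite !lt_min => /andP[h1 /andP[h2 /andP[h3 h4]]].
have bh : 4 * b * h <= r * e.
  by move: h2; rewrite ltr_pdivlMr ?mulr_gt0 ?ltr0n// => /ltW; rewrite mulrC.
have hr : cm * h ^+ 2 <= r ^+ 4.
  have : cm * h <= r ^+ 4 by move: h3; rewrite ltr_pdivlMr//; lra.
  apply: le_trans; apply: ler_wpM2l; first exact: ltW.
  by rewrite expr2 ler_piMr// ltW.
have hQ : Q * h <= eta / 4.
  by move: h4; rewrite ltr_pdivlMr//; have := mulr_ge0 Q0 (ltW hgt0); nra.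
have [X [mX PX good]] := good0 e r t h e0 r0 re t0 hgt0 bh hr.
have th0 : 0 <= t + h by lra.
have st : 0 <= t < t + h by lra.
have thE : t + h - t = h by ring.
pose D w := B (t + h) w - B t w.
have fK z : `|f z| <= K by have [] := test_bounded tf z.
have f1K z : `|f1 z| <= K by have [] := test_bounded tf z.
have f2K z : `|f2 z| <= K by have [] := test_bounded tf z.
have i1 := iU mf fK th0; have i2 := iU mf fK t0; have i3 := iU mL L_bound t0.
have [im1 em1] := increment_mean bm st (adapted_at_comp mf1 (aV t0)) (fun w => f1K (V t w)).
have [im2 em2] := increment_sqr_mean bm st (adapted_at_comp mf2 (aV t0)) (fun w => f2K (V t w)).
rewrite -/D thE in im1 em1 im2 em2.
pose m1 w := f1 (V t w) * D w; pose m2 w := f2 (V t w) * (D w ^+ 2 - h).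
pose G w := f (V (t + h) w) + - 1 * f (V t w) + - h * L (V t w).
pose Del w := G w + - sigma * m1 w + - (kappa / 2) * m2 w.
have iG : P.-integrable setT (EFin \o G).
  apply: integrable_addR; last exact: integrable_scaleR.
  by apply: integrable_addR => //; exact: integrable_scaleR.
have iD1 : P.-integrable setT (EFin \o (fun w => G w + - sigma * m1 w)).
  by apply: integrable_addR => //; exact: integrable_scaleR.
have iDel : P.-integrable setT (EFin \o Del).
  by apply: integrable_addR => //; exact: integrable_scaleR.
have EG : \int[P]_w G w = \int[P]_w f (V (t + h) w) - \int[P]_w f (V t w) - h * \int[P]_w L (V t w).
  rewrite /G RintegralD//; [|apply: integrable_addR => //; exact: integrable_scaleR|exact: integrable_scaleR].
  rewrite RintegralD//; last exact: integrable_scaleR.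
  by rewrite !RintegralZl// mulN1r mulNr.
have EDel : \int[P]_w Del w = \int[P]_w G w.
  rewrite /Del RintegralD//; last exact: integrable_scaleR.
  rewrite RintegralD//; last exact: integrable_scaleR.
  rewrite !RintegralZl// {2 3}/Rintegral em1 em2 /=.
  by rewrite !mulr0 !addr0.
rewrite -EG -EDel.
have iD2 := increment_pow_integrable bm st (isT : (2 <= 4)%N).
have iD4 := increment_pow_integrable bm st (isT : (4 <= 4)%N).
rewrite -/D in iD2 iD4.
(* The first bracket dominates on the good event and the second on the exceptional one; both are
   nonnegative, so the sum dominates in either case. *)
pose Bd w := (C * r * h + C * r * kappa * D w ^+ 2) +
  ((c1 + c2 * (M * h)) * \1_X w + c2 / (M * h) * D w ^+ 4).
have iX : P.-integrable setT (EFin \o (\1_X : T -> R)) by exact: integrable_indic.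
have ic : P.-integrable setT (EFin \o (fun w : T => C * r * h)).
  exact: finite_measure_integrable_cst.
have iB1 : P.-integrable setT (EFin \o (fun w : T => C * r * h + C * r * kappa * D w ^+ 2)).
  by apply: integrable_addR => //; exact: integrable_scaleR.
have iB2 : P.-integrable setT (EFin \o (fun w : T => (c1 + c2 * (M * h)) * \1_X w + c2 / (M * h) * D w ^+ 4)).
  by apply: integrable_addR; exact: integrable_scaleR.
have iBd : P.-integrable setT (EFin \o Bd) by exact: integrable_addR.
have Mh0 : 0 < M * h by exact: mulr_gt0.
apply: le_trans (ae_le_Rintegral iDel iBd _) _.
  near=> w.
  have gw : ~ X w -> forall s, t <= s <= t + h -> `|sigma * B s w - sigma * B t w| <= r.
    by near: w.
  have bw : bessel_path b z0 (fun t => sigma * B t w) (V ^~ w) by near: w.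
  have DelE : Del w = f (V (t + h) w) - f (V t w) - f1 (V t w) * (sigma * B (t + h) w - sigma * B t w)
    - f2 (V t w) * (sigma * B (t + h) w - sigma * B t w) ^+ 2 / 2 + b * h / V t w * f1 (V t w).
    by rewrite /Del /G /m1 /m2 /L /D -sigma2; ring.
  have D20 := sqr_ge0 (D w).
  have D40 : 0 <= D w ^+ 4 by rewrite (exprM _ 2 2) sqr_ge0.
  have sD : (sigma * B (t + h) w - sigma * B t w) = sigma * D w by rewrite /D; ring.
  have Cr0 : 0 <= C * r := mulr_ge0 C0 (ltW r0).
  have last0 : 0 <= c2 / (M * h) * D w ^+ 4.
    by apply: mulr_ge0 => //; apply: divr_ge0 => //; exact: ltW.
  rewrite /Bd indicE; case: (boolP (w \in X)) => Xw; last first.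
    have nX : ~ X w by move=> /mem_set; rewrite (negbTE Xw).
    rewrite DelE; apply: le_trans (taylor_step b0 e0 r0 re t0 (ltW hgt0) bh bw (gw nX) r1 tf) _.
    rewrite sD exprMn sigma2 -/C mulr0 add0r.
    rewrite [leLHS](_ : _ = C * r * h + C * r * kappa * D w ^+ 2); last by ring.
    by rewrite lerDl.
  rewrite mulr1 DelE sD; apply: le_trans (remainder_bound _ _ _ hgt0 h1) _.
  rewrite -/c1 -/c2; apply: le_trans (_ : c1 + (c2 * (M * h) + c2 / (M * h) * D w ^+ 4) <= _).
    rewrite lerD2l -mulrA -mulrDr; apply: ler_wpM2l => //.
    by rewrite [(M * h)^-1 * _]mulrC; exact: sqr_le_pow4.
  rewrite addrA lerDr addr_ge0//; first by apply: mulr_ge0 => //; exact: ltW.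
  by apply: mulr_ge0 => //; apply: mulr_ge0 => //; exact: ltW.
rewrite /Bd RintegralD// RintegralD//; last exact: integrable_scaleR.
rewrite RintegralD//; [|exact: integrable_scaleR|exact: integrable_scaleR].
rewrite Rintegral_cst//= probability_setT /= mulr1 !RintegralZl//.
have -> : \int[P]_w (D w ^+ 2) = h.
  by rewrite /Rintegral (increment_variance bm st) thE.
have d4 : \int[P]_w (D w ^+ 4) <= c40 * h ^+ 2.
  rewrite -lee_fin /Rintegral fineK; last exact: (integrable_fin_num measurableT iD4).
  by apply: le_trans (inc4 _ _ st) _; rewrite thE.
have px : \int[P]_w (\1_X w : R) <= cm * h ^+ 2 / r ^+ 4.
  rewrite -lee_fin /Rintegral fineK; last exact: (integrable_fin_num measurableT iX).
  by rewrite integral_indic// setIT.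
have t1 : (c1 + c2 * (M * h)) * \int[P]_w (\1_X w : R) <= Q * h ^+ 2.
  apply: le_trans (_ : (c1 + c2 * M) * (cm * h ^+ 2 / r ^+ 4) <= _); last first.
    by rewrite /Q; lra.
  apply: ler_pM => //.
  - by rewrite addr_ge0// mulr_ge0// ltW.
  - by apply: Rintegral_ge0 => w _; rewrite indicE.
  - by rewrite lerD2l; apply: ler_wpM2l => //; rewrite ler_piMr// ltW.
have t2 : c2 / (M * h) * \int[P]_w (D w ^+ 4) <= c40 * c2 / M * h.
  apply: le_trans (_ : c2 / (M * h) * (c40 * h ^+ 2) <= _).
    by apply: ler_wpM2l => //; rewrite divr_ge0// ltW.
  by rewrite [leLHS](_ : _ = c40 * c2 / M * h)//; field; rewrite !gt_eqF.
have hh : Q * h ^+ 2 <= eta / 4 * h by rewrite expr2 mulrA ler_pM2r.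
have hM : c40 * c2 / M * h <= eta / 4 * h by rewrite ler_pM2r.
have hC : C * r * (1 + kappa) * h <= eta / 4 * h by rewrite ler_pM2r.
have : C * r * h + C * r * kappa * h = C * r * (1 + kappa) * h by ring.
have := mulr_gt0 eta0 hgt0.
by lra.
Unshelve. all: by end_near. Qed.
End test.
End dynkin.

(** * From estimates over small steps to an integral identity *)

Section uniform_ftc.
Variable R : realType.
Notation mu := (@lebesgue_measure R).

(** Increments are taken forward in time, as in the step estimates; uniformity in the starting time
    yields continuity from the left as well. *)
Definition uniform_modulus (u : R -> R) := forall eta, 0 < eta ->
  exists2 h0, 0 < h0 & forall t h, 0 <= t -> 0 < h < h0 -> `|u (t + h) - u t| <= eta.

Lemma uniform_modulus_continuous (u : R -> R) : uniform_modulus u ->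
  {within `[0, +oo[, continuous u}.
Proof.
move=> mu_u; apply/within_continuousP => x; rewrite /= in_itv/= andbT => x0 e e0.
have [h0 h00 hu] := mu_u (e / 2) ltac:(lra).
exists h0 => // y; rewrite in_itv/= andbT => y0 xy.
have [xley|yltx|->] := ltgtP x y; last by rewrite subrr normr0.
- have hxy : 0 < y - x < h0 by move: xy; rewrite ltr0_norm; lra.
  have := hu x (y - x) x0 hxy; rewrite distrC (_ : x + (y - x) = y) => [h|]; [lra|ring].
- have hxy : 0 < x - y < h0 by move: xy; rewrite gtr0_norm; lra.
  have := hu y (x - y) y0 hxy; rewrite (_ : y + (x - y) = x) => [h|]; [lra|ring].
Qed.

(** For a left difference quotient at x the forward estimate is applied at the earlier time, and the
    modulus of psi brings its value back to x. So psi is the two-sided derivative of g, and the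
    fundamental theorem of calculus applies. *)
Lemma uniform_ftc (g psi : R -> R) : uniform_modulus g -> uniform_modulus psi ->
  (forall eta, 0 < eta -> exists2 h0, 0 < h0 & forall t h, 0 <= t -> 0 < h < h0 ->
     `|g (t + h) - g t - h * psi t| <= eta * h) ->
  forall t, 0 <= t -> g t - g 0 = \int[mu]_(s in `[0, t]) psi s.
Proof.
move=> mg mpsi step t; rewrite le_eqVlt => /orP[/eqP <-|t0].
  by rewrite subrr set_itv1 Rintegral_set1.
have sub (a c : R) : 0 <= a -> [set` `[a, c]] `<=` [set` `[0, +oo[].
  by move=> a0 x /=; rewrite !in_itv/= andbT => /andP[ax _]; exact: le_trans ax.
have cg := uniform_modulus_continuous mg.
have cpsi := uniform_modulus_continuous mpsi.
have dg (x : R) : 0 < x -> is_derive x 1 g (psi x).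
  move=> x0.
  have : (fun h : R => h^-1 *: (g (h *: 1 + x) - g x)) @ 0^' --> psi x.
    apply/cvgrPdist_le => e e0.
    have [h1 h10 H1] := step (e / 2) ltac:(lra).
    have [h2 h20 H2] := mpsi (e / 2) ltac:(lra).
    exists (Num.min (Num.min h1 h2) x); first by rewrite /= !lt_min h10 h20.
    move=> h /=; rewrite sub0r normrN !lt_min => /andP[/andP[hh1 hh2] hx] hn0.
    change (`|psi x - h^-1 * (g (h * 1 + x) - g x)| <= e); rewrite mulr1.
    have [hlt|hgt|he] := ltgtP h 0; last by rewrite he eqxx in hn0.
    + rewrite ltr0_norm// in hh1 hh2 hx.
      have y0 : 0 <= x + h by lra.
      have k1 : 0 < - h < h1 by lra.
      have k2 : 0 < - h < h2 by lra.
      have := H1 _ _ y0 k1; have := H2 _ _ y0 k2; rewrite addrK => q2 q1.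
      have -> : psi x - h^-1 * (g (h + x) - g x) =
        (psi x - psi (x + h)) - (- h)^-1 * (g x - g (x + h) - - h * psi (x + h)).
        by rewrite [h + x]addrC; field; rewrite lt_eqF.
      apply: le_trans (ler_normB _ _) _; rewrite normrM normfV.
      have h0' : 0 < `|- h| by rewrite normr_gt0 oppr_eq0.
      have : `|- h|^-1 * `|g x - g (x + h) - - h * psi (x + h)| <= e / 2.
        rewrite mulrC ler_pdivrMr// (gtr0_norm (_ : 0 < - h))//; lra.
      by lra.
    + rewrite gtr0_norm// in hh1 hh2 hx.
      have k1 : 0 < h < h1 by lra.
      have := H1 _ _ (ltW x0) k1 => q1.
      have -> : psi x - h^-1 * (g (h + x) - g x) = - (h^-1 * (g (x + h) - g x - h * psi x)).
        by rewrite [h + x]addrC; field; rewrite gt_eqF.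
      rewrite normrN normrM normfV (gtr0_norm hgt) mulrC ler_pdivrMr//.
      by nra.
  move=> dgx; split; first by apply/cvg_ex; exists (psi x).
  exact/cvg_lim.
rewrite /Rintegral (@continuous_FTC2 _ psi g) //.
- exact: continuous_subspaceW (sub 0 t (lexx _)) cpsi.
- have := continuous_subspaceW (sub 0 t (lexx _)) cg.
  move=> /(continuous_within_itvP _ t0)[_ c1 c2]; split => //.
  by move=> x; rewrite in_itv/= => /andP[x0 _]; have [] := dg x x0.
- by move=> x; rewrite in_itv/= => /andP[x0 _]; rewrite derive1E; have [_ ->] := dg x x0.
Qed.
End uniform_ftc.

Section dynkin_formula.
Context d (T : measurableType d) (R : realType) (P : probability T R).
Notation mu := (@lebesgue_measure R).
Variables (F : R -> set_system T) (B V : R -> T -> R).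
Variables (kappa sigma b z0 : R).
Hypothesis bm : brownian_motion P F B.
Hypotheses (b_gt0 : 0 < b) (sigma0 : sigma != 0) (sigma2 : sigma ^+ 2 = kappa).
Hypothesis aV : forall t, 0 <= t -> adapted_at F t (V t).
Hypothesis HV : {ae P, forall w, bessel_path b z0 (fun t => sigma * B t w) (V ^~ w)}.

Let kappa_gt0 : 0 < kappa.
Proof. by rewrite -sigma2 exprn_even_gt0. Qed.

Let mV t : 0 <= t -> measurable_fun setT (V t).
Proof. by move=> t0; exact: (adapted_at_measurable bm t0 (aV t0)). Qed.

(** Off the exceptional event phi(V) moves by at most 2 K r, on it by at most 2 K', and for fixed r
    the probability of that event is O(h^2). *)
Lemma lipschitz_modulus (e K K' : R) (phi : R -> R) : 0 < e ->
  (forall z, z <= e -> phi z = 0) ->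
  (forall z w, 0 < z -> 0 < w -> `|phi w - phi z| <= K * `|w - z|) ->
  (forall z, `|phi z| <= K') -> measurable_fun setT phi ->
  uniform_modulus (fun t => \int[P]_w phi (V t w)).
Proof.
move=> e0 phi0 phiK phiK' mphi eta eta0; move: (b_gt0) (kappa_gt0) => b0 k0.
have K0 : 0 <= K.
  have := phiK 1 2 ltr01 ltac:(lra); rewrite (_ : 2 - 1 = 1 :> R); last by lra.
  by rewrite normr1 mulr1; apply: le_trans.
have K'0 : 0 <= K' by apply: le_trans (phiK' 0).
have [cm cm_gt0 good0] := good_event b bm sigma0 sigma2.
pose r := Num.min (e / 16) (eta / (4 * (K + 1))).
have K10 : 0 < 4 * (K + 1) by lra.
have r0 : 0 < r by rewrite !lt_min !divr_gt0.
have re : 8 * r < e by have : r <= e / 16 by [rewrite ge_min lexx]; lra.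
have rK : 2 * K * r <= eta / 2.
  have : r <= eta / (4 * (K + 1)) by rewrite ge_min lexx orbT.
  by rewrite ler_pdivlMr//; lra.
have r40 : 0 < r ^+ 4 by exact: exprn_gt0.
pose Q := 2 * K' * (cm / r ^+ 4).
have Q0 : 0 <= Q by apply: mulr_ge0; [exact: mulr_ge0|apply: divr_ge0; exact: ltW].
have Q10 : 0 < 2 * (Q + 1) by lra.
pose h0 := Num.min 1 (Num.min (r * e / (4 * b)) (Num.min (r ^+ 4 / cm) (eta / (2 * (Q + 1))))).
have h00 : 0 < h0.
  rewrite !lt_min ltr01 /=; apply/and3P; split; apply: divr_gt0 => //.
    exact: mulr_gt0.
  by apply: mulr_gt0 => //; rewrite ltr0n.
exists h0 => // t h t0 /andP[hgt0]; rewrite !lt_min => /andP[h1 /andP[h2 /andP[h3 h4]]].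
have bh : 4 * b * h <= r * e.
  by move: h2; rewrite ltr_pdivlMr ?mulr_gt0 ?ltr0n// => /ltW; rewrite mulrC.
have hr : cm * h ^+ 2 <= r ^+ 4.
  have : cm * h <= r ^+ 4 by move: h3; rewrite ltr_pdivlMr//; lra.
  apply: le_trans; apply: ler_wpM2l; first exact: ltW.
  by rewrite expr2 ler_piMr// ltW.
have [X [mX PX good]] := good0 e r t h e0 r0 re t0 hgt0 bh hr.
have th0 : 0 <= t + h by lra.
have iU s : 0 <= s -> P.-integrable setT (EFin \o (fun w => phi (V s w))).
  move=> s0; apply: (@integrable_boundedR _ _ _ _ K') => //.
  exact: measurableT_comp (mV s0).
have i1 := iU _ th0; have i2 := iU _ t0.
rewrite -RintegralB//.
have iX : P.-integrable setT (EFin \o (\1_X : T -> R)) by exact: integrable_indic.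
pose Bd w := 2 * K * r + 2 * K' * \1_X w.
have ic : P.-integrable setT (EFin \o (fun w : T => 2 * K * r)).
  exact: finite_measure_integrable_cst.
have iX2 := integrable_scaleR (2 * K') iX.
have iBd : P.-integrable setT (EFin \o Bd) by exact: integrable_addR.
have iDel : P.-integrable setT (EFin \o (fun w => phi (V (t + h) w) - phi (V t w))).
  exact: (integrableB measurableT i1 i2).
apply: le_trans (ae_le_Rintegral iDel iBd _) _.
  near=> w.
  have gw : ~ X w -> forall s, t <= s <= t + h -> `|sigma * B s w - sigma * B t w| <= r.
    by near: w.
  have bw : bessel_path b z0 (fun t => sigma * B t w) (V ^~ w) by near: w.
  rewrite /Bd indicE; case: (boolP (w \in X)) => Xw; last first.
    have nX : ~ X w by move=> /mem_set; rewrite (negbTE Xw).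
    rewrite mulr0 addr0; exact: (lipschitz_step b0 e0 r0 re t0 (ltW hgt0) bh bw (gw nX) phi0 phiK).
  apply: le_trans (ler_normB _ _) _; apply: le_trans (lerD (phiK' _) (phiK' _)) _.
  rewrite mulr1 (_ : K' + K' = 2 * K'); last by ring.
  by rewrite lerDr; apply: mulr_ge0; [exact: mulr_ge0|exact: ltW].
rewrite /Bd RintegralD// Rintegral_cst//= probability_setT /= mulr1 RintegralZl//.
have px : \int[P]_w (\1_X w : R) <= cm * h ^+ 2 / r ^+ 4.
  rewrite -lee_fin /Rintegral fineK; last exact: (integrable_fin_num measurableT iX).
  by rewrite integral_indic// setIT.
have t1 : 2 * K' * \int[P]_w (\1_X w : R) <= Q * h ^+ 2.
  apply: le_trans (_ : 2 * K' * (cm * h ^+ 2 / r ^+ 4) <= _).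
    by apply: ler_wpM2l => //; rewrite mulr_ge0.
  by rewrite /Q; lra.
have hQ : Q * h ^+ 2 <= eta / 2.
  have : Q * h <= eta / 2 by move: h4; rewrite ltr_pdivlMr//; have := mulr_ge0 Q0 (ltW hgt0); nra.
  by have := mulr_ge0 Q0 (ltW hgt0); nra.
by lra.
Unshelve. all: by end_near. Qed.

Lemma V_start : {ae P, forall w, V 0 w = z0}.
Proof. by apply: filterS HV => w; exact: bessel_start. Qed.

Lemma dynkin_formula (e K K1 K2 : R) (f f1 f2 : R -> R) :
  let L z := kappa / 2 * f2 z - b * (f1 z / z) in
  0 < e -> test_function e K f f1 f2 ->
  measurable_fun setT f -> measurable_fun setT f1 -> measurable_fun setT f2 ->
  measurable_fun setT L ->
  (forall z w, 0 < z -> 0 < w -> `|f w - f z| <= K1 * `|w - z|) ->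
  (forall z w, 0 < z -> 0 < w -> `|L w - L z| <= K2 * `|w - z|) ->
  forall t, 0 <= t -> {within `[0, +oo[, continuous (fun s => \int[P]_w L (V s w))} /\
    \int[P]_w f (V t w) = f z0 + \int[mu]_(s in `[0, t]) \int[P]_w L (V s w).
Proof.
move=> L e0 tf mf mf1 mf2 mL lf lL t t0.
have fK z : `|f z| <= K by have [] := test_bounded tf z.
have LK z : `|L z| <= kappa / 2 * K + b * (K / e).
  have [_ f1K f2K] := test_bounded tf z.
  move: (b_gt0) (kappa_gt0) => b0 k0.
  apply: le_trans (ler_normB _ _) _; apply: lerD; rewrite normrM gtr0_norm ?divr_gt0//.
    by apply: ler_wpM2l => //; rewrite divr_ge0// ltW.
  apply: ler_wpM2l; first exact: ltW.
  have K0 : 0 <= K by exact: le_trans f1K.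
  have [ze|ez] := leP z e.
    by have [_ -> _] := test_near0 tf ze; rewrite mul0r normr0 divr_ge0// ltW.
  have z0' : 0 < z by exact: lt_trans ez.
  rewrite normrM normfV (gtr0_norm z0'); apply: ler_pM => //; first by rewrite invr_ge0 ltW.
  by rewrite lef_pV2 ?posrE// ltW.
have near0f z : z <= e -> f z = 0 by move=> /(test_near0 tf)[].
have near0L z : z <= e -> L z = 0.
  by move=> /(test_near0 tf)[_ f10 f20]; rewrite /L f10 f20 !(mul0r, mulr0) subrr.
have modg := lipschitz_modulus e0 near0f lf fK mf.
have modL := lipschitz_modulus e0 near0L lL LK mL.
split; first exact: uniform_modulus_continuous.
have st : forall eta, 0 < eta -> exists2 h0, 0 < h0 & forall t h, 0 <= t -> 0 < h < h0 ->
  `|\int[P]_w f (V (t + h) w) - \int[P]_w f (V t w) - h * \int[P]_w L (V t w)| <= eta * h.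
  exact: (dynkin_step bm b_gt0 sigma0 sigma2 aV HV e0 tf mf mf1 mf2 mL).
rewrite -(uniform_ftc modg modL st t0).
have -> : \int[P]_w f (V 0 w) = f z0; last by rewrite addrC subrK.
rewrite /Rintegral (@ae_eq_integral _ _ _ P setT (fun=> (f z0)%:E))//.
- by rewrite integral_cst//= probability_setT mule1.
- by apply/measurable_EFinP; exact: measurableT_comp (mV (lexx 0)).
- by move: V_start; apply: filterS => w -> _.
Qed.
End dynkin_formula.

(** * Moments of the absorbed process *)

Section power_pos.
Variable R : realType.

Lemma measurable_power_pos (a : R) : measurable_fun setT (power_pos a).
Proof.
apply: (@measurable_fun_ifT _ _ R R (fun z => z `^ a) (fun=> 0) (fun z => 0 < z)) => //.
exact: measurable_fun_ltr.
Qed.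

Lemma power_pos_ge0 (a z : R) : 0 <= power_pos a z.
Proof. by rewrite /power_pos; case: ifP => // _; exact: powR_ge0. Qed.

Lemma power_pos0_le1 (z : R) : power_pos 0 z <= 1.
Proof. by rewrite /power_pos powRr0; case: ifP. Qed.

Lemma power_pos_mono (a c z : R) : 0 <= a <= c -> power_pos a z <= 1 + power_pos c z.
Proof.
move=> /andP[a0 ac]; rewrite /power_pos; case: ifPn => z0; last by rewrite addr0.
have [z1|z1] := leP z 1.
  apply: le_trans (_ : 1 <= _); last by rewrite lerDl powR_ge0.
  by rewrite -(powRr0 z); apply: ger_powR => //; rewrite z0.
apply: le_trans (_ : z `^ c <= _); last by rewrite lerDr.
by apply: ler_powR => //; exact: ltW.
Qed.

Lemma lipschitz_near0_measurable (e K : R) (phi : R -> R) : 0 < e ->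
  (forall z, z <= e -> phi z = 0) ->
  (forall z w, 0 < z -> 0 < w -> `|phi w - phi z| <= K * `|w - z|) ->
  measurable_fun setT phi.
Proof.
move=> e0 phi0 phiK; apply: continuous_measurable_fun => x.
have K0 : 0 <= K.
  have := phiK 1 2 ltr01 ltac:(lra); rewrite (_ : 2 - 1 = 1 :> R); last by lra.
  by rewrite normr1 mulr1; apply: le_trans.
apply/cvgrPdist_lt => c c0.
have K1 : 0 < K + 1 by lra.
have [xe|xe] := ltP x e.
  near=> y; rewrite !phi0 ?subrr ?normr0//; last exact: ltW.
  by apply/ltW; near: y; exact: lt_nbhsl.
have x0 : 0 < x by exact: lt_le_trans xe.
near=> y.
have y0 : 0 < y by near: y; exact: lt_nbhsr.
rewrite distrC; apply: le_lt_trans (phiK _ _ x0 y0) _.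
have : `|x - y| < c / (K + 1).
  by near: y; exists (c / (K + 1)); [exact: divr_gt0|].
rewrite ltr_pdivlMr// distrC; have := normr_ge0 (y - x).
by nra.
Unshelve. all: by end_near. Qed.

Lemma limn_einf_le (u : nat -> \bar R) (c : \bar R) : (forall n, u n <= c)%E ->
  (limn_einf u <= c)%E.
Proof.
move=> uc; rewrite limn_einf_lim; apply: lime_le; first exact: is_cvg_einfs.
apply: nearW => n; apply: le_trans (uc n); apply: ereal_inf_lbound.
by exists n => /=.
Qed.
End power_pos.

Section moments.
Context d (T : measurableType d) (R : realType) (P : probability T R).
Notation mu := (@lebesgue_measure R).
Variables (F : R -> set_system T) (B V : R -> T -> R).
Variables (kappa sigma b z0 : R).
Hypothesis bm : brownian_motion P F B.
Hypotheses (b_gt0 : 0 < b) (sigma0 : sigma != 0) (sigma2 : sigma ^+ 2 = kappa).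
Hypothesis aV : forall t, 0 <= t -> adapted_at F t (V t).
Hypothesis HV : {ae P, forall w, bessel_path b z0 (fun t => sigma * B t w) (V ^~ w)}.
Hypothesis z0_gt0 : 0 < z0.

Let mV t : 0 <= t -> measurable_fun setT (V t).
Proof. by move=> t0; exact: (adapted_at_measurable bm t0 (aV t0)). Qed.

(** The shift by 2 keeps the parameter strictly below 1, even at n = 0. *)
Let ep (n : nat) : R := n.+2%:R^-1.
Let ep0 n : 0 < ep n. Proof. by rewrite invr_gt0 ltr0n. Qed.
Let ep1 n : ep n < 1. Proof. by rewrite invf_lt1 ?ltr0n// ltr1n. Qed.

Definition moment (a t : R) : R := \int[P]_w power_pos a (V t w).

Let mP a t : 0 <= t -> measurable_fun setT (fun w => power_pos a (V t w)).
Proof. by move=> t0; apply: measurableT_comp (mV t0); exact: measurable_power_pos. Qed.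

Lemma moment_ge0 a t : 0 <= moment a t.
Proof. by apply: Rintegral_ge0 => w _; exact: power_pos_ge0. Qed.

Let fn a n := power_cut (ep n) a.
Let Ln a n := power_cut_gen (ep n) kappa b a.

Let fn_le a n z : 0 <= fn a n z <= power_pos a z.
Proof. exact: bump_le. Qed.

Lemma power_cut_genE eps a z : 0 < eps ->
  power_cut_gen eps kappa b a z =
  kappa / 2 * power_cut2 eps a z - b * (power_cut1 eps a z / z).
Proof.
move=> e0; rewrite /power_cut_gen; congr (_ - b * _).
have [z0'|z0'] := ltP 0 z; first by rewrite power_cut1E.
by rewrite /power_cut1 /power_cut1_div !bump_near0 ?mulr0 ?addr0 ?subrr ?mul0r//; lra.
Qed.

Lemma dynkin_power a n t : 0 <= t ->
  [/\ {within `[0, +oo[, continuous (fun s => \int[P]_w Ln a n (V s w))},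
   measurable_fun setT (fn a n), measurable_fun setT (Ln a n) &
  \int[P]_w fn a n (V t w) = fn a n z0 + \int[mu]_(s in `[0, t]) \int[P]_w Ln a n (V s w)].
Proof.
move=> t0.
have [K tf] := power_cut_test (ep0 n) (ep1 n) a.
have [K1 l1] : lipschitz_on_pos (fn a n) by exact: lipschitz_bump.
have [K2 l2] : lipschitz_on_pos (Ln a n) by exact: power_cut_gen_lip.
have [K3 l3] : lipschitz_on_pos (power_cut1 (ep n) a).
  rewrite /power_cut1; under eq_fun do rewrite -mulNr.
  by do ?apply: lipschitz_on_posD; apply: lipschitz_on_posZ; exact: lipschitz_bump.
have [K4 l4] : lipschitz_on_pos (power_cut2 (ep n) a).
  rewrite /power_cut2; under eq_fun do rewrite -!mulNr.
  do ?apply: lipschitz_on_posD; apply: lipschitz_on_posZ;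
    do ?apply: lipschitz_on_posD; apply: lipschitz_on_posZ; exact: lipschitz_bump.
have z1 z : z <= ep n -> fn a n z = 0 by move=> /(test_near0 tf)[].
have z2 z : z <= ep n -> Ln a n z = 0 by exact: power_cut_gen_near0.
have z3 z : z <= ep n -> power_cut1 (ep n) a z = 0 by move=> /(test_near0 tf)[].
have z4 z : z <= ep n -> power_cut2 (ep n) a z = 0 by move=> /(test_near0 tf)[].
have m1 := lipschitz_near0_measurable (ep0 n) z1 l1.
have m2 := lipschitz_near0_measurable (ep0 n) z2 l2.
have m3 := lipschitz_near0_measurable (ep0 n) z3 l3.
have m4 := lipschitz_near0_measurable (ep0 n) z4 l4.
have LE : Ln a n = fun z => kappa / 2 * power_cut2 (ep n) a z - b * (power_cut1 (ep n) a z / z).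
  by apply/funext => z; exact: power_cut_genE.
rewrite LE in m2 l2 *.
by have [] := dynkin_formula bm b_gt0 sigma0 sigma2 aV HV (ep0 n) tf m1 m3 m4 m2 l1 l2 t0.
Qed.

Let Cgen a := power_cut_gen_bound kappa b a.

Let Ln_le a n z : `|Ln a n z| <= Cgen a * power_pos (a - 2) z.
Proof. exact: power_cut_gen_le. Qed.

Let Cgen_ge0 a : 0 <= Cgen a.
Proof.
have := Ln_le a 0 1; rewrite /power_pos ltr01 powR1 mulr1.
exact: le_trans.
Qed.

(** Integrability climbs by two orders: Dynkin's formula bounds the expectations of the cut-off
    powers by the moments of order a - 2, uniformly in n, and Fatou's lemma removes the cut-offs. *)
Lemma moment_step a t M : 0 <= t ->
  (forall s, 0 <= s <= t -> P.-integrable setT (EFin \o (fun w => power_pos (a - 2) (V s w))) /\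
     moment (a - 2) s <= M) ->
  forall s, 0 <= s <= t -> P.-integrable setT (EFin \o (fun w => power_pos a (V s w))) /\
     moment a s <= z0 `^ a + Cgen a * M * t.
Proof.
move=> t0 HM s /andP[s0 st].
have M0 : 0 <= M.
  by have [|_] := HM 0; [rewrite lexx|apply: le_trans; exact: moment_ge0].
set bound := z0 `^ a + Cgen a * M * t.
have ELn n u : 0 <= u <= t -> `|\int[P]_w Ln a n (V u w)| <= Cgen a * M.
  move=> ut; have [iu Mu] := HM u ut; have u0 : 0 <= u by case/andP: ut.
  have [_ _ mL _] := dynkin_power a n u0.
  have iL : P.-integrable setT (EFin \o (fun w => Ln a n (V u w))).
    apply: (@le_integrable _ _ R P setT measurableT _
      (EFin \o (fun w => Cgen a * power_pos (a - 2) (V u w)))).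
    - apply/measurable_EFinP; exact: measurableT_comp (mV u0).
    - move=> w _ /=; rewrite lee_fin; apply: le_trans (Ln_le a n _) _; exact: ler_norm.
    - exact: integrable_scaleR.
  apply: le_trans (ae_le_Rintegral iL (integrable_scaleR (Cgen a) iu) _) _.
    by apply: aeW => w; exact: Ln_le.
  by rewrite RintegralZl//; apply: ler_wpM2l.
have Efn n : (\int[P]_w (fn a n (V s w))%:E <= bound%:E)%E.
  have [cL mf mL] := dynkin_power a n s0.
  have [K tf] := power_cut_test (ep0 n) (ep1 n) a.
  have ifn : P.-integrable setT (EFin \o (fun w => fn a n (V s w))).
    apply: (@integrable_boundedR _ _ _ _ K) => [|w]; first exact: measurableT_comp (mV s0).
    by have [] := test_bounded tf (V s w).
  rewrite /Rintegral => e.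
  rewrite -[leLHS]fineK; last exact: (integrable_fin_num measurableT ifn).
  rewrite lee_fin e; apply: lerD.
    have /andP[_] := fn_le a n z0; rewrite /power_pos z0_gt0; exact: le_trans.
  have iLs : mu.-integrable `[0, s] (EFin \o (fun u => \int[P]_w Ln a n (V u w))).
    apply: continuous_compact_integrable; first exact: segment_compact.
    apply: continuous_subspaceW cL => x /=; rewrite !in_itv/= andbT => /andP[]//.
  have ics : mu.-integrable `[0, s] (EFin \o (fun=> Cgen a * M)).
    apply: continuous_compact_integrable; first exact: segment_compact.
    by move=> u; exact: cvg_cst.
  apply: le_trans (_ : \int[mu]_(u in `[0, s]) (Cgen a * M) <= _).
    apply: le_Rintegral => // u /=; rewrite in_itv/= => /andP[u0 us].
    by apply: le_trans (ler_norm _) _; apply: ELn; rewrite u0 (le_trans us).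
  rewrite Rintegral_cst//= lebesgue_measure_itv/= lte_fin.
  apply: ler_wpM2l; first exact: mulr_ge0.
  by case: ifPn => _ //=; rewrite subr0.
have mpn n : measurable_fun setT (fun w => (fn a n (V s w))%:E).
  have [_ mf _ _] := dynkin_power a n s0.
  by apply/measurable_EFinP; exact: measurableT_comp (mV s0).
have fat : (\int[P]_w (power_pos a (V s w))%:E <= bound%:E)%E.
  have := @fatou _ _ _ P setT measurableT (fun n w => (fn a n (V s w))%:E) mpn.
  have lims w : limn_einf (fun n => (fn a n (V s w))%:E) = (power_pos a (V s w))%:E.
    have c : (fn a n (V s w))%:E @[n --> \oo] --> (power_pos a (V s w))%:E.
      by apply: cvg_EFin; [exact: nearW|exact: bump_cvg].
    rewrite is_cvg_limn_einfE; first exact/cvg_lim.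
    by apply/cvg_ex; eexists; exact: c.
  under eq_integral do rewrite lims.
  move=> /(_ _)/le_trans; apply; first by move=> n w _; rewrite lee_fin; have /andP[] := fn_le a n (V s w).
  exact: limn_einf_le.
have iP : P.-integrable setT (EFin \o (fun w => power_pos a (V s w))).
  apply/integrableP; split; first by apply/measurable_EFinP; exact: mP.
  under eq_integral do rewrite /= ger0_norm ?power_pos_ge0//.
  exact: le_lt_trans fat (ltry _).
split => //; rewrite -lee_fin /moment /Rintegral fineK//.
exact: (integrable_fin_num measurableT iP).
Qed.

(** Even orders are reached from order 0, where the power is an indicator function; any other order
    is dominated by 1 plus an even one. *)
Lemma moment_bounded a t : 0 <= a -> 0 <= t -> exists M, forall s, 0 <= s <= t ->
  P.-integrable setT (EFin \o (fun w => power_pos a (V s w))) /\ moment a s <= M.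
Proof.
move=> a0 t0.
have even k : exists M, forall s, 0 <= s <= t ->
    P.-integrable setT (EFin \o (fun w => power_pos (2 * k)%:R (V s w))) /\ moment (2 * k)%:R s <= M.
  elim: k => [|k [M HM]].
    exists 1 => s /andP[s0 _].
    have i0 : P.-integrable setT (EFin \o (fun w => power_pos (2 * 0)%:R (V s w))).
      apply: (@integrable_boundedR _ _ _ _ 1) => [|w]; first exact: mP.
      by rewrite ger0_norm ?power_pos_ge0// muln0 power_pos0_le1.
    split => //; rewrite -[leRHS](_ : \int[P]_w (1 : R) = 1); last first.
      by rewrite Rintegral_cst//= probability_setT /= mulr1.
    apply: le_Rintegral => //; first exact: finite_measure_integrable_cst.
    by move=> w _; rewrite muln0 power_pos0_le1.
  exists (z0 `^ (2 * k.+1)%:R + Cgen (2 * k.+1)%:R * M * t) => s st.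
  have e2 : (2 * k.+1)%:R - 2 = (2 * k)%:R :> R by rewrite mulnS natrD addrC addKr.
  by apply: moment_step => // u ut; rewrite e2; exact: HM.
pose k := (Num.truncn a).+1.
have ak : a <= (2 * k)%:R.
  have := truncnS_gt a => h; apply: ltW; apply: lt_le_trans h _.
  by rewrite ler_nat leq_pmull.
have [M HM] := even k; exists (1 + M) => s st; have [iM Ms] := HM s st.
have s0 : 0 <= s by case/andP: st.
have i1 : P.-integrable setT (EFin \o (fun w : T => 1 : R)) by exact: finite_measure_integrable_cst.
have i2 := integrable_addR i1 iM.
have le2 w : power_pos a (V s w) <= 1 + power_pos (2 * k)%:R (V s w).
  by apply: power_pos_mono; rewrite a0.
have iP : P.-integrable setT (EFin \o (fun w => power_pos a (V s w))).
  apply: (@le_integrable _ _ R P setT measurableT _ _ _ _ i2).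
    by apply/measurable_EFinP; exact: mP.
  move=> w _ /=; rewrite lee_fin ger0_norm ?power_pos_ge0//.
  exact: le_trans (le2 w) (ler_norm _).
split => //; apply: le_trans (_ : \int[P]_w (1 + power_pos (2 * k)%:R (V s w)) <= _).
  by apply: le_Rintegral.
by rewrite RintegralD// Rintegral_cst//= probability_setT /= mulr1 lerD2l.
Qed.

Lemma moment_integrable a t : 0 <= a -> 0 <= t ->
  P.-integrable setT (EFin \o (fun w => power_pos a (V t w))).
Proof.
by move=> a0 t0; have [M /(_ t)] := moment_bounded a0 t0; rewrite t0 lexx => -[].
Qed.

Let cvgE (g : nat -> R -> R) (l G : R -> R) s : 0 <= s ->
    (forall n, measurable_fun setT (g n)) ->
    (forall z, g n z @[n --> \oo] --> l z) ->
    (forall n z, `|g n z| <= G z) ->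
    P.-integrable setT (EFin \o (fun w => G (V s w))) ->
    \int[P]_w g n (V s w) @[n --> \oo] --> \int[P]_w l (V s w).
Proof.
move=> s0 mg gl gG iG.
have mgn n : measurable_fun setT (fun w => (g n (V s w))%:E).
  by apply/measurable_EFinP; exact: measurableT_comp (mV s0).
have cgn w : setT w -> (g n (V s w))%:E @[n --> \oo] --> (l (V s w))%:E.
  by move=> _; apply: cvg_EFin; [exact: nearW|exact: gl].
have fing w : setT w -> (EFin \o (fun w => G (V s w))) w \is a fin_num by [].
have gGe n w : setT w -> (`|(g n (V s w))%:E| <= (EFin \o (fun w => G (V s w))) w)%E.
  by move=> _; rewrite lee_fin.
have H := dominated_cvg measurableT mgn cgn fing iG gGe.
have lG z : `|l z| <= G z.
  have c : `|g n z| @[n --> \oo] --> `|l z| by apply: cvg_norm; exact: gl.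
  rewrite -(cvg_lim _ c)//; apply: limr_le; first by apply/cvg_ex; eexists; exact: c.
  by apply: nearW => n.
have il : P.-integrable setT (EFin \o (fun w => l (V s w))).
  apply: (@le_integrable _ _ R P setT measurableT _ _ _ _ iG).
    exact: (emeasurable_fun_cvg _ _ mgn cgn).
  by move=> w _ /=; rewrite lee_fin; apply: le_trans (lG _) (ler_norm _).
apply: fine_cvg; rewrite /Rintegral fineK; last exact: (integrable_fin_num measurableT il).
exact: H.
Qed.

Let cvg_moment a t : 0 <= a -> 0 <= t ->
  \int[P]_w fn a n (V t w) @[n --> \oo] --> moment a t.
Proof.
move=> a0 t0; apply: (cvgE t0 (g := fn a) (G := power_pos a)) => //.
- by move=> n; have [] := dynkin_power a n t0.
- by move=> z; exact: bump_cvg.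
- by move=> n z; have /andP[h1 h2] := fn_le a n z; rewrite ger0_norm.
- exact: moment_integrable.
Qed.

Lemma measurable_moment (a : R) : 0 <= a -> measurable_fun ([set` `[0, +oo[] : set R) (moment a).
Proof.
move=> a0.
have cfn n : {within `[0, +oo[, continuous (fun s => \int[P]_w fn a n (V s w))}.
  have [K tf] := power_cut_test (ep0 n) (ep1 n) a.
  have [K1 l1] : lipschitz_on_pos (fn a n) by exact: lipschitz_bump.
  have z1 z : z <= ep n -> fn a n z = 0 by move=> /(test_near0 tf)[].
  have m1 : measurable_fun setT (fn a n) by have [] := dynkin_power a n (lexx 0).
  apply: uniform_modulus_continuous.
  apply: (lipschitz_modulus bm b_gt0 sigma0 sigma2 aV HV (ep0 n) z1 l1 (K' := K)) => // z.
  by have [] := test_bounded tf z.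
have mI : measurable ([set` `[0, +oo[] : set R) by exact: measurable_itv.
apply/measurable_EFinP.
apply: (@emeasurable_fun_cvg _ _ _ _ (fun n s => (\int[P]_w fn a n (V s w))%:E)).
  by move=> n; apply/measurable_EFinP; apply: subspace_continuous_measurable_fun => //; exact: cfn.
move=> s; rewrite /= in_itv/= andbT => s0.
by apply: cvg_EFin; [exact: nearW|exact: cvg_moment].
Qed.

(** Once the moments are known to be finite, dominated convergence turns the bound of [moment_step]
    into an identity, with [Cgen a * power_pos (a - 2)] as dominating function under P and a
    constant one under the time integral. *)
Lemma moment_formula a t : 2 <= a -> 0 <= t ->
  mu.-integrable `[0, t] (EFin \o moment (a - 2)) /\
  moment a t = z0 `^ a + (kappa / 2 * (a * (a - 1)) - b * a) *
    \int[mu]_(s in `[0, t]) moment (a - 2) s.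
Proof.
move=> a2 t0; have a20 : 0 <= a - 2 by lra.
have a0 : 0 <= a by lra.
have [M HM] := moment_bounded a20 t0.
set q := kappa / 2 * (a * (a - 1)) - b * a.
have c1 := cvg_moment a0 t0.
have c2 s : 0 <= s -> \int[P]_w Ln a n (V s w) @[n --> \oo] --> q * moment (a - 2) s.
  move=> s0; rewrite /moment -RintegralZl//; last exact: moment_integrable.
  apply: (cvgE s0 (g := Ln a) (l := fun z => q * power_pos (a - 2) z) (G := fun z => Cgen a * power_pos (a - 2) z)) => //.
  - by move=> n; have [] := dynkin_power a n s0.
  - by move=> z; exact: power_cut_gen_cvg.
  - by apply: integrable_scaleR; exact: moment_integrable.
have c3 : fn a n z0 @[n --> \oo] --> z0 `^ a.
  by have := @bump_cvg R a 4 4 z0; rewrite /power_pos z0_gt0.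
have ELn n s : 0 <= s <= t -> `|\int[P]_w Ln a n (V s w)| <= Cgen a * M.
  move=> st; have [iu Mu] := HM s st; have s0 : 0 <= s by case/andP: st.
  have [_ _ mL _] := dynkin_power a n s0.
  have iL : P.-integrable setT (EFin \o (fun w => Ln a n (V s w))).
    apply: (@le_integrable _ _ R P setT measurableT _
      (EFin \o (fun w => Cgen a * power_pos (a - 2) (V s w)))).
    - apply/measurable_EFinP; exact: measurableT_comp (mV s0).
    - move=> w _ /=; rewrite lee_fin; apply: le_trans (Ln_le a n _) _; exact: ler_norm.
    - exact: integrable_scaleR.
  apply: le_trans (ae_le_Rintegral iL (integrable_scaleR (Cgen a) iu) _) _.
    by apply: aeW => w; exact: Ln_le.
  by rewrite RintegralZl//; apply: ler_wpM2l.
have cLs n : {within `[0, t], continuous (fun s => \int[P]_w Ln a n (V s w))}.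
  have [cL _ _ _] := dynkin_power a n t0.
  by apply: continuous_subspaceW cL => x /=; rewrite !in_itv/= andbT => /andP[].
have mI : measurable ([set` `[0, t]] : set R) by exact: measurable_itv.
have mEL n : measurable_fun ([set` `[0, t]] : set R) (fun s => (\int[P]_w Ln a n (V s w))%:E).
  by apply/measurable_EFinP; apply: subspace_continuous_measurable_fun => //; exact: cLs.
have cEL s : [set` `[0, t]] s -> (\int[P]_w Ln a n (V s w))%:E @[n --> \oo] --> (q * moment (a - 2) s)%:E.
  by rewrite /= in_itv/= => /andP[s0 _]; apply: cvg_EFin; [exact: nearW|exact: c2].
have ics (c : R) : mu.-integrable `[0, t] (fun _ : R => c%:E).
  apply: continuous_compact_integrable; first exact: segment_compact.
  by move=> u; exact: cvg_cst.
have fing s : [set` `[0, t]] s -> ((fun _ : R => (Cgen a * M)%:E) s) \is a fin_num by [].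
have bEL n s : [set` `[0, t]] s -> (`|(\int[P]_w Ln a n (V s w))%:E| <= (fun _ : R => (Cgen a * M)%:E) s)%E.
  by rewrite /= in_itv/= => st; rewrite lee_fin; exact: ELn.
have H := @dominated_cvg _ (measurableTypeR R) R mu _ mI _ _ _ mEL cEL fing (ics _) bEL.
have imom : mu.-integrable `[0, t] (EFin \o moment (a - 2)).
  apply: (@le_integrable _ (measurableTypeR R) R mu _ mI _ (fun=> M%:E) _ _ (ics M)).
    apply/measurable_EFinP; apply: measurable_funS (measurable_moment a20) => //.
    by move=> s /=; rewrite !in_itv/= andbT => /andP[].
  move=> s; rewrite /= in_itv/= => st; rewrite lee_fin ger0_norm ?moment_ge0//.
  by apply: le_trans (ler_norm _); have [] := HM s st.
split => //.
have c4 : \int[mu]_(s in `[0, t]) \int[P]_w Ln a n (V s w) @[n --> \oo] -->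
    q * \int[mu]_(s in `[0, t]) moment (a - 2) s.
  rewrite -RintegralZl//; apply: fine_cvg; rewrite /Rintegral fineK; first exact: H.
  have iq : mu.-integrable `[0, t] (fun s => (q * moment (a - 2) s)%:E).
    refine (@integrableZl _ (measurableTypeR R) R mu _ mI q _ imom).
  refine (@integrable_fin_num _ (measurableTypeR R) R mu _ mI _ iq).
have c5 := cvgD c3 c4.
have e5 : (fun n => fn a n z0 + \int[mu]_(s in `[0, t]) \int[P]_w Ln a n (V s w)) =
    (fun n => \int[P]_w fn a n (V t w)).
  by apply/funext => n; have [_ _ _ ->] := dynkin_power a n t0.
rewrite -(cvg_lim _ c1)//; apply: cvg_lim => //.
by rewrite -e5; exact: c5.
Qed.
End moments.

(** * From moments to the law of the lifetime *)

Section layer_cake.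
Variable R : realType.
Notation mu := (@lebesgue_measure R).

(** The weight of the layer cake formula; the restriction to s > 0 is part of the integrand, so that
    the time integrals run over the whole line. *)
Definition power_weight (j : nat) (s : R) : R := (0 < s)%R%:R * s ^+ j.

Lemma power_weight_ge0 j s : 0 <= power_weight j s.
Proof.
rewrite /power_weight; case: ltP => [s0|_]; last by rewrite mul0r.
by rewrite mul1r exprn_ge0// ltW.
Qed.

Lemma measurable_bool_natr d (S : measurableType d) (b : S -> bool) :
  measurable_fun setT b -> measurable_fun setT (fun x => (b x)%:R : R).
Proof.
move=> mb; rewrite (_ : (fun x => (b x)%:R : R) = fun x => if b x then 1 else 0).
  exact: measurable_fun_ifT.
by apply/funext => x; case: (b x).
Qed.

Lemma measurable_power_weight j : measurable_fun setT (power_weight j).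
Proof.
apply: measurable_funM; last exact: exprn_measurable.
by apply: measurable_bool_natr; exact: measurable_fun_ltr.
Qed.

Lemma integral_power_weight j (u : R) : 0 <= u ->
  (\int[mu]_s (power_weight j s * (s < u)%R%:R)%:E = (u ^+ j.+1 / j.+1%:R)%:E)%E.
Proof.
rewrite le_eqVlt => /orP[/eqP <-|u0].
  rewrite integral0_eq ?expr0n ?mul0r// => s _; rewrite /power_weight.
  by case: ltgtP => //; rewrite ?(mul0r, mulr0).
transitivity (\int[mu]_(s in `]0%R, u[) (s ^+ j)%:E)%E.
  rewrite [RHS]integral_mkcond; apply: eq_integral => s _.
  rewrite patchE mem_setE in_itv/= /power_weight.
  by case: (ltP 0 s); case: (ltP s u) => *; rewrite ?(mul0r, mulr0, mul1r, mulr1).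
rewrite -(@integral_itv_bndoo _ _ _ _ true false); last first.
  by apply/measurable_EFinP; apply: measurable_funTS; exact: exprn_measurable.
have j0 : j.+1%:R != 0 :> R by rewrite pnatr_eq0.
pose G (s : R) := j.+1%:R^-1 * s ^+ j.+1.
have dG (s : R) : is_derive s 1 G (s ^+ j).
  have := is_deriveZ j.+1%:R^-1 (@is_deriveX R R^o id j.+1 s 1 1 (is_derive_id s (1 : R))).
  rewrite exprfctE => dX; apply: (is_derive_eq dX).
  by rewrite /GRing.scale /=; rewrite mulr1 mulrA mulVf// mul1r.
have cG : continuous G.
  by move=> s; apply: differentiable_continuous; apply/derivable1_diffP; have [] := dG s.
rewrite (@continuous_FTC2 _ _ G)//.
- by rewrite /G expr0n mulr0 sube0 mulrC.
- by apply: continuous_subspaceT => s; exact: exprn_continuous.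
- split; first by move=> s _; have [] := dG s.
    by apply: cvg_at_right_filter; exact: cG.
  by apply: cvg_at_left_filter; exact: cG.
- by move=> s _; rewrite derive1E; have [_ ->] := dG s.
Qed.

(** Tonelli's theorem, with U^(j+1) / (j+1) written as the integral of s^j over 0 < s < U. The
    weight [h] is a moment function when [nu] is Lebesgue measure, and 1 when [nu] is the
    probability. *)
Lemma layer_cake d (S : measurableType d) (nu : {sigma_finite_measure set S -> \bar R})
    (U h : S -> R) j :
  measurable_fun setT U -> measurable_fun setT h ->
  (forall x, 0 <= U x) -> (forall x, 0 <= h x) ->
  (\int[nu]_x (U x ^+ j.+1 / j.+1%:R * h x)%:E =
   \int[mu]_s ((power_weight j s)%:E * \int[nu]_x (h x * (s < U x)%R%:R)%:E))%E.
Proof.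
move=> mU mh U0 h0.
pose f (p : S * R) : \bar R := (power_weight j p.2 * (p.2 < U p.1)%R%:R * h p.1)%:E.
have mf : measurable_fun setT f.
  apply/measurable_EFinP; apply: measurable_funM; last first.
    exact: measurableT_comp mh (@measurable_fst _ _ S R).
  apply: measurable_funM.
    exact: measurableT_comp (measurable_power_weight j) (@measurable_snd _ _ S R).
  apply: measurable_bool_natr; apply: measurable_fun_ltr; first exact: measurable_snd.
  exact: measurableT_comp mU (@measurable_fst _ _ S R).
have f0 p : setT p -> (0 <= f p)%E.
  by move=> _; rewrite lee_fin; do 2![apply: mulr_ge0 => //]; exact: power_weight_ge0.
have := @fubini_tonelli _ _ S (measurableTypeR R) R nu mu f mf (fun p => f0 p I).
rewrite /f /= => tonelli.
have mUs s : measurable_fun setT (fun x => (s < U x)%R%:R : R).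
  by apply: measurable_bool_natr; exact: measurable_fun_ltr.
transitivity (\int[nu]_x \int[mu]_s (power_weight j s * (s < U x)%R%:R * h x)%:E)%E.
  apply: eq_integral => x _; under eq_integral do rewrite EFinM muleC.
  rewrite ge0_integralZl_EFin//; first by rewrite integral_power_weight// -EFinM mulrC.
  - by move=> s _; rewrite lee_fin mulr_ge0// power_weight_ge0.
  - apply/measurable_EFinP; apply: measurable_funM; first exact: measurable_power_weight.
    by apply: measurable_bool_natr; exact: measurable_fun_ltr.
rewrite tonelli; apply: eq_integral => s _.
rewrite -ge0_integralZl_EFin ?power_weight_ge0//.
- by apply: eq_integral => x _; rewrite -EFinM; congr EFin; ring.
- by move=> x _; rewrite lee_fin mulr_ge0.
- by apply/measurable_EFinP; exact: measurable_funM.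
Qed.
End layer_cake.

Section moment_recursion.
Variable R : realType.
Notation mu := (@lebesgue_measure R).
Variables (m : nat -> R -> R) (c : nat -> R) (n : nat).
Hypothesis mm : forall k, (k < n)%N -> measurable_fun setT (m k).
Hypothesis m_ge0 : forall k s, 0 <= m k s.
Hypothesis c_gt0 : forall k, (k < n)%N -> 0 < c k.
Hypothesis tail : forall k s, (k < n)%N -> 0 <= s ->
  ((m k.+1 s)%:E = (c k)%:E * \int[mu]_u (m k u * (s < u)%R%:R)%:E)%E.

(** The tail hypothesis makes the left side a double integral over s < u; [layer_cake] with U =
    max(u, 0) carries out the integration in s and raises the degree of the weight by one. *)
Lemma moment_recursion_step k j : (k.+1 < n)%N ->
  (\int[mu]_s (power_weight j s * m k.+1 s)%:E =
   (c k / j.+1%:R)%:E * \int[mu]_s (power_weight j.+1 s * m k s)%:E)%E.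
Proof.
move=> kn; have kn' : (k < n)%N by exact: ltnW.
have mU : measurable_fun setT (fun s : R => Num.max s 0).
  exact: measurable_maxr.
have U0 (s : R) : 0 <= Num.max s 0 by rewrite le_max lexx orbT.
have := @layer_cake R _ (measurableTypeR R) mu (fun s => Num.max s 0) (m k) j mU (mm kn') U0 (m_ge0 k).
move=> lc.
have wE (s : R) : Num.max s 0 ^+ j.+1 = power_weight j.+1 s.
  rewrite /power_weight; case: ltP => s0; first by rewrite mul1r.
  by rewrite mul0r expr0n.
have ck0 := c_gt0 kn'.
have c0 : 0 <= c k / j.+1%:R by rewrite divr_ge0// ltW.
rewrite -ge0_integralZl_EFin//; last 2 first.
- by move=> s _; rewrite lee_fin mulr_ge0// power_weight_ge0.
- by apply/measurable_EFinP; apply: measurable_funM; [exact: measurable_power_weight|exact: mm].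
transitivity ((c k)%:E * \int[mu]_x (Num.max x 0 ^+ j.+1 / j.+1%:R * m k x)%:E)%E; last first.
  rewrite -ge0_integralZl_EFin ?ltW//.
  - apply: eq_integral => s _; rewrite -EFinM wE; congr EFin; ring.
  - by move=> s _; rewrite lee_fin wE mulr_ge0// divr_ge0// power_weight_ge0.
  - apply/measurable_EFinP; apply: measurable_funM; last exact: mm.
    by under eq_fun do rewrite wE; apply: measurable_funM => //; exact: measurable_power_weight.
rewrite lc.
have tailE (s : R) : ((power_weight j s)%:E * \int[mu]_u (m k u * (s < Num.max u 0)%R%:R)%:E =
    (power_weight j s * m k.+1 s / c k)%:E)%E.
  have [s0|s0] := ltP 0 s; last first.
    by rewrite /power_weight ltNge s0 /= !mul0r mul0e.
  have sE (u : R) : (s < Num.max u 0) = (s < u) by rewrite lt_max [s < 0]ltNge ltW// orbF.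
  under eq_integral do rewrite sE.
  have I0 : (0 <= \int[mu]_u (m k u * (s < u)%R%:R)%:E)%E.
    by apply: integral_ge0 => u _; rewrite lee_fin mulr_ge0.
  have := tail kn' (ltW s0); move: I0.
  (* An infinite integral is excluded: its product with [c k > 0] is a real number. *)
  case: (\int[mu]_u _)%E => [r _|_|//].
  - by rewrite -EFinM => -[->]; rewrite -EFinM; congr EFin; field; rewrite gt_eqF.
  - by rewrite gt0_muley ?lte_fin.
under [in RHS]eq_integral do rewrite tailE.
rewrite -ge0_integralZl_EFin ?ltW//.
- by apply: eq_integral => s _; rewrite -EFinM; congr EFin; field; rewrite gt_eqF.
- by move=> s _; rewrite lee_fin; apply: divr_ge0; [apply: mulr_ge0 => //; exact: power_weight_ge0|exact: ltW].
- apply/measurable_EFinP; apply: measurable_funM => //.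
  by apply: measurable_funM; [exact: measurable_power_weight|exact: mm].
Qed.

Lemma moment_recursionE : (0 < n)%N ->
  ((m n 0)%:E = ((\prod_(i < n) c i) / n.-1`!%:R)%:E *
     \int[mu]_s (power_weight n.-1 s * m 0%N s)%:E)%E.
Proof.
move=> n0.
(* After j exchanges of integrals the weight has degree j and the moment has index n - 1 - j; the
   factors 1 / (j + 1) accumulate to 1 / j!. *)
have H j : (j < n)%N -> ((m n 0)%:E = ((\prod_(n.-1 - j <= i < n) c i) / j`!%:R)%:E *
     \int[mu]_s (power_weight j s * m (n.-1 - j)%N s)%:E)%E.
  elim: j => [_|j IH jn].
    have n1 : (n.-1 < n)%N by rewrite prednK.
    have := tail n1 (lexx 0); rewrite prednK// subn0 => ->.
    rewrite -[X in index_iota _ X](prednK n0) big_nat1 fact0 divr1; congr (_ * _)%E.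
    by apply: eq_integral => s _; rewrite /power_weight expr0 mulr1 mulrC.
  have jn' : (j < n)%N by exact: ltnW.
  have e : (n.-1 - j = (n.-1 - j.+1).+1)%N by move: jn; case: (n) => // p; rewrite ltnS /= => jp; rewrite subnSK.
  rewrite (IH jn') e moment_recursion_step; last by rewrite -e; move: jn; case: (n) => // p _; rewrite /= ltnS leq_subr.
  rewrite muleA -EFinM; congr (_%:E * _)%E.
  rewrite [in RHS]big_ltn; last by rewrite (leq_ltn_trans (leq_subr _ _))// prednK.
  rewrite factS natrM.
  by rewrite invfM; ring.
have := H n.-1; rewrite prednK// subnn => /(_ (leqnn _)).
by rewrite big_mkord.
Qed.
End moment_recursion.

Section tail.
Variable R : realType.
Notation mu := (@lebesgue_measure R).

(** Differences of M are integrals over the bounded intervals from s to s + i. Since M vanishes at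
    infinity, monotone convergence gives the integral over the half line together with its
    finiteness. *)
Lemma tail_integral (m M : R -> R) (c : R) : 0 < c -> measurable_fun setT m ->
  (forall u, 0 <= m u) ->
  (forall t, 0 <= t -> mu.-integrable `[0, t] (EFin \o m) /\
     M t = M 0 - c * \int[mu]_(u in `[0, t]) m u) ->
  (forall e, 0 < e -> exists t0, forall t, t0 <= t -> `|M t| <= e) ->
  forall s, 0 <= s -> ((M s)%:E = c%:E * \int[mu]_u (m u * (s < u)%R%:R)%:E)%E.
Proof.
move=> c0 mm m0 HM M0 s s0.
pose F (i : nat) : set R := [set` `]s, s + i%:R]].
have ndF : nondecreasing_seq F.
  move=> i j ij; apply/subsetPset => u; rewrite /F /= !in_itv/= => /andP[-> us].
  by apply: le_trans us _; rewrite lerD2l ler_nat.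
have mF i : measurable (F i) by exact: measurable_itv.
have mmF i : measurable_fun (F i) (EFin \o m).
  by apply/measurable_EFinP; exact: measurable_funTS.
have C := @ge0_nondecreasing_set_cvg_integral _ (measurableTypeR R) R F (EFin \o m) mu ndF mF mmF
  (fun i x _ => m0 x).
have FE : (\bigcup_i F i) = [set` `]s, +oo[].
  apply/seteqP; split => u; rewrite /= in_itv/= andbT.
    by move=> [i _]; rewrite /F /= in_itv/= => /andP[].
  move=> su; exists (Num.truncn (u - s)).+1 => //; rewrite /F /= in_itv/= su /=.
  by have := truncnS_gt (u - s) => h; rewrite -lerBlDl; exact: ltW.
have IE i : (\int[mu]_(u in F i) (EFin \o m) u)%E = ((M s - M (s + i%:R)) / c)%:E.
  have si : 0 <= s + i%:R by exact: addr_ge0.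
  have [isi Esi] := HM _ si; have [_ Es] := HM s s0.
  have := @Rintegral_itvB R m (BLeft 0) (BRight (s + i%:R)) s isi.
  rewrite /= !bnd_simp => /(_ s0); rewrite lerDl ler0n => /(_ isT) E.
  have -> : (M s - M (s + i%:R)) / c = \int[mu]_(u in F i) m u.
    by rewrite -E Es Esi; field; rewrite gt_eqF.
  rewrite /Rintegral fineK//.
  have iF : mu.-integrable (F i) (EFin \o m).
    apply: (@integrableS _ (measurableTypeR R) R mu _ _ _ _ (mF i) _ isi); first exact: measurable_itv.
    rewrite /F => u /=; rewrite !in_itv/= => /andP[su ->].
    by rewrite andbT ltW// (le_lt_trans s0).
  refine (@integrable_fin_num _ (measurableTypeR R) R mu _ (mF i) _ iF).
have C2 : (\int[mu]_(u in F i) (EFin \o m) u)%E @[i --> \oo] --> (M s / c)%:E.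
  under eq_fun do rewrite IE.
  apply: cvg_EFin; first exact: nearW.
  apply: cvgM; last exact: cvg_cst.
  rewrite -[X in _ --> X]subr0; apply: cvgB; first exact: cvg_cst.
  apply/cvgr0Pnorm_le => e e0; have [t0 Ht] := M0 e e0.
  near=> i; apply: Ht; have : t0 <= i%:R by near: i; exact: nbhs_infty_ger.
  by lra.
have := cvg_unique _ C C2; rewrite FE integral_mkcond => E.
transitivity (c%:E * (M s / c)%:E)%E; first by rewrite -EFinM mulrC divfK// gt_eqF.
rewrite -E//; congr (_ * _)%E; apply: eq_integral => u _.
rewrite patchE mem_setE in_itv/= andbT.
by case: ifPn; rewrite ?(mulr1, mulr0).
Unshelve. all: by end_near. Qed.
End tail.

(** Splitting at z = M: below it z^k <= M^k, above it z^(k - a) <= M^(k - a). *)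
Lemma power_pos_interp (R : realType) (k a M z : R) : 0 <= k <= a -> 0 < M ->
  power_pos k z <= M `^ k * power_pos 0 z + M `^ (k - a) * power_pos a z.
Proof.
move=> /andP[k0 ka] M0; rewrite /power_pos; case: ifPn => z0; last by rewrite !mulr0 addr0.
rewrite powRr0 mulr1; have [zM|Mz] := leP z M.
  apply: le_trans (_ : M `^ k <= _); first by apply: ge0_ler_powR; rewrite ?nnegrE// ltW.
  by rewrite lerDl mulr_ge0// powR_ge0.
have -> : z `^ k = z `^ (k - a) * z `^ a.
  by rewrite -powRD ?subrK//; apply/implyP => _; rewrite gt_eqF.
apply: le_trans (_ : M `^ (k - a) * z `^ a <= _); last by rewrite lerDr powR_ge0.
apply: ler_wpM2r; first exact: powR_ge0.
have ak : 0 <= a - k by lra.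
rewrite -opprB !powRN lef_pV2 ?posrE ?powR_gt0//.
by apply: ge0_ler_powR; rewrite ?nnegrE// ltW.
Qed.

(** * Decay of the moments and law of the lifetime *)

Section lifetime.
Context d (T : measurableType d) (R : realType) (P : probability T R).
Notation mu := (@lebesgue_measure R).
Variables (F : R -> set_system T) (B V : R -> T -> R).
Variables (kappa sigma b z0 : R) (n : nat).
Hypothesis bm : brownian_motion P F B.
Hypotheses (b_gt0 : 0 < b) (sigma0 : sigma != 0) (sigma2 : sigma ^+ 2 = kappa).
Hypothesis aV : forall t, 0 <= t -> adapted_at F t (V t).
Hypothesis HV : {ae P, forall w, bessel_path b z0 (fun t => sigma * B t w) (V ^~ w)}.
Hypothesis z0_gt0 : 0 < z0.
Hypotheses (n_gt0 : (0 < n)%N) (n_small : (2 * n)%:R * kappa < 2 * b + kappa).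

Let kappa_gt0 : 0 < kappa.
Proof. by rewrite -sigma2 exprn_even_gt0. Qed.

Let mV t : 0 <= t -> measurable_fun setT (V t).
Proof. by move=> t0; exact: (adapted_at_measurable bm t0 (aV t0)). Qed.

Notation moment := (moment P V).

Let imoment a t : 0 <= a -> 0 <= t ->
  P.-integrable setT (EFin \o (fun w => power_pos a (V t w))).
Proof. exact: (moment_integrable bm b_gt0 sigma0 sigma2 aV HV z0_gt0). Qed.

Let formula a t : 2 <= a -> 0 <= t ->
  mu.-integrable `[0, t] (EFin \o moment (a - 2)) /\
  moment a t = z0 `^ a + (kappa / 2 * (a * (a - 1)) - b * a) *
    \int[mu]_(s in `[0, t]) moment (a - 2) s.
Proof. exact: (moment_formula bm b_gt0 sigma0 sigma2 aV HV z0_gt0). Qed.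

Let b_big : kappa < 2 * b.
Proof.
move: (n_small) (kappa_gt0) => h k0.
have : 2 * kappa <= (2 * n)%:R * kappa.
  by apply: ler_wpM2r; [exact: ltW|rewrite ler_nat leq_pmulr].
by lra.
Qed.

Lemma moment_interp k a M t : 0 <= k <= a -> 0 < M -> 0 <= t ->
  moment k t <= M `^ k * moment 0 t + M `^ (k - a) * moment a t.
Proof.
move=> /[dup] ka /andP[k0 ka'] M0 t0; have a0 : 0 <= a by exact: le_trans ka'.
have i1 := imoment k0 t0; have i2 := imoment (lexx 0) t0; have i3 := imoment a0 t0.
have i4 := integrable_scaleR (M `^ k) i2; have i5 := integrable_scaleR (M `^ (k - a)) i3.
rewrite /moment -!RintegralZl// -RintegralD//.
apply: le_Rintegral => //; first exact: integrable_addR.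
by move=> w _; exact: power_pos_interp.
Qed.

Lemma moment0_nonincreasing s t : 0 <= s <= t -> moment 0 t <= moment 0 s.
Proof.
move=> /[dup] st /andP[s0 st']; have t0 : 0 <= t by exact: le_trans st'.
have i1 := imoment (lexx 0) t0; have i2 := imoment (lexx 0) s0.
apply: le_trans (ler_norm _) _; apply: ae_le_Rintegral => //.
apply: filterS HV => w bw; rewrite /power_pos !powRr0.
case: (ltP 0 (V t w)) => Vt; last by rewrite normr0; case: ifP.
by rewrite (bessel_absorbed bw st Vt) normr1.
Qed.

(** For a = 2 the moment formula says that E[V_t^2] is z0^2 minus 2 b - kappa times the integral of
    P(V_s > 0) over [0, t]. The former is nonnegative, and the integrand is nonincreasing in s. *)
Lemma moment0_decay t : 0 < t -> moment 0 t <= z0 `^ 2 / ((2 * b - kappa) * t).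
Proof.
move=> t0; have [] := formula (lexx 2) (ltW t0); rewrite subrr => i0 E.
have m2 := moment_ge0 P V 2 t.
have ic : mu.-integrable `[0, t] (EFin \o (fun=> moment 0 t)).
  apply: continuous_compact_integrable; first exact: segment_compact.
  by move=> u; exact: cvg_cst.
have : moment 0 t * t <= \int[mu]_(s in `[0, t]) moment 0 s.
  apply: le_trans (_ : \int[mu]_(s in `[0, t]) moment 0 t <= _).
    rewrite Rintegral_cst//= lebesgue_measure_itv/= lte_fin t0 /= subr0; exact: lexx.
  have mI : measurable ([set` `[0, t]] : set R) by exact: measurable_itv.
  refine (@le_Rintegral _ (measurableTypeR R) R mu _ _ _ mI ic i0 _) => u; rewrite /= in_itv/= => ut.
  exact: moment0_nonincreasing.
move: (b_big) m2 E => bb m2 E le1.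
have q0 : 0 < 2 * b - kappa by rewrite subr_gt0.
rewrite ler_pdivlMr ?mulr_gt0//.
have : (2 * b - kappa) * (moment 0 t * t) <= (2 * b - kappa) * \int[mu]_(s in `[0, t]) moment 0 s.
  by apply: ler_wpM2l => //; exact: ltW.
set I := \int[mu]_(_ in _) _ in E *.
have -> : (2 * b - kappa) * I = z0 `^ 2 - moment 2 t by rewrite E; field.
set m0 := moment 0 t; lra.
Qed.

(** Interpolation between the order 0, which decays, and the order [1 + 2 * b / kappa], whose moment
    is constant; for b = 4 - kappa this order is 8 / kappa - 1. *)
Lemma moment_decay k : 0 <= k < 1 + 2 * b / kappa ->
  forall e, 0 < e -> exists t0, forall t, t0 <= t -> moment k t <= e.
Proof.
set a := 1 + 2 * b / kappa => /andP[k0 ka] e e0.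
move: (b_gt0) (kappa_gt0) (b_big) => b0 kp0 bb.
have q0 : 0 < 2 * b - kappa by rewrite subr_gt0.
(* [z ^ a] is annihilated by the generator. *)
have a2 : 2 <= a.
  have : 1 <= 2 * b / kappa by rewrite ler_pdivlMr// mul1r ltW.
  by rewrite /a; lra.
have mA t : 0 <= t -> moment a t = z0 `^ a.
  move=> t0; have [_ ->] := formula a2 t0.
  have -> : kappa / 2 * (a * (a - 1)) - b * a = 0 by rewrite /a; field; rewrite gt_eqF.
  by rewrite mul0r addr0.
pose C := z0 `^ a; have C0 : 0 < C by exact: powR_gt0.
(* The solution of M^(k - a) C = e / 2: the constant moment contributes half of [e] at all times,
   and a large t takes care of the other half. *)
pose M := (e / 2 / C) `^ (k - a)^-1.
have eC : 0 < e / 2 / C by rewrite !divr_gt0.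
have M0 : 0 < M by exact: powR_gt0.
have ka0 : k - a != 0 by rewrite subr_eq0 lt_eqF.
have MC : M `^ (k - a) = e / 2 / C by rewrite /M -powRrM mulVf// powRr1// ltW.
pose D := M `^ k * z0 `^ 2 / (2 * b - kappa).
have D0 : 0 < D by rewrite divr_gt0// mulr_gt0// powR_gt0.
exists (2 * D / e) => t tD.
have t0 : 0 < t by apply: lt_le_trans tD; rewrite divr_gt0// mulr_gt0.
apply: le_trans (moment_interp (a := a) _ M0 (ltW t0)) _; first by rewrite k0 ltW.
rewrite (mA _ (ltW t0)) MC (_ : e / 2 / C * z0 `^ a = e / 2); last by rewrite -/C divfK// gt_eqF.
have : M `^ k * moment 0 t <= M `^ k * (z0 `^ 2 / ((2 * b - kappa) * t)).
  by apply: ler_wpM2l; [exact: powR_ge0|exact: moment0_decay].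
have -> : M `^ k * (z0 `^ 2 / ((2 * b - kappa) * t)) = D / t.
  by rewrite /D; field; rewrite !gt_eqF.
have : D / t <= e / 2.
  by rewrite ler_pdivrMr//; move: tD; rewrite ler_pdivrMr//; lra.
by move=> h1 h2; rewrite [leRHS](splitr e) lerD2r; exact: le_trans h2 h1.
Qed.

Let moment0E t : 0 <= t -> P [set w | 0 < V t w] = (moment 0 t)%:E.
Proof.
move=> t0; rewrite /moment /Rintegral fineK; last first.
  exact: (integrable_fin_num measurableT (imoment (lexx 0) t0)).
have mS : measurable [set w | 0 < V t w].
  rewrite (_ : [set w | 0 < V t w] = V t @^-1` [set` `]0, +oo[]).
    by rewrite -[X in measurable X]setTI; apply: mV => //; exact: measurable_itv.
  by apply/seteqP; split => w; rewrite /= in_itv/= andbT.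
rewrite -[LHS](_ : \int[P]_w (\1_[set w | 0 < V t w] w)%:E = _)%E; last first.
  by rewrite integral_indic// setIT.
apply: eq_integral => w _; rewrite indicE /power_pos powRr0.
case: ifPn => h; first by rewrite mem_set.
by rewrite memNset//= => h'; rewrite h' in h.
Qed.

Lemma extinction : {ae P, forall w, exists k : nat, V k%:R w <= 0}.
Proof.
have mS (k : nat) : measurable [set w | 0 < V k%:R w].
  rewrite (_ : [set w | 0 < V k%:R w] = V k%:R @^-1` [set` `]0, +oo[]).
    by rewrite -[X in measurable X]setTI; apply: mV => //; exact: measurable_itv.
  by apply/seteqP; split => w; rewrite /= in_itv/= andbT.
exists (\bigcap_(k : nat) [set w | 0 < V k%:R w]); split.
- by apply: bigcap_measurable => // k _; exact: mS.
- apply/eqP; rewrite -measure_le0; apply/lee_addgt0Pr => e e0; rewrite add0e.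
  have h0 : 0 <= (0 : R) < 1 + 2 * b / kappa.
    move: (b_gt0) (kappa_gt0) => b0 k0.
    have : 0 < 2 * b / kappa by rewrite divr_gt0// mulr_gt0.
    by rewrite lexx /=; lra.
  have [t0 Ht] := moment_decay h0 e0.
  pose k := (Num.truncn t0).+1.
  have Pk : (P [set w | (0 < V k%:R w)%R] <= e%:E)%E.
    by rewrite moment0E// lee_fin; apply: Ht; apply: ltW; exact: truncnS_gt.
  apply: le_trans Pk; apply: le_measure; rewrite ?inE//.
    by apply: bigcap_measurable => // j _; exact: mS.
  by move=> w /(_ k I).
- move=> w h k _ /=; rewrite ltNge; apply/negP => hk; apply: h; by exists k.
Qed.

(** The extension by 0 to negative times serves the integrals over the whole line. *)
Let m (k : nat) (s : R) : R := if 0 <= s then moment (2 * k)%:R s else 0.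
(** For b = 4 - kappa this is (k + 1) (8 - (2 k + 3) kappa), the coefficient linking the orders 2 k
    + 2 and 2 k. *)
Let c (k : nat) : R := k.+1%:R * (2 * b - (2 * k + 1)%:R * kappa).

Let m_ge0 k s : 0 <= m k s.
Proof. by rewrite /m; case: ifP => // _; exact: moment_ge0. Qed.

Let mm k : measurable_fun setT (m k).
Proof.
have -> : m k = moment (2 * k)%:R \_ [set` `[0, +oo[].
  by apply/funext => s; rewrite patchE mem_setE in_itv/= andbT.
apply/(measurable_restrictT _ _).1; first exact: measurable_itv.
by apply: (measurable_moment bm b_gt0 sigma0 sigma2 aV HV z0_gt0).
Qed.

Let c_gt0 k : (k < n)%N -> 0 < c k.
Proof.
move=> kn; apply: mulr_gt0; first by rewrite ltr0n.
move: (n_small) (kappa_gt0) => h k0.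
have : (2 * k + 2)%:R * kappa <= (2 * n)%:R * kappa.
  apply: ler_wpM2r; first exact: ltW.
  by rewrite ler_nat addnC -mulnS leq_mul2l kn.
by rewrite !natrD; lra.
Qed.

Let m_formula k t : 0 <= t -> mu.-integrable `[0, t] (EFin \o m k) /\
  m k.+1 t = z0 ^+ (2 * k.+1) - c k * \int[mu]_(u in `[0, t]) m k u.
Proof.
move=> t0; have a2 : 2 <= (2 * k.+1)%:R :> R by rewrite ler_nat mulnS leq_addr.
have [] := formula a2 t0.
have -> : (2 * k.+1)%:R - 2 = (2 * k)%:R :> R by rewrite mulnS natrD addrC addKr.
have mE : {in [set` `[0, t]], moment (2 * k)%:R =1 m k}.
  by move=> u; rewrite mem_setE in_itv/= /m => /andP[-> _].
move=> i1 E; split.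
  have mI : measurable ([set` `[0, t]] : set R) by exact: measurable_itv.
  refine (@eq_integrable _ (measurableTypeR R) R mu _ mI _ _ _ i1).
  by move=> u /mE /= ->.
rewrite {1}/m t0 E powR_mulrn ?ltW//; congr (_ + _).
rewrite -[in RHS]mulNr; congr (_ * _).
  by rewrite /c natrM natrD natrM -natr1; field.
by rewrite /Rintegral; congr fine; apply: eq_integral => u /mE /= ->.
Qed.

Let m_tail k s : (k < n)%N -> 0 <= s ->
  ((m k.+1 s)%:E = (c k)%:E * \int[mu]_u (m k u * (s < u)%R%:R)%:E)%E.
Proof.
move=> kn; apply: tail_integral => //; first exact: c_gt0.
- move=> t t0; have [i1 ->] := m_formula k t0; split => //.
  by have [_ ->] := m_formula k (lexx 0); rewrite set_itv1 Rintegral_set1 mulr0 subr0.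
- move=> e e0.
  have h : 0 <= ((2 * k.+1)%:R : R) < 1 + 2 * b / kappa.
    rewrite ler0n /=; move: (n_small) (kappa_gt0) => h k0.
    have -> : 1 + 2 * b / kappa = (2 * b + kappa) / kappa by field; rewrite gt_eqF.
    rewrite ltr_pdivlMr//; apply: le_lt_trans h; apply: ler_wpM2r; first exact: ltW.
    by rewrite ler_nat leq_mul2l kn.
  have [t0 Ht] := moment_decay h e0; exists t0 => t tt.
  rewrite /m; case: ifP => _; last by rewrite normr0 ltW.
  by rewrite ger0_norm ?moment_ge0//; exact: Ht.
Qed.

(** [A] stands for a measurable version of the lifetime and is tied to V only through the almost
    sure equivalence of 0 < V_s and s < A. The layer cake formula expresses E[A^n] through the
    integral of s^(n-1) P(V_s > 0), where the recursion ends. Of n! from the coefficients and (n-1)!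
    from the exchanges a factor n remains, and it cancels that of the layer cake formula. *)
Lemma lifetime_moment (A : T -> R) : measurable_fun setT A -> (forall w, 0 <= A w) ->
  {ae P, forall w s, 0 <= s -> (0 < V s w) = (s < A w)} ->
  (\int[P]_w (A w ^+ n)%:E =
   (z0 ^+ (2 * n) / \prod_(k < n) (2 * b - (2 * k + 1)%:R * kappa))%:E)%E.
Proof.
move=> mA A0 AV.
have prec := moment_recursionE (fun k _ => mm k) m_ge0 c_gt0 m_tail n_gt0.
have lc := layer_cake P n.-1 mA (measurable_cst (1 : R)) A0 (fun=> ler01).
have m0E (s : R) : ((power_weight n.-1 s)%:E * \int[P]_x (1 * (s < A x)%R%:R)%:E =
    (power_weight n.-1 s * m 0%N s)%:E)%E.
  have [s0|s0] := ltP 0 s; last by rewrite /power_weight ltNge s0 /= !mul0r mul0e.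
  rewrite [RHS]EFinM; congr (_ * _)%E; rewrite /m (ltW s0) muln0.
  rewrite /moment /Rintegral fineK; last first.
    exact: (integrable_fin_num measurableT (imoment (lexx 0) (ltW s0))).
  apply: ae_eq_integral => //.
  - apply/measurable_EFinP; apply: measurable_funM => //.
    by apply: measurable_bool_natr; exact: measurable_fun_ltr.
  - apply/measurable_EFinP; apply: measurableT_comp (mV (ltW s0)); exact: measurable_power_pos.
  - apply: filterS AV => w AVw _; rewrite -AVw ?ltW// mul1r /power_pos powRr0.
    by case: ifP.
have {}lc := etrans lc (@eq_integral _ (measurableTypeR R) R mu setT _ _ (fun s _ => m0E s)).
move: prec; rewrite -lc; set I := (\int[P]_x (_ / _ * _)%:E)%E => prec.
have nE : n.-1.+1 = n by rewrite prednK.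
have n0 : n%:R != 0 :> R by rewrite pnatr_eq0 -lt0n.
have I0 : (0 <= I)%E.
  by apply: integral_ge0 => w _; rewrite lee_fin mulr1 divr_ge0// exprn_ge0.
have -> : (\int[P]_w (A w ^+ n)%:E = n%:R%:E * I)%E.
  rewrite -ge0_integralZl_EFin//.
  - by apply: eq_integral => w _; rewrite nE -EFinM /= mulr1 mulrC divfK.
  - by move=> w _; rewrite lee_fin mulr1 divr_ge0// exprn_ge0.
  - apply/measurable_EFinP; apply: measurable_funM => //; apply: measurable_funM => //.
    by apply: measurable_funX.
have mn : m n 0 = z0 ^+ (2 * n).
  rewrite -[n]nE; have [_ ->] := m_formula n.-1 (lexx 0).
  by rewrite set_itv1 Rintegral_set1 mulr0 subr0.
pose L := \prod_(k < n) (2 * b - (2 * k + 1)%:R * kappa).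
have cE : \prod_(k < n) c k = n`!%:R * L.
  rewrite /c big_split /=; congr (_ * _).
  elim: (n) => [|p IH]; first by rewrite big_ord0.
  by rewrite big_ord_recr /= IH factS natrM mulrC.
have L0 : 0 < L.
  apply: prodr_gt0 => k _; have := c_gt0 (ltn_ord k).
  by rewrite /c pmulr_rgt0// ltr0n.
have f0 : 0 < n.-1`!%:R :> R by rewrite ltr0n fact_gt0.
have cf : \prod_(k < n) c k / n.-1`!%:R = n%:R * L.
  by rewrite cE -[in n`!]nE factS nE natrM; field; rewrite gt_eqF.
(* A positive multiple of [I] equals a real number, so [I] is finite. *)
move: prec; rewrite mn cf; case: I I0 => [r _|_|//].
- by rewrite -!EFinM -/L => -[->]; congr EFin; field; rewrite gt_eqF.
- by rewrite gt0_muley ?lte_fin// mulr_gt0// ltr0n.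
Qed.
End lifetime.

(** * Application to the trajectories of SLE *)

Section sle.
Context d (T : measurableType d) (R : realType) (P : probability T R).
Variables (F : R -> set_system T) (B X Y : R -> T -> R).
Variables (kappa x y : R).
Hypothesis sle : sle_kappa_rho P F B kappa (kappa - 6) x y X Y.
Let tau w := collision_time (X ^~ w) (Y ^~ w).
Let bm : brownian_motion P F B. Proof. exact: sle_brownian sle. Qed.

(** Adaptedness is assumed on the event t < tau only. Taking [A] to be everything puts this event
    and its complement in [F t]; the value on the complement is 0, whence the cases on [A 0]. *)
Lemma adapted_stopped (Z : R -> T -> R) t : 0 <= t ->
  (forall A, measurable A -> F t [set w | (t%:E < tau w)%E /\ A (Z t w)]) ->
  adapted_at F t (fun w => if (t%:E < tau w)%E then Z t w else 0).
Proof.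
move=> t0 FZ A mA.
have FT : F t setT.
  have [sF _ _] := bm_filtration bm; have [F0 FC _] := sF t t0.
  by rewrite -(setD0 setT); exact: FC.
have FD : F t [set w | ~~ (t%:E < tau w)%E].
  rewrite (_ : [set w | _] = setT `\` [set w | (t%:E < tau w)%E /\ [set: R] (Z t w)]).
    by apply: (adapted_setD bm) => //; exact: FZ.
  apply/seteqP; split => w /=.
    by move=> /negP h; split => // -[].
  by move=> [_ h]; apply/negP => ?; exact: h.
have [A0|A0] := pselect (A 0).
  rewrite (_ : _ @^-1` A = [set w | (t%:E < tau w)%E /\ A (Z t w)] `|` [set w | ~~ (t%:E < tau w)%E]).
    by apply: (adapted_setU bm) => //; exact: FZ.
  apply/seteqP; split => w /=; first by case: ifP => h Aw; [left|right].
  by case: ifP => h [[]|].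
rewrite (_ : _ @^-1` A = [set w | (t%:E < tau w)%E /\ A (Z t w)]); first exact: FZ.
apply/seteqP; split => w /=; first by case: ifP.
by move=> [->].
Qed.

(** [X] and [Y] are arbitrary from tau on, hence the explicit 0. The sign makes the process start
    from |x - y|, and along a trajectory it stays positive up to tau. *)
Definition sle_bessel (t : R) (w : T) : R :=
  if (t%:E < tau w)%E then Num.sg (x - y) * (X t w - Y t w) else 0.

Lemma adapted_sle_bessel t : 0 <= t -> adapted_at F t (sle_bessel t).
Proof.
move=> t0.
have aX := adapted_stopped t0 (fun A mA => sle_adaptedX sle t0 mA).
have aY := adapted_stopped t0 (fun A mA => sle_adaptedY sle t0 mA).
have := adapted_at_comp (mulrl_measurable (Num.sg (x - y))) (adapted_atB bm t0 aX aY).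
congr (adapted_at F t _); apply/funext => w; rewrite /sle_bessel.
by case: ifP => _ //; rewrite subrr mulr0.
Qed.
End sle.

Theorem mainTheorem2 (R : realType) (d : measure_display)
    (T : measurableType d) (P : probability T R) (F : R -> set_system T)
    (B X Y : R -> T -> R) (a : nat -> {RV P >-> R})
    (n : nat) (kappa x y : R) :
  (1 <= n)%N ->
  0 < kappa < 8 / (2 * n + 1)%:R ->
  x != y ->
  sle_kappa_rho P F B kappa (kappa - 6) x y X Y ->
  {ae P, forall w, let tau := collision_time (X ^~ w) (Y ^~ w) in
    (tau < +oo)%E ->
    expansion_at_infinity (loewner_hull (X ^~ w) (fine tau))
      (loewner_map (X ^~ w) (fine tau)) (fun k => a k w)} ->
  ('E_P[(fun w => (a 1%N w ^+ n)%R)])%E =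
    (2 ^+ n * (x - y) ^+ (2 * n)
     / \prod_(1 <= j < n.+1) (8 - (2 * j + 1)%:R * kappa))%:E.
Proof.
move=> n0 /andP[k0 kn] xy sle expansion.
have kn8 : (2 * n + 1)%:R * kappa < 8 by move: kn; rewrite ltr_pdivlMr ?ltr0n ?addn1// mulrC.
have k83 : 3 * kappa < 8.
  apply: le_lt_trans kn8; apply: ler_wpM2r; first exact: ltW.
  by rewrite ler_nat addn1 ltnS leq_pmulr.
have k4 : kappa < 4 by lra.
have b0 : 0 < 4 - kappa by lra.
have xy0 : x - y != 0 by rewrite subr_eq0.
(* The sign of x - y is kept in the noise coefficient; the generator only sees [sigma ^+ 2]. *)
pose sg := Num.sg (x - y); pose sigma := sg * Num.sqrt kappa.
have sigma2 : sigma ^+ 2 = kappa.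
  by rewrite exprMn sqr_sg xy0 mul1r sqr_sqrtr// ltW.
have sigma0 : sigma != 0 by apply: contraTneq k0 => s0; rewrite -sigma2 s0 expr0n ltxx.
have z0 : 0 < `|x - y| by rewrite normr_gt0.
have bm := sle_brownian sle.
have aV := adapted_sle_bessel (x := x) (y := y) sle.
pose V := sle_bessel X Y x y.
have HV : {ae P, forall w, bessel_path (4 - kappa) `|x - y| (fun t => sigma * B t w) (V ^~ w)}.
  by apply: filterS (sle_solution sle) => w; exact: sle_bessel_path.
have n_small : (2 * n)%:R * kappa < 2 * (4 - kappa) + kappa.
  by move: kn8; rewrite natrD; lra.
pose tau w := collision_time (X ^~ w) (Y ^~ w).
have alive : {ae P, forall w s, 0 <= s -> (0 < V s w) = (s%:E < tau w)%E}.
  by apply: filterS (sle_solution sle) => w traj s s0; exact: (sle_bessel_gt0 xy traj).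
(* The expansion is assumed only when tau is finite, so finiteness has to come from extinction
   beforehand. *)
have finite : {ae P, forall w, (tau w < +oo)%E}.
  apply: filterS2 alive (extinction bm b0 sigma0 sigma2 aV HV z0 n0 n_small) => w al [k Vk].
  have := al k%:R (ler0n _ _); rewrite ltNge Vk /= => /esym/negbT; rewrite -leNgt => h.
  exact: le_lt_trans h (ltry _).
have capacity : {ae P, forall w, a 1%N w = 2 * fine (tau w) /\ 0 < fine (tau w)}.
  near=> w.
  have traj : sle_trajectory kappa (kappa - 6) x y (B ^~ w) (X ^~ w) (Y ^~ w) by near: w; exact: sle_solution sle.
  have cB : {within `[0, +oo[, continuous (B ^~ w)} by near: w; exact: bm_continuous bm.
  have fin : (tau w < +oo)%E by near: w.
  have [tau0 [C XC]] := sle_driving_bounded k4 xy cB traj fin.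
  split => //; apply: (@expansion_capacity R _ _ C (fun k => a k w) tau0 XC); move: fin; near: w.
  exact: expansion.
(* Measurability comes from [a 1], which is a random variable; no measurability of tau is assumed.
   Cutting at 0 makes [A] nonnegative everywhere, and almost surely it equals tau. *)
pose A w := Num.max (a 1%N w / 2) 0.
have mA : measurable_fun setT A by apply: measurable_maxr => //; apply: measurable_funM.
have A0 w : 0 <= A w by rewrite le_max lexx orbT.
have AE : {ae P, forall w, A w = fine (tau w)}.
  apply: filterS capacity => w [aw tw]; rewrite /A aw mulrC mulrA mulVf// mul1r.
  by apply/max_idPl; exact: ltW.
have AV : {ae P, forall w s, 0 <= s -> (0 < V s w) = (s < A w)}.
  near=> w => s s0.
  have al : forall s, 0 <= s -> (0 < V s w) = (s%:E < tau w)%E by near: w.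
  have Aw : A w = fine (tau w) by near: w.
  have fin : (tau w < +oo)%E by near: w.
  have [_ tw] : a 1%N w = 2 * fine (tau w) /\ 0 < fine (tau w) by near: w.
  by rewrite al// Aw -lte_fin fineK//; move: tw fin; case: (tau w); rewrite //= ltxx.
have EA := lifetime_moment bm b0 sigma0 sigma2 aV HV z0 n0 n_small mA A0 AV.
rewrite unlock.
transitivity (\int[P]_w ((2 ^+ n)%:E * (A w ^+ n)%:E))%E.
  apply: ae_eq_integral => //.
  - by apply/measurable_EFinP; apply: measurable_funX.
  - by apply/measurable_EFinP; apply: measurable_funM => //; apply: measurable_funX.
  - by apply: filterS2 AE capacity => w -> [-> _] _; rewrite -EFinM exprMn.
rewrite ge0_integralZl_EFin//; first 1 last.
- by move=> w _; rewrite lee_fin exprn_ge0.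
- by apply/measurable_EFinP; exact: measurable_funX.
rewrite EA -EFinM; congr EFin; rewrite mulrA; congr (_ * _ / _).
  by rewrite exprM [in RHS]exprM real_normK// num_real.
(* With j = k + 1 and b = 4 - kappa, both factors are 8 - (2 k + 3) kappa. *)
rewrite big_add1 /= big_mkord; apply: eq_bigr => k _.
by rewrite mulnS !natrD; ring.
Unshelve. all: by end_near. Qed.
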